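(* Let $C_0\ge e$, $c_0>0$, $q>0$, $K>0$, $\kappa>0$ be constants. There exist an integer $n_0\ge2$ and constants $C\ge e$, $c>0$, depending only on $C_0,c_0,q,K,\kappa$, such that the following holds for all integers $n\ge n_0$ and $p\ge1$ with $p\le\kappa n$, all $z_0\in(0,1)$ with $1/z_0\le\kappa$ and all $z>z_0$. Let $X=(x_1,\dots,x_n)$ be a random $p\times n$ matrix satisfying (A1), (A2) and one of (A3), (A3'). Let $F$ be the spectral distribution of $S=\frac1nXX^T$ and $m_F(-z)=\frac1p\operatorname{Tr}\left((S+zI_p)^{-1}\right)$ its Stieltjes transform at $-z$. Then $$m_F(-z)\in\frac1p\operatorname{Tr}\tilde Q^{\delta'}(z)\pm Ce^{-\left(\sqrt{n/\log n}\ \cdot\right)^q/c},$$ where $$\tilde Q^{\delta'}(z)=\left(\frac1n\sum_{i=1}^n\frac{\Sigma_i}{1+\delta'_i}+zI_p\right)^{-1},\qquad \Sigma_i=\mathbb E[x_ix_i^T],$$ with $\delta'=(\delta'_1,\dots,\delta'_n)$ the unique solution in $\mathbb R_+^n$ of $$\delta'_i=\frac1n\operatorname{Tr}\left(\Sigma_i\left(\frac1n\sum_{j\ne i}\frac{\Sigma_j}{1+\delta'_j}+zI_p\right)^{-1}\right),\qquad 1\le i\le n.$$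
   Context: For a non-increasing $\alpha:\mathbb R_+\to\mathbb R_+$ (values above $1$ read as $1$) and a real random variable $W$: $W\propto\alpha$ means $\mathbb P(|W-W'|\ge t)\le\alpha(t)$ for all $t>0$, $W'$ an independent copy of $W$; $W\in a\pm\alpha$ means $\mathbb P(|W-a|\ge t)\le\alpha(t)$ for all $t>0$. The dot in $\alpha$ stands for $t$. A random vector $Z$ of a normed space $V$ satisfies $Z\propto_c\alpha$ (convex concentration) if $f(Z)\propto\alpha$ for every $1$-Lipschitz quasiconvex $f:V\to\mathbb R$ (quasiconvex: all sublevel sets $\{f\le t\}$ are convex). The spectral distribution of $S$ is the normalized counting measure of its eigenvalues, and $m_F(w)=\int\frac{dF(\lambda)}{\lambda-w}$. Assumptions, with constants $C_0,c_0,q,K$ not depending on $n,p$; here $m_i=\mathbb E[x_i]$ is decomposed as $m_i=\mathring m_i+s$ with deterministic $\mathring m_i,s\in\mathbb R^p$ ($s$ not depending on $i$): (A1) $x_1,\dots,x_n\in\mathbb R^p$ are independent (not necessarily identically distributed). (A2) $X\propto_cC_0e^{-(\cdot)^q/c_0}$ in the space $\mathcal M_{p,n}$ of real $p\times n$ matrices with the Frobenius norm. (A3) for all $i$, $\mathbb E\|x_i\|\le K\sqrt p$ and $\|\mathring m_i\|\le K$ (Euclidean norms). (A3') $q\ge2$, $\|s\|\le K\sqrt p$ and $\sup_i\|\mathring m_i\|\le K$. The existence and uniqueness of $\delta'$ is part of the setting (a separate result of the paper). *)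

(* Defs.v *)
From HB Require Import structures.
From mathcomp Require Import all_boot all_order all_algebra.
From mathcomp Require Import all_classical all_reals all_analysis.
From mathcomp Require Import polyrcf.

Set Implicit Arguments.
Unset Strict Implicit.
Unset Printing Implicit Defensive.

Import Order.TTheory GRing.Theory Num.Theory.
Import numFieldNormedType.Exports.

Local Open Scope classical_set_scope.
Local Open Scope ring_scope.

(* The library norm on matrices is the sup norm, hence the explicit Frobenius
   norm; on column vectors it is the Euclidean norm. *)
Definition frobenius (R : realType) (m n : nat) (A : 'M[R]_(m, n)) : R :=
  Num.sqrt (\sum_(i < m) \sum_(j < n) A i j ^+ 2).

Definition quasiconvex (R : realType) (V : lmodType R) (f : V -> R) : Prop :=
  forall t : R, convex_set ([set v | f v <= t] : set (convex_lmodType V)).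

(* "1-Lipschitz" is relative to a norm N given separately from V, because the
   norm of interest on matrices is not the canonical one. *)
Definition lipschitz1 (R : realType) (V : lmodType R) (N : V -> R)
    (f : V -> R) : Prop :=
  forall u v : V, `|f u - f v| <= N (u - v).

(* Concentration of measure.  Reading values of alpha above 1 as 1 changes
   nothing below, since alpha only occurs as an upper bound on a probability. *)
Section Concentration.
Context d (T : measurableType d) (R : realType) (P : probability T R).

(* W \propto alpha: the pair (W, W'), W' an independent copy of W, is realised
   on the product space P \x P. *)
Definition concentrated (W : T -> R) (alpha : R -> R) : Prop :=
  forall t : R, 0 < t ->
    ((P \x P) [set w : T * T | (t <= `|W w.1 - W w.2|)%R] <= (alpha t)%:E)%E.

(* W \in a \pm alpha *)
Definition concentrated_around (W : T -> R) (a : R) (alpha : R -> R) : Prop :=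
  forall t : R, 0 < t ->
    (P [set w : T | (t <= `|W w - a|)%R] <= (alpha t)%:E)%E.

(* Z \propto_c alpha *)
Definition convexly_concentrated (V : lmodType R) (N : V -> R) (Z : T -> V)
    (alpha : R -> R) : Prop :=
  forall f : V -> R, lipschitz1 N f -> quasiconvex f ->
    concentrated (f \o Z) alpha.

End Concentration.

Section RandomMatrices.
Context d (T : measurableType d) (R : realType) (P : probability T R).

(* Borel sets of R^(m x n), as the product sigma-algebra generated by the
   entries. *)
Definition mx_borel (m n : nat) : set (set 'M[R]_(m, n)) :=
  <<s [set A | exists i j, exists2 B : set R, measurable B &
                 A = (fun M : 'M[R]_(m, n) => M i j) @^-1` B] >>.

Definition random_mx (m n : nat) (X : T -> 'M[R]_(m, n)) : Prop :=
  forall i j, measurable_fun setT (fun w => X w i j).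

(* Mutual independence; subfamilies are covered by taking B i = setT. *)
Definition independent_vectors (p n : nat) (x : 'I_n -> T -> 'cV[R]_p) : Prop :=
  forall B : 'I_n -> set 'cV[R]_p, (forall i, mx_borel (B i)) ->
    P [set w | forall i, B i (x i w)] =
    (\prod_(i < n) P [set w | B i (x i w)])%E.

Definition mx_expectation (m n : nat) (Z : T -> 'M[R]_(m, n)) : 'M[R]_(m, n) :=
  \matrix_(i, j) fine 'E_P[fun w => Z w i j].

Definition second_moment (p : nat) (x : T -> 'cV[R]_p) : 'M[R]_p :=
  mx_expectation (fun w => x w *m (x w)^T).

End RandomMatrices.

Section Spectrum.
Context (R : realType).

(* The real eigenvalues of A, repeated according to their multiplicity in the
   characteristic polynomial; for symmetric A this is the whole spectrum. *)
Definition eigenvalues (p : nat) (A : 'M[R]_p) : seq R :=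
  flatten [seq nseq (mup a (char_poly A)) a | a <- rootsR (char_poly A)].

Definition spectral_distribution (p : nat) (A : 'M[R]_p) :
    {measure set R -> \bar R} :=
  mscale (p%:R^-1)%:nng
    (msum (fun k : nat => \d_((eigenvalues A)`_k)) (size (eigenvalues A))).

(* m_F(w), for real w outside the support of F *)
Definition stieltjes (F : {measure set R -> \bar R}) (w : R) : R :=
  \int[F]_(x in setT) (x - w)^-1.

End Spectrum.

Section DeterministicEquivalent.
Context (R : realType) (p n : nat) (Sigma : 'I_n -> 'M[R]_p) (z : R).

(* The sum is restricted to the indices in J, so as to cover both the full sum
   and the sum over j != i. *)
Definition tildeQ_on (J : pred 'I_n) (delta : 'rV[R]_n) : 'M[R]_p :=
  invmx (n%:R^-1 *: (\sum_(j < n | J j) (1 + delta 0 j)^-1 *: Sigma j) + z%:M).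

Definition tildeQ (delta : 'rV[R]_n) : 'M[R]_p := tildeQ_on predT delta.

Definition delta_equation (delta : 'rV[R]_n) : Prop :=
  (forall i, 0 <= delta 0 i) /\
  (forall i, delta 0 i =
     n%:R^-1 * \tr (Sigma i *m tildeQ_on (fun j => j != i) delta)).

End DeterministicEquivalent.

(* Main.v *)
(* Every norm of a linear image of X is convex and Lipschitz, so its centred
   moments are bounded.  The trace of B^T Q B, Q = (X X^T / n + z)^-1, becomes
   convex after adding a multiple of |X|^2 / n, and the truncated suprema of its
   tangents are convex Lipschitz functions that agree with it on large balls;
   hence tr (D Q) / p fluctuates at scale n^(-1/2) for D = 1 and D = C_i, where
   C_i is the covariance matrix of x_i.

   For the bias let Q_i be the resolvent without the column x_i and
   delta_i = E tr (C_i Q) / n.  The rank one update formula and the concentration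
   of x_i^T Q_i x_i / n around delta_i give E tr (D Q) = tr (D Qt) + O(p n^(-1/2)),
   where Qt is the deterministic equivalent built from delta.  With D = C_i this
   says that delta solves the fixed point equation up to O(n^(-1/2)).  The means
   m_i may have norm of order sqrt p, but they are all close to one vector s, and
   the inverse damps the direction of s: m_i^T Qt m_i = O(1).  The equation is
   stable for the weighted distance max |d_i - d'_i| / sqrt ((1 + d_i) (1 + d'_i)),
   so delta, and with it Qt, may be replaced by delta'. *)
Require Import Defs.
From HB Require Import structures.
From mathcomp Require Import all_boot all_order all_algebra.
From mathcomp Require Import all_classical all_reals all_analysis.
From mathcomp Require Import measurable_realfun spectral polyrcf complex.
From mathcomp Require Import ring lra.

Set Implicit Arguments.
Unset Strict Implicit.
Unset Printing Implicit Defensive.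

Import Order.TTheory GRing.Theory Num.Theory.
Import numFieldNormedType.Exports.

Local Open Scope classical_set_scope.
Local Open Scope ring_scope.

(** * Positive definite matrices *)

(** Because of the means, the second moments [Sigma i] may have operator norm of order p. That is
    why [delta] is built from the covariances: a factor B of C_i satisfies |B^T U| <= sqrt V |U|
    with V independent of the dimension, which is what the trace concentration needs, and the
    missing term m_i^T Q m_i / n is only of order 1/n. The ball of the truncation has radius of
    order sqrt (n p), a multiple of the bound on the mean of |X|. On it the slopes of the trace are
    of order sqrt (p / n), so sqrt n times the normalised trace has Lipschitz constant of order 1 /
    sqrt p. The bias needs only moments up to order four and the variance of the traces. Constants
    must not depend on n, p or the probability space, so the bounds drawn from concentration are
    proved uniformly over all spaces. The deviation is obtained at scale n^(-1/2); the logarithm of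
    the statement is a weakening made at the very end. *)

Lemma discriminant_le (R : realFieldType) (a b c : R) :
  0 <= c -> (forall t : R, 0 <= a - 2 * t * b + t ^+ 2 * c) -> b ^+ 2 <= a * c.
Proof.
move=> c0 h; case: (eqVneq c 0) => [cE|cN]; last first.
  have cp : 0 < c by rewrite lt_def cN.
  have := h (b / c).
  have -> : a - 2 * (b / c) * b + (b / c) ^+ 2 * c = (a * c - b ^+ 2) / c.
    by field.
  by rewrite pmulr_lge0 ?invr_gt0// subr_ge0.
rewrite cE mulr0; case: (eqVneq b 0) => [->|bN]; first by rewrite expr0n.
(* With [c = 0] the polynomial is affine in t, and this point gives it the value -1. *)
have := h ((a + 1) / (2 * b)).
have -> : a - 2 * ((a + 1) / (2 * b)) * b + ((a + 1) / (2 * b)) ^+ 2 * c = - 1.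
  by rewrite cE; field.
by rewrite oppr_ge0 ler10.
Qed.

Section FrobeniusInnerProduct.
Variable R : rcfType.
Implicit Types m n k : nat.

(** The trace inner product: Frobenius on matrices and Euclidean on column vectors, so one
    Cauchy-Schwarz inequality serves both. *)
Definition ip m n (A B : 'M[R]_(m, n)) : R := \tr (A^T *m B).

Lemma ipE m n (A B : 'M[R]_(m, n)) :
  ip A B = \sum_(i < m) \sum_(j < n) A i j * B i j.
Proof.
rewrite exchange_big; apply: eq_bigr => j _; rewrite mxE.
by apply: eq_bigr => i _; rewrite mxE.
Qed.

Lemma ipC m n (A B : 'M[R]_(m, n)) : ip A B = ip B A.
Proof. by rewrite /ip -mxtrace_tr trmx_mul trmxK. Qed.

Lemma ipDr m n (A B C : 'M[R]_(m, n)) : ip A (B + C) = ip A B + ip A C.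
Proof. by rewrite /ip mulmxDr mxtraceD. Qed.

Lemma ipDl m n (A B C : 'M[R]_(m, n)) : ip (A + B) C = ip A C + ip B C.
Proof. by rewrite ipC ipDr !(ipC C). Qed.

Lemma ipZr m n a (A B : 'M[R]_(m, n)) : ip A (a *: B) = a * ip A B.
Proof. by rewrite /ip -scalemxAr mxtraceZ. Qed.

Lemma ipZl m n a (A B : 'M[R]_(m, n)) : ip (a *: A) B = a * ip A B.
Proof. by rewrite ipC ipZr ipC. Qed.

Lemma ipNr m n (A B : 'M[R]_(m, n)) : ip A (- B) = - ip A B.
Proof. by rewrite -scaleN1r ipZr mulN1r. Qed.

Lemma ipNl m n (A B : 'M[R]_(m, n)) : ip (- A) B = - ip A B.
Proof. by rewrite ipC ipNr ipC. Qed.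

Lemma ipBr m n (A B C : 'M[R]_(m, n)) : ip A (B - C) = ip A B - ip A C.
Proof. by rewrite ipDr ipNr. Qed.

Lemma ipBl m n (A B C : 'M[R]_(m, n)) : ip (A - B) C = ip A C - ip B C.
Proof. by rewrite ipDl ipNl. Qed.

Lemma ip0r m n (A : 'M[R]_(m, n)) : ip A 0 = 0.
Proof. by rewrite /ip mulmx0 mxtrace0. Qed.

Lemma ip_sumr m n (I : Type) (r : seq I) (Pr : pred I) (A : 'M[R]_(m, n)) F :
  ip A (\sum_(i <- r | Pr i) F i) = \sum_(i <- r | Pr i) ip A (F i).
Proof. by rewrite /ip mulmx_sumr raddf_sum. Qed.

Definition ip_lin := (ipDl, ipDr, ipBl, ipBr, ipNl, ipNr, ipZl, ipZr).

Lemma ip_mulml m n k (M : 'M[R]_(k, m)) (A : 'M[R]_(m, n)) B :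
  ip (M *m A) B = ip A (M^T *m B).
Proof. by rewrite /ip trmx_mul mulmxA. Qed.

Lemma ip_mulmr m n k (M : 'M[R]_(m, k)) (A : 'M[R]_(m, n)) B :
  ip A (M *m B) = ip (M^T *m A) B.
Proof. by rewrite ip_mulml trmxK. Qed.

Lemma ip_tr m n (A B : 'M[R]_(m, n)) : ip A^T B^T = ip A B.
Proof. by rewrite /ip trmxK mxtrace_mulC -mxtrace_tr trmx_mul trmxK. Qed.

Lemma ip_mulmxr m n k (M : 'M[R]_(k, n)) (A : 'M[R]_(m, k)) B :
  ip (A *m M) B = ip A (B *m M^T).
Proof. by rewrite -ip_tr trmx_mul ip_mulml -ip_tr trmx_mul !trmxK. Qed.

Lemma ip_ge0 m n (A : 'M[R]_(m, n)) : 0 <= ip A A.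
Proof.
rewrite ipE; apply: sumr_ge0 => i _; apply: sumr_ge0 => j _.
exact: sqr_ge0.
Qed.

Lemma ip_eq0 m n (A : 'M[R]_(m, n)) : (ip A A == 0) = (A == 0).
Proof.
apply/idP/eqP => [|->]; last by rewrite ip0r.
rewrite ipE psumr_eq0 => [/allP h|i _]; last first.
  by apply: sumr_ge0 => j _; exact: sqr_ge0.
apply/matrixP => i j; rewrite mxE; move: (h i (mem_index_enum _)) => /=.
rewrite psumr_eq0 => [/allP/(_ j (mem_index_enum _))/=|k _]; last exact: sqr_ge0.
by rewrite mulf_eq0 orbb => /eqP.
Qed.

Lemma ip_CS m n (A B : 'M[R]_(m, n)) : ip A B ^+ 2 <= ip A A * ip B B.
Proof.
apply: discriminant_le; first exact: ip_ge0.
move=> t; have := ip_ge0 (A - t *: B).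
by rewrite !ip_lin (ipC B A); lra.
Qed.

Definition fnorm m n (A : 'M[R]_(m, n)) : R := Num.sqrt (ip A A).

Lemma fnorm_ge0 m n (A : 'M[R]_(m, n)) : 0 <= fnorm A.
Proof. exact: sqrtr_ge0. Qed.

Lemma sqr_fnorm m n (A : 'M[R]_(m, n)) : fnorm A ^+ 2 = ip A A.
Proof. by rewrite sqr_sqrtr// ip_ge0. Qed.

Lemma ip_le_fnorm m n (A B : 'M[R]_(m, n)) : `|ip A B| <= fnorm A * fnorm B.
Proof.
rewrite -[leRHS]ger0_norm ?mulr_ge0 ?fnorm_ge0//.
by rewrite -ler_sqr ?nnegrE// !real_normK ?num_real// exprMn !sqr_fnorm ip_CS.
Qed.

Lemma fnormD m n (A B : 'M[R]_(m, n)) : fnorm (A + B) <= fnorm A + fnorm B.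
Proof.
rewrite -ler_sqr ?nnegrE ?addr_ge0 ?fnorm_ge0//.
have := ip_le_fnorm A B; rewrite ler_norml => /andP[_ h].
rewrite sqrrD !sqr_fnorm !ip_lin (ipC B A) -mulr_natr; lra.
Qed.

Lemma fnormZ m n a (A : 'M[R]_(m, n)) : fnorm (a *: A) = `|a| * fnorm A.
Proof.
by rewrite /fnorm !ip_lin mulrA -expr2 sqrtrM ?sqr_ge0// sqrtr_sqr.
Qed.

Lemma fnormN m n (A : 'M[R]_(m, n)) : fnorm (- A) = fnorm A.
Proof. by rewrite -scaleN1r fnormZ normrN1 mul1r. Qed.

Lemma fnormB m n (A B : 'M[R]_(m, n)) : fnorm (A - B) <= fnorm A + fnorm B.
Proof. by rewrite -(fnormN B) fnormD. Qed.

Lemma fnorm_dist m n (A B : 'M[R]_(m, n)) :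
  `|fnorm A - fnorm B| <= fnorm (A - B).
Proof.
have := fnormD (A - B) B; have := fnormD (B - A) A; rewrite !subrK.
rewrite -(fnormN (B - A)) opprB => h1 h2; rewrite ler_norml; lra.
Qed.

(** Reduces quadratic bounds for matrices to column vectors: it is applied with [V = M *m U], whose
    columns are the images of those of [U]. *)
Lemma ip_le_cols m n (U V : 'M[R]_(m, n)) :
  ip U V = \sum_j ip (col j U) (col j V).
Proof.
rewrite ipE exchange_big; apply: eq_bigr => j _; rewrite ipE.
by apply: eq_bigr => i _; rewrite big_ord1 !mxE.
Qed.

Lemma ip_outer m (A : 'M[R]_m) (u v : 'cV[R]_m) :
  \tr (A *m (u *m v^T)) = ip v (A *m u).
Proof. by rewrite mulmxA mxtrace_mulC. Qed.

End FrobeniusInnerProduct.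

Section Coercive.
Variable R : rcfType.
Implicit Types m n k p : nat.

Definition psd p (M : 'M[R]_p) : Prop :=
  M^T = M /\ forall u : 'cV[R]_p, 0 <= ip u (M *m u).

Lemma psd_ip p (M : 'M[R]_p) : psd M ->
  forall k (U : 'M[R]_(p, k)), 0 <= ip U (M *m U).
Proof.
move=> [_ h] k U; rewrite ip_le_cols; apply: sumr_ge0 => j _.
by rewrite [col j (M *m U)]colE -mulmxA -colE h.
Qed.

Lemma psdD p (M N : 'M[R]_p) : psd M -> psd N -> psd (M + N).
Proof.
move=> [sM hM] [sN hN]; split=> [|u]; first by rewrite raddfD /= sM sN.
by rewrite mulmxDl ipDr addr_ge0.
Qed.

Lemma psdZ p a (M : 'M[R]_p) : 0 <= a -> psd M -> psd (a *: M).
Proof.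
move=> a0 [sM hM]; split=> [|u]; first by rewrite linearZ /= sM.
by rewrite -scalemxAl ipZr mulr_ge0.
Qed.

Lemma psd0 p : psd (0 : 'M[R]_p).
Proof. by split=> [|u]; rewrite ?trmx0// mul0mx ip0r. Qed.

Lemma psd_sum p (I : Type) (r : seq I) (Pr : pred I) (F : I -> 'M[R]_p) :
  (forall i, Pr i -> psd (F i)) -> psd (\sum_(i <- r | Pr i) F i).
Proof. by move=> h; elim/big_ind : _ => //; [exact: psd0|exact: psdD]. Qed.

Lemma psd_gram p k (G : 'M[R]_(p, k)) : psd (G *m G^T).
Proof.
split=> [|u]; first by rewrite trmx_mul trmxK.
by rewrite -mulmxA ip_mulmr ip_ge0.
Qed.

Lemma ip_psd_CS p (M : 'M[R]_p) : psd M -> forall k (U V : 'M[R]_(p, k)),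
  ip U (M *m V) ^+ 2 <= ip U (M *m U) * ip V (M *m V).
Proof.
move=> hM k U V; apply: discriminant_le; first exact: psd_ip.
move=> t; have := psd_ip hM (U - t *: V).
have e : ip V (M *m U) = ip U (M *m V) by rewrite ip_mulmr hM.1 ipC.
by rewrite mulmxBr -scalemxAr !ip_lin e; lra.
Qed.

(** The order relation A >= z, expressed by quadratic forms so that no eigenvalues are involved. *)
Definition coercive p (z : R) (A : 'M[R]_p) : Prop :=
  A^T = A /\ forall u : 'cV[R]_p, z * ip u u <= ip u (A *m u).

Lemma coercive_psdD p (z : R) (M : 'M[R]_p) : psd M -> coercive z (M + z%:M).
Proof.
move=> [sM hM]; split=> [|u]; first by rewrite raddfD /= sM tr_scalar_mx.
by rewrite mulmxDl mul_scalar_mx !ip_lin lerDr.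
Qed.

Section Inverse.
Variables (p : nat) (z : R) (A : 'M[R]_p).
Hypotheses (z0 : 0 < z) (hA : coercive z A).

(** By symmetry a row vector of the left kernel transposes to a column vector killed by [A], whose
    norm vanishes by coercivity. *)
Lemma coercive_unit : A \in unitmx.
Proof.
rewrite -row_free_unit -kermx_eq0; apply/eqP/row_matrixP => i.
rewrite row0; set v := row i _.
have vA : v *m A = 0 by rewrite -row_mul mulmx_ker row0.
have Av : A *m v^T = 0 by rewrite -[A in LHS]hA.1 -trmx_mul vA trmx0.
have := hA.2 v^T; rewrite Av ip0r => h.
have : ip v^T v^T == 0.
  rewrite eq_le ip_ge0 andbT; rewrite pmulr_rle0// in h.
by rewrite ip_eq0 => /eqP/(congr1 trmx); rewrite trmxK trmx0.
Qed.

Lemma coercive_ip k (U : 'M[R]_(p, k)) : z * ip U U <= ip U (A *m U).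
Proof.
rewrite !ip_le_cols mulr_sumr; apply: ler_sum => j _.
by rewrite [col j (A *m U)]colE -mulmxA -colE hA.2.
Qed.

Lemma coercive_inv_sym : (invmx A)^T = invmx A.
Proof. by rewrite trmx_inv hA.1. Qed.

(** With V = A^-1 U one has z |V|^2 <= <V, U> <= |V| |U|; one factor |V| cancels. *)
Lemma coercive_inv_norm k (U : 'M[R]_(p, k)) :
  fnorm (invmx A *m U) <= z^-1 * fnorm U.
Proof.
set V := invmx A *m U.
have UE : U = A *m V by rewrite mulmxA mulmxV ?mul1mx ?coercive_unit.
have := coercive_ip V; rewrite -UE -sqr_fnorm.
have := ip_le_fnorm V U; rewrite ler_norml => /andP[_ h1] h2.
have h3 := le_trans h2 h1.
rewrite mulrC ler_pdivlMr// mulrC.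
case: (eqVneq (fnorm V) 0) => [->|vn0]; first by rewrite mulr0 fnorm_ge0.
have vp : 0 < fnorm V by rewrite lt_def vn0 fnorm_ge0.
by rewrite -(ler_pM2l vp) mulrCA -expr2.
Qed.

Lemma coercive_inv_psd : psd (invmx A).
Proof.
split=> [|u]; first exact: coercive_inv_sym.
set v := invmx A *m u.
have uE : u = A *m v by rewrite mulmxA mulmxV ?mul1mx ?coercive_unit.
by rewrite uE ipC; apply: le_trans (hA.2 v); rewrite mulr_ge0 ?ip_ge0// ltW.
Qed.

Lemma coercive_inv_ip k (U V : 'M[R]_(p, k)) :
  `|ip U (invmx A *m V)| <= z^-1 * (fnorm U * fnorm V).
Proof.
apply: le_trans (ip_le_fnorm _ _) _.
rewrite mulrCA ler_wpM2l ?fnorm_ge0//; exact: coercive_inv_norm.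
Qed.

Lemma coercive_inv_le k (U : 'M[R]_(p, k)) :
  ip U (invmx A *m U) <= z^-1 * ip U U.
Proof.
by apply: le_trans (ler_norm _) _; rewrite -sqr_fnorm expr2 coercive_inv_ip.
Qed.

(* The right-hand side is the concave quadratic function of V whose maximum is
   attained at V = A^-1 B. *)
Lemma inv_variational k (B V : 'M[R]_(p, k)) :
  2 * ip B V - ip V (A *m V) <= ip B (invmx A *m B).
Proof.
have := psd_ip coercive_inv_psd (B - A *m V).
have uA := coercive_unit.
have e1 : ip B V = ip V B by rewrite ipC.
have e2 : ip (A *m V) (invmx A *m B) = ip V B.
  by rewrite ip_mulml hA.1 mulmxA mulmxV// mul1mx.
have e3 : ip (A *m V) V = ip V (A *m V) by rewrite ipC.
rewrite mulmxBr (mulmxA _ A) mulVmx// mul1mx !ip_lin e2 e3 e1; lra.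
Qed.

End Inverse.

(** The resolvent identity, source of the comparisons of inverses below. *)
Lemma invmx_sub p (A B : 'M[R]_p) : A \in unitmx -> B \in unitmx ->
  invmx A - invmx B = invmx A *m (B - A) *m invmx B.
Proof.
move=> uA uB; rewrite mulmxBr mulmxBl mulVmx// mul1mx.
by rewrite -mulmxA mulmxV// mulmx1.
Qed.

(* The part of m lying in the span of the y_j is damped by the inverse. *)
Lemma inv_mean_bound p (z : R) (A : 'M[R]_p) (I : finType) (J : pred I)
    (w : I -> R) (y : I -> 'cV[R]_p) (m : 'cV[R]_p) (W : R) :
  0 < z -> A^T = A -> (forall j, J j -> 0 <= w j) -> 0 < W ->
  W = \sum_(j | J j) w j ->
  (forall u : 'cV[R]_p,
     \sum_(j | J j) w j * ip u (y j) ^+ 2 + z * ip u u <= ip u (A *m u)) ->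
  ip m (invmx A *m m) <=
    2 * (W^-1 + z^-1 * ip (m - W^-1 *: \sum_(j | J j) w j *: y j)
                          (m - W^-1 *: \sum_(j | J j) w j *: y j)).
Proof.
move=> z0 sA w0 W0 WE hA.
have cA : coercive z A.
  split=> // u; apply: le_trans (hA u); rewrite lerDr.
  by apply: sumr_ge0 => j Jj; rewrite mulr_ge0 ?sqr_ge0 ?w0.
set s := \sum_(j | J j) w j *: y j; set r := m - W^-1 *: s.
set u := invmx A *m m; set a := ip m u.
have aE : ip u (A *m u) = a.
  by rewrite /a /u (mulmxA A) mulmxV ?mul1mx ?(coercive_unit z0 cA)// ipC.
have a0 : 0 <= a by rewrite -aE; apply: le_trans (cA.2 u); rewrite mulr_ge0 ?ip_ge0 ?ltW.
have au : a = W^-1 * ip u s + ip u r.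
  by rewrite /a ipC /r ipBr ipZr addrCA subrr addr0.
have hu : \sum_(j | J j) w j * ip u (y j) ^+ 2 + z * ip u u <= a by rewrite -aE.
(* Cauchy-Schwarz with the weights [w j], in the form of a discriminant. *)
have hs : ip u s ^+ 2 <= W * \sum_(j | J j) w j * ip u (y j) ^+ 2.
  rewrite mulrC; apply: discriminant_le; first exact: ltW.
  move=> t.
  have -> : ip u s = \sum_(j | J j) w j * ip u (y j).
    by rewrite ip_sumr; apply: eq_bigr => j _; rewrite ipZr.
  rewrite WE !mulr_sumr -sumrB -big_split /=; apply: sumr_ge0 => j Jj.
  have -> : w j * ip u (y j) ^+ 2 - 2 * t * (w j * ip u (y j)) + t ^+ 2 * w j
    = w j * (ip u (y j) - t) ^+ 2 by ring.
  by rewrite mulr_ge0 ?sqr_ge0 ?w0.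
set b := \sum_(j | J j) _ in hu hs.
have b0 : 0 <= b by apply: sumr_ge0 => j Jj; rewrite mulr_ge0 ?sqr_ge0 ?w0.
have hr := ip_CS u r.
have h1 : (W^-1 * ip u s) ^+ 2 <= W^-1 * b.
  rewrite exprMn; have -> : W^-1 * b = W^-1 ^+ 2 * (W * b).
    by field; rewrite gt_eqF.
  by rewrite ler_wpM2l ?sqr_ge0.
have uu0 := ip_ge0 u; have rr0 := ip_ge0 r.
have Wi : 0 < W^-1 by rewrite invr_gt0.
have zi : 0 < z^-1 by rewrite invr_gt0.
set c := W^-1 * ip u s in au h1; set e := ip u r in au hr.
have [b' [hb' hbb]] : exists b', z * ip u u = b' /\ ip u u = z^-1 * b'.
  by exists (z * ip u u); split=> //; field; rewrite gt_eqF.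
rewrite hb' in hu; rewrite hbb in hr.
have b'0 : 0 <= b' by rewrite -hb' mulr_ge0// ltW.
(* Here a^2 <= 2 (c^2 + e^2), where c^2 is at most W^-1 times the weighted sum of squares and e^2 at
   most |r|^2 |u|^2. That sum and z |u|^2 are both at most a, so a factor a splits off and is
   cancelled at the end. *)
have h2 : a ^+ 2 <= 2 * (W^-1 + z^-1 * ip r r) * a.
  have e1 : a ^+ 2 <= 2 * (c ^+ 2 + e ^+ 2) by rewrite au; have := sqr_ge0 (c - e); nra.
  apply: le_trans e1 _; rewrite -mulrA ler_pM2l//.
  rewrite mulrDl; apply: lerD.
    by apply: le_trans h1 _; rewrite ler_pM2l//; lra.
  apply: le_trans hr _; rewrite mulrAC ler_wpM2l//.
    by rewrite mulr_ge0// ltW.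
  by lra.
case: (eqVneq a 0) => [->|an0].
  by rewrite mulr_ge0// addr_ge0 ?(ltW Wi)// mulr_ge0 ?(ltW zi).
have ap : 0 < a by rewrite lt_def an0.
by rewrite -(ler_pM2r ap) -expr2.
Qed.

End Coercive.

(** * Rank one updates and resolvents *)

Section RankOneUpdate.
Variables (R : rcfType) (p : nat) (z nu : R) (A : 'M[R]_p) (x : 'cV[R]_p).
Hypotheses (z0 : 0 < z) (nu0 : 0 <= nu) (hA : coercive z A).

Let A' := A + nu *: (x *m x^T).
Let Q := invmx A.
Let Q' := invmx A'.

Lemma coercive_update : coercive z A'.
Proof.
split=> [|u].
  by rewrite raddfD /= linearZ /= trmx_mul trmxK hA.1.
rewrite /A' mulmxDl ipDr; apply: le_trans (hA.2 u) _; rewrite lerDl.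
rewrite -scalemxAl ipZr mulr_ge0//; exact: (psd_gram x).2.
Qed.

Let uA : A \in unitmx := coercive_unit z0 hA.
Let uA' : A' \in unitmx := coercive_unit z0 coercive_update.

Let lam := nu * ip x (Q *m x).
Let tau := (1 + lam)^-1.

Lemma update_quad_ge0 : 0 <= nu * ip x (invmx A *m x).
Proof. by rewrite mulr_ge0//; exact: (coercive_inv_psd z0 hA).2. Qed.

Lemma update_tau : 0 < (1 + nu * ip x (invmx A *m x))^-1 <= 1.
Proof.
have h := update_quad_ge0.
rewrite invr_gt0 invf_le1 ?lerDl ?h ?andbT; last by rewrite ltr_pwDl.
by rewrite ltr_pwDl.
Qed.

(** Sherman-Morrison in the direction x alone: A' maps Q x to (1 + lam) x. *)
Lemma invmx_update_mul : invmx A' *m x = tau *: (Q *m x).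
Proof.
have l0 : 1 + lam != 0 by rewrite gt_eqF// ltr_pwDl// update_quad_ge0.
apply: (can_inj (mulKmx uA')).
rewrite mulmxA mulmxV// mul1mx -scalemxAr mulmxDl mulmxA mulmxV// mul1mx.
rewrite -scalemxAl -mulmxA.
have -> : x^T *m (Q *m x) = (ip x (Q *m x))%:M.
  by rewrite [LHS]mx11_scalar /ip /mxtrace big_ord1.
rewrite mul_mx_scalar scalerA -/lam -{2}[x]scale1r -scalerDl scalerA.
by rewrite mulVf// scale1r.
Qed.

(** The resolvent identity leaves Q' x x^T Q, and Q' x is known from [invmx_update_mul]. *)
Lemma invmx_update_sub :
  invmx A' - invmx A = - ((nu * tau) *: (Q *m x *m (Q *m x)^T)).
Proof.
rewrite invmx_sub// opprD addNKr mulmxN mulNmx; congr (- _).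
rewrite -scalemxAr -scalemxAl (mulmxA Q') invmx_update_mul -!scalemxAl.
by rewrite scalerA trmx_mul (coercive_inv_sym hA) -!mulmxA.
Qed.

End RankOneUpdate.

Section GramResolvent.
Variables (R : rcfType) (p n : nat) (z : R).
Hypothesis z0 : 0 < z.
Implicit Types X Y H : 'M[R]_(p, n).

Definition resolvent X : 'M[R]_p := invmx (n%:R^-1 *: (X *m X^T) + z%:M).

Lemma gram_coercive X : coercive z (n%:R^-1 *: (X *m X^T) + z%:M).
Proof. by apply: coercive_psdD; apply: psdZ; [rewrite invr_ge0|exact: psd_gram]. Qed.

Lemma ip_gram X k (V : 'M[R]_(p, k)) :
  ip V ((n%:R^-1 *: (X *m X^T) + z%:M) *m V) =
  n%:R^-1 * ip (X^T *m V) (X^T *m V) + z * ip V V.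
Proof.
rewrite mulmxDl mul_scalar_mx -scalemxAl !ip_lin; congr (_ * _ + _).
by rewrite -mulmxA [RHS]ip_mulml trmxK.
Qed.

(** * Tangents of resolvent traces *)

Section Tangent.
Variables (k : nat) (B : 'M[R]_(p, k)) (b : R).
Hypothesis b0 : 0 <= b.
Hypothesis hB : forall m (U : 'M[R]_(p, m)), fnorm (B^T *m U) <= b * fnorm U.

Let c := b / z.
Let f X := ip B (resolvent X *m B).
Let V X := resolvent X *m B.

(** Transposition moves the norm onto B^T Q H, so the operator bounds of B and Q act on H. The
    Frobenius norm of B, of order sqrt p, does not enter. *)
Lemma fnorm_trmul_resolvent X H : fnorm (H^T *m V X) <= c * fnorm H.
Proof.
have -> : fnorm (H^T *m V X) = fnorm (B^T *m (resolvent X *m H)).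
  rewrite /fnorm -ip_tr; congr (Num.sqrt (ip _ _));
  by rewrite trmx_mul trmxK /V trmx_mul (coercive_inv_sym (gram_coercive X)) mulmxA.
apply: le_trans (hB _) _; rewrite /c -mulrA ler_wpM2l//.
exact: (coercive_inv_norm z0 (gram_coercive X)).
Qed.

(** The differential at X, in the direction H, of the function tr (B^T Q B) + c^2 |X|^2 / n. *)
Definition gram_slope X H : R :=
  2 * n%:R^-1 * (c ^+ 2 * ip X H - ip (X^T *m V X) (H^T *m V X)).

Lemma gram_slopeB X H K : gram_slope X (H - K) = gram_slope X H - gram_slope X K.
Proof. by rewrite /gram_slope raddfB /= mulmxBl !ip_lin; ring. Qed.

Lemma gram_slopeD X H K : gram_slope X (H + K) = gram_slope X H + gram_slope X K.
Proof. by rewrite /gram_slope raddfD /= mulmxDl !ip_lin; ring. Qed.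

Lemma gram_slopeZ X a H : gram_slope X (a *: H) = a * gram_slope X H.
Proof. by rewrite /gram_slope linearZ /= -scalemxAl !ip_lin; ring. Qed.

(** The bound grows with |X|: tangents are uniformly Lipschitz only when their base points stay in a
    ball, hence the truncation later. *)
Lemma gram_slope_le X H :
  `|gram_slope X H| <= 4 * n%:R^-1 * c ^+ 2 * fnorm X * fnorm H.
Proof.
have c0 : 0 <= c by rewrite divr_ge0// ltW.
have n0 : 0 <= 2 * n%:R^-1 :> R by rewrite mulr_ge0// invr_ge0.
rewrite normrM ger0_norm//.
have -> : 4 * n%:R^-1 * c ^+ 2 * fnorm X * fnorm H =
  2 * n%:R^-1 * (c ^+ 2 * (fnorm X * fnorm H) + (c * fnorm X) * (c * fnorm H)).
  by ring.
rewrite ler_wpM2l//; apply: le_trans (ler_normB _ _) _; apply: lerD.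
  by rewrite normrM ger0_norm ?sqr_ge0// ler_wpM2l ?sqr_ge0// ip_le_fnorm.
apply: le_trans (ip_le_fnorm _ _) _.
by apply: ler_pM; rewrite ?fnorm_ge0 ?fnorm_trmul_resolvent.
Qed.

(* Adding a multiple of the squared norm makes the resolvent trace convex: each
   quadratic form X |-> c^2 |X|^2 - |X^T V|^2 is nonnegative. *)
Lemma gram_tangent X Y :
  ip B (resolvent X *m B) + c ^+ 2 * n%:R^-1 * ip X X + gram_slope X (Y - X) <=
  ip B (resolvent Y *m B) + c ^+ 2 * n%:R^-1 * ip Y Y.
Proof.
rewrite -/(f X) -/(f Y).
have c0 : 0 <= c by rewrite divr_ge0// ltW.
have hX : f X = 2 * ip B (V X) - ip (V X) ((n%:R^-1 *: (X *m X^T) + z%:M) *m V X).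
  rewrite /V /f -/(resolvent X) [X in _ - ip _ X]mulmxA mulmxV; last first.
    exact: (coercive_unit z0 (gram_coercive X)).
  by rewrite mul1mx (ipC _ B); ring.
(* The variational formula at Y is tested with the maximiser for X. The resulting lower bound is
   quadratic in Y, and [hH] shows that its second order part is compensated by the added squared
   norm. *)
have hY := inv_variational z0 (gram_coercive Y) B (V X).
have hH : ip ((Y - X)^T *m V X) ((Y - X)^T *m V X) <= c ^+ 2 * ip (Y - X) (Y - X).
  rewrite -!sqr_fnorm -exprMn ler_sqr ?nnegrE ?(mulr_ge0 c0) ?fnorm_ge0//.
  exact: fnorm_trmul_resolvent.
have ni : 0 <= n%:R^-1 :> R by rewrite invr_ge0.
rewrite -/(resolvent Y) -/(f Y) in hY.
move: hX hY; rewrite !ip_gram => hX hY.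
have := ler_wpM2l ni hH.
move: hX hY; rewrite gram_slopeB /gram_slope !(raddfB trmx) /= mulmxBl !ip_lin.
rewrite (ipC Y X) (ipC (Y^T *m V X) (X^T *m V X)).
lra.
Qed.

End Tangent.
End GramResolvent.

(** * Spectral distributions of symmetric matrices *)

Section RealSpectral.
Variable R : realType.
Import complex.
Local Notation C := R[i].
Local Notation toC := (map_mx (real_complex R)).

(** The diagonalisation takes place over the complex numbers, where a real symmetric matrix is
    Hermitian. The eigenvalues are real, but [P] remains complex. *)
Lemma symmetric_spectral p (A : 'M[R]_p) : A^T = A ->
  exists (P : 'M[C]_p) (d : 'rV[R]_p),
    P \is unitarymx /\ toC A = invmx P *m diag_mx (toC d) *m P.
Proof.
move=> sA.
have hA : toC A \is hermsymmx.
  apply: realsym_hermsym.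
    by apply/is_hermitianmxP; rewrite expr0 scale1r map_mx_id// map_trmx sA.
  apply/mxOverP => i j; rewrite mxE; apply/complex_realP; by exists (A i j).
have /orthomx_spectralP AE := hermitian_normalmx hA.
exists (spectralmx (toC A)), (\row_j Re (spectral_diag (toC A) 0 j)).
split; first exact: spectral_unitarymx.
rewrite {1}AE; congr (_ *m diag_mx _ *m _); apply/rowP => j; rewrite !mxE.
rewrite RRe_real//.
by have /mxOverP/(_ 0 j) := hermitian_spectral_diag_real hA.
Qed.

Let mRe p q (X : 'M[C]_(p, q)) : 'M[R]_(p, q) := map_mx (@Re R) X.
Let mIm p q (X : 'M[C]_(p, q)) : 'M[R]_(p, q) := map_mx (@Im R) X.

Let mRe_mul p q r (X : 'M[C]_(p, q)) (Y : 'M[C]_(q, r)) :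
  mRe (X *m Y) = mRe X *m mRe Y - mIm X *m mIm Y.
Proof.
apply/matrixP => i j; rewrite !mxE raddf_sum -sumrB; apply: eq_bigr => k _.
by rewrite !mxE; case: (X i k) => ? ?; case: (Y k j).
Qed.

Let mIm_mul p q r (X : 'M[C]_(p, q)) (Y : 'M[C]_(q, r)) :
  mIm (X *m Y) = mRe X *m mIm Y + mIm X *m mRe Y.
Proof.
apply/matrixP => i j; rewrite !mxE raddf_sum -big_split; apply: eq_bigr => k _.
by rewrite !mxE; case: (X i k) => ? ?; case: (Y k j).
Qed.

Let mRe_real p q (X : 'M[R]_(p, q)) : mRe (toC X) = X.
Proof. by apply/matrixP => i j; rewrite !mxE. Qed.

Let mIm_real p q (X : 'M[R]_(p, q)) : mIm (toC X) = 0.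
Proof. by apply/matrixP => i j; rewrite !mxE. Qed.

(** For P = P1 + i P2, the real part of P^* D P is P1^T D P1 + P2^T D P2. Placing the two square
    roots side by side gives a real factor, with [p + p] columns. *)
Lemma psd_factor p (M : 'M[R]_p) :
  psd M -> exists G : 'M[R]_(p, p + p), M = G *m G^T.
Proof.
move=> [sM hM]; have [P [d [uP ME]]] := symmetric_spectral sM.
rewrite invmx_unitary// in ME.
pose P1 := mRe P; pose P2 := mIm P; pose D := diag_mx d.
have DE : diag_mx (toC d) = toC D by rewrite map_diag_mx.
have PtR : mRe (map_mx Num.Def.conjC P^T) = P1^T.
  by apply/matrixP => i j; rewrite !mxE; case: (P j i).
have PtI : mIm (map_mx Num.Def.conjC P^T) = - P2^T.
  by apply/matrixP => i j; rewrite !mxE; case: (P j i).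
have M1 : M = P1^T *m D *m P1 + P2^T *m D *m P2.
  rewrite -[LHS]mRe_real ME DE !(mRe_mul, mIm_mul) mRe_real mIm_real PtR PtI.
  by rewrite !mulmx0 subr0 add0r !mulNmx opprK.
(* Inverting the decomposition exhibits the diagonal of [D] as a sum of values of the form of [M],
   hence as nonnegative. *)
have M2 : D = P1 *m M *m P1^T + P2 *m M *m P2^T.
  have : toC D = P *m toC M *m map_mx Num.Def.conjC P^T.
    by rewrite ME DE !mulmxA (unitarymxP uP) mul1mx -mulmxA (unitarymxP uP) mulmx1.
  move=> /(congr1 (@mRe _ _)); rewrite mRe_real !(mRe_mul, mIm_mul) mRe_real.
  by rewrite mIm_real PtR PtI !mulmx0 subr0 add0r mulmxN opprK.
have d0 i : 0 <= d 0 i.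
  have -> : d 0 i = D i i by rewrite mxE eqxx.
  have h (Y : 'M[R]_p) : 0 <= (Y *m M *m Y^T) i i.
    suff -> : (Y *m M *m Y^T) i i = ip (row i Y)^T (M *m (row i Y)^T) by [].
    rewrite /ip /mxtrace big_ord1 trmxK mulmxA -row_mul mxE [RHS]mxE.
    by apply: eq_bigr => k _; rewrite !mxE.
  by rewrite M2 mxE addr_ge0.
pose sD := diag_mx (\row_j Num.sqrt (d 0 j)).
have sDE : D = sD *m sD^T.
  rewrite tr_diag_mx mulmx_diag; congr diag_mx; apply/rowP => j; rewrite !mxE.
  by rewrite -expr2 sqr_sqrtr.
exists (row_mx (P1^T *m sD) (P2^T *m sD)).
by rewrite tr_row_mx mul_row_col !trmx_mul !trmxK {1}M1 sDE !mulmxA.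
Qed.

Lemma char_poly_similar (F : fieldType) p (P D : 'M[F]_p) : P \in unitmx ->
  char_poly (invmx P *m D *m P) = char_poly D.
Proof.
move=> uP; rewrite /char_poly.
have -> : char_poly_mx (invmx P *m D *m P) =
    map_mx polyC (invmx P) *m char_poly_mx D *m map_mx polyC P.
  rewrite /char_poly_mx mulmxBr mulmxBl !map_mxM; congr (_ - _).
  by rewrite scalar_mxC -mulmxA -map_mxM mulVmx// map_mx1 mulmx1.
by rewrite !det_mulmx mulrAC -det_mulmx -map_mxM mulVmx// map_mx1 det1 mul1r.
Qed.

(** One vector [d] serves both claims: it counts the roots of the characteristic polynomial with
    multiplicity, and it diagonalises the shifted inverse. *)
Lemma eigenvalues_symmetric p (A : 'M[R]_p) : A^T = A ->
  exists d : 'rV[R]_p, perm_eq (eigenvalues A) [seq d 0 i | i <- enum 'I_p] /\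
   forall z : R, A + z%:M \in unitmx ->
     \tr (invmx (A + z%:M)) = \sum_i (d 0 i + z)^-1.
Proof.
move=> /symmetric_spectral[P [d [uP AE]]].
have uP' := unitarymx_unit uP.
exists d; split.
  have chiE : char_poly A = \prod_(i < p) ('X - (d 0 i)%:P).
    apply: (@map_poly_inj _ _ (real_complex R)).
    rewrite map_char_poly AE char_poly_similar// char_poly_trig ?diag_mx_is_trig//.
    rewrite rmorph_prod; apply: eq_bigr => i _.
    by rewrite !mxE eqxx mulr1n rmorphB /= map_polyX map_polyC.
  have chi0 : char_poly A != 0 by rewrite monic_neq0// char_poly_monic.
  rewrite /perm_eq; apply/allP => a _; apply/eqP.
  have mu : mup a (char_poly A) = count_mem a [seq d 0 i | i <- enum 'I_p].
    rewrite chiE -[in LHS]big_enum /=; elim: (enum _) => [|i s IH].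
      by rewrite big_nil mupNroot// root1.
    rewrite big_cons mupM ?polyXsubC_eq0//; last first.
      by rewrite prodf_seq_neq0; apply/allP => j _ /=; rewrite polyXsubC_eq0.
    by rewrite IH -['X - _]expr1 mup_XsubCX/= eq_sym.
  rewrite -mu /eigenvalues count_flatten -map_comp.
  (* Off the roots no block of [eigenvalues] contains [a]; at a root exactly one does, of length its
     multiplicity. *)
  have [ra|nra] := boolP (a \in rootsR (char_poly A)); last first.
    rewrite mupNroot; last first.
      by have := roots_on_rootsR chi0 a; rewrite inE /= (negbTE nra) => ->.
    rewrite sumnE big_map big_seq big1// => b hb /=.
    have /negbTE ba : b != a by apply: contraNneq nra => <-.
    by rewrite count_nseq /= ba mul0n.
  rewrite sumnE big_map (bigD1_seq a)//=; last exact: uniq_roots.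
  rewrite count_nseq /= eqxx mul1n big1 ?addn0// => b /negbTE ba.
  by rewrite count_nseq /= ba mul0n.
move=> z uz; pose e := \row_j (d 0 j + z).
have AzE : toC (A + z%:M) = invmx P *m diag_mx (toC e) *m P.
  have -> : diag_mx (toC e) = diag_mx (toC d) + (z%:C)%C%:M.
    by apply/matrixP => i j; rewrite !mxE -mulrnDl rmorphD.
  by rewrite mulmxDr mulmxDl -AE map_mxD map_scalar_mx mul_mx_scalar -scalemxAl mulVmx// scalemx1.
have e0 i : d 0 i + z != 0.
  have : \det (toC (A + z%:M)) != 0 by rewrite -unitfE -unitmxE map_unitmx.
  rewrite AzE !det_mulmx mulrAC -det_mulmx mulVmx// det1 mul1r det_diag.
  move=> /prodf_neq0/(_ i isT); rewrite !mxE.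
  by apply: contraNneq => ->; rewrite rmorph0.
pose f := \row_j (d 0 j + z)^-1.
have iE : toC (invmx (A + z%:M)) = invmx P *m diag_mx (toC f) *m P.
  have uA : toC (A + z%:M) \in unitmx by rewrite map_unitmx.
  rewrite map_invmx; apply: (can_inj (mulKmx uA)); rewrite mulmxV// {1}AzE.
  rewrite !mulmxA -(mulmxA _ P) mulmxV// mulmx1 -(mulmxA (invmx P)) mulmx_diag.
  have -> : diag_mx (\row_i (toC e 0 i * toC f 0 i)) = 1%:M.
    by apply/matrixP => i j; rewrite !mxE -rmorphM mulfV.
  by rewrite mulmx1 mulVmx.
apply: (@complexI R); rewrite -trace_map_mx.
rewrite [X in \tr X]iE -mulmxA mxtrace_mulC -mulmxA mulmxV// mulmx1.
rewrite mxtrace_diag rmorph_sum; apply: eq_bigr => i _; by rewrite !mxE.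
Qed.

(** Inversion is discontinuous at 0, so the line is cut into that point and its open complement. *)
Lemma measurable_inv (D : set R) : measurable_fun D (@GRing.inv R).
Proof.
apply: (@measurable_funS _ _ _ _ setT) => //.
rewrite -(setUv [set 0 : R]); apply/measurable_funU => //.
  exact: measurableC.
split; first exact: measurable_fun_set1.
have -> : ~` [set 0 : R] = [set x | x != 0].
  by apply/seteqP; split => x /= /eqP.
apply: measurable_realfun.open_continuous_measurable_fun; first exact: open_neq.
by move=> x; rewrite inE; exact: inv_continuous.
Qed.

(** The kernel changes sign: its positive and negative parts are integrated separately against the
    Dirac masses and then recombined. *)
Lemma stieltjes_spectral p (A : 'M[R]_p) (w : R) :
  stieltjes (spectral_distribution A) w =
  p%:R^-1 * \sum_(l <- eigenvalues A) (l - w)^-1.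
Proof.
have mf : measurable_fun setT (fun x : R => ((x - w)^-1)%:E).
  apply/measurable_EFinP; apply: measurableT_comp; first exact: measurable_inv.
  exact: measurable_funB.
have int (g : R -> \bar R) : measurable_fun setT g -> (forall x, 0 <= g x)%E ->
    (\int[spectral_distribution A]_x g x =
     p%:R^-1%:E * \sum_(k < size (eigenvalues A)) g (eigenvalues A)`_k)%E.
  move=> mg g0; rewrite ge0_integral_mscale//=; congr (_ * _)%E.
  rewrite ge0_integral_measure_sum//; apply: eq_bigr => k _.
  by rewrite integral_dirac// diracT mul1e.
rewrite /stieltjes /Rintegral integralE !int//; last first.
  exact: measurable_funepos.
  exact: measurable_funeneg.
pose g : R -> \bar R := fun x => ((x - w)^-1)%:E.
rewrite -/g; have pE x : funepos g x = (Num.max (x - w)^-1 0)%:E by rewrite funeposE EFin_max.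
have nE x : funeneg g x = (Num.max (- (x - w)^-1) 0)%:E.
  by rewrite funenegE EFin_max EFinN.
under eq_bigr do rewrite pE.
under [in X in (_ - X)%E]eq_bigr do rewrite nE.
rewrite !sumEFin -!EFinM -EFinB /= -mulrBr -sumrB; congr (_ * _).
rewrite (big_nth 0) big_mkord; apply: eq_bigr => k _.
move: (_^-1) => a.
by case: (lerP a 0) => ha; case: (lerP (- a) 0) => hb; lra.
Qed.

Lemma stieltjes_resolvent p (A : 'M[R]_p) (z : R) :
  A^T = A -> A + z%:M \in unitmx ->
  stieltjes (spectral_distribution A) (- z) =
  p%:R^-1 * \tr (invmx (A + z%:M)).
Proof.
move=> sA uA; rewrite stieltjes_spectral.
have [d [eA trA]] := eigenvalues_symmetric sA.
rewrite trA//; congr (_ * _); rewrite (perm_big _ eA) big_map big_enum /=.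
by apply: eq_bigr => i _; rewrite opprK.
Qed.
End RealSpectral.

(** * Stability of the fixed point equation *)

Lemma sum_CS (R : realFieldType) (I : finType) (J : pred I) (u v : I -> R) :
  (\sum_(j | J j) u j * v j) ^+ 2 <=
  (\sum_(j | J j) u j ^+ 2) * (\sum_(j | J j) v j ^+ 2).
Proof.
apply: discriminant_le; first by apply: sumr_ge0 => j _; exact: sqr_ge0.
move=> t; rewrite !mulr_sumr -sumrB -big_split /=; apply: sumr_ge0 => j _.
have -> : u j ^+ 2 - 2 * t * (u j * v j) + t ^+ 2 * v j ^+ 2 = (u j - t * v j) ^+ 2.
  by ring.
exact: sqr_ge0.
Qed.

Section TraceBounds.
Variables (R : realType) (p : nat).
Implicit Types S T A B : 'M[R]_p.

Lemma ip_fact k S (G : 'M[R]_(p, k)) A : S = G *m G^T ->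
  \tr (S *m A) = ip G (A *m G).
Proof. by move=> ->; rewrite -mulmxA mxtrace_mulC /ip mulmxA mxtrace_mulC mulmxA. Qed.

Lemma trace_psd_ge0 S A : psd S -> psd A -> 0 <= \tr (S *m A).
Proof.
by move=> /psd_factor[G SE] hA; rewrite (ip_fact _ SE); exact: psd_ip.
Qed.

(** With S = G G^T and T = H H^T, the trace is the inner product of H^T A G and H^T B G. *)
Lemma trace_CS S T A B : psd S -> psd T -> A^T = A -> B^T = B ->
  \tr (S *m A *m T *m B) ^+ 2 <=
  \tr (S *m A *m T *m A) * \tr (S *m B *m T *m B).
Proof.
move=> /psd_factor[G SE] /psd_factor[H TE] sA sB.
have e X Y : X^T = X -> \tr (S *m X *m T *m Y) = ip (H^T *m X *m G) (H^T *m Y *m G).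
  move=> sX; rewrite -!mulmxA (ip_fact _ SE) TE -!mulmxA.
  by rewrite [RHS]ip_mulml trmxK [RHS]ip_mulml sX.
by rewrite !e// ip_CS.
Qed.

Lemma trace_inv_le z S A : psd S -> 0 < z -> coercive z A ->
  0 <= \tr (S *m invmx A) <= z^-1 * \tr S.
Proof.
move=> hS z0 cA; rewrite trace_psd_ge0//=; last exact: coercive_inv_psd cA.
have [G SE] := psd_factor hS; rewrite (ip_fact _ SE).
have -> : \tr S = ip G G by rewrite SE mxtrace_mulC.
exact: (coercive_inv_le z0 cA).
Qed.

Lemma trace_inv2_le z S A B : psd S -> 0 < z -> coercive z A -> coercive z B ->
  `|\tr (invmx A *m S *m invmx B)| <= z^-1 * z^-1 * \tr S.
Proof.
move=> hS z0 cA cB; have [G SE] := psd_factor hS.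
rewrite -mulmxA mxtrace_mulC -mulmxA (ip_fact _ SE) -mulmxA.
rewrite ip_mulmr (coercive_inv_sym cB).
have -> : \tr S = fnorm G * fnorm G by rewrite -expr2 sqr_fnorm SE mxtrace_mulC.
rewrite mulrACA; apply: le_trans (ip_le_fnorm _ _) _.
by rewrite ler_pM ?fnorm_ge0//; exact: coercive_inv_norm.
Qed.

End TraceBounds.

Section FixedPointStability.
Variables (R : realType) (p n : nat) (Sigma : 'I_n -> 'M[R]_p) (z : R).
Hypotheses (z0 : 0 < z) (hSigma : forall i, psd (Sigma i)).
Implicit Types (J : pred 'I_n) (d : 'rV[R]_n).

Lemma tildeQ_coercive J d : (forall i, 0 <= d 0 i) ->
  coercive z (n%:R^-1 *: (\sum_(j < n | J j) (1 + d 0 j)^-1 *: Sigma j) + z%:M).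
Proof.
move=> d0; apply: coercive_psdD; apply: psdZ; first by rewrite invr_ge0.
by apply: psd_sum => j _; apply: psdZ => //; rewrite invr_ge0 addr_ge0.
Qed.

(** The scalar factor is the difference of the two weights. Its denominator is the square of the
    normalisation in the weighted distance, so dividing by that distance splits it evenly between
    [d] and [d']. *)
Lemma tildeQ_sub J d d' : (forall i, 0 <= d 0 i) -> (forall i, 0 <= d' 0 i) ->
  tildeQ_on Sigma z J d - tildeQ_on Sigma z J d' =
  n%:R^-1 *: \sum_(j < n | J j)
    ((d 0 j - d' 0 j) / ((1 + d 0 j) * (1 + d' 0 j))) *:
      (tildeQ_on Sigma z J d *m Sigma j *m tildeQ_on Sigma z J d').
Proof.
move=> d0 d0'; rewrite {1 2}/tildeQ_on invmx_sub; last 2 first.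
- exact: (coercive_unit z0 (tildeQ_coercive J d0)).
- exact: (coercive_unit z0 (tildeQ_coercive J d0')).
rewrite -!/(tildeQ_on _ _ _ _) opprD addrACA subrr addr0 -scalerBr -sumrB.
rewrite -scalemxAr -scalemxAl; congr (_ *: _).
rewrite mulmx_sumr mulmx_suml; apply: eq_bigr => j _.
rewrite -scalerBl -scalemxAr -scalemxAl; congr (_ *: _).
have h1 : 1 + d 0 j != 0 by rewrite gt_eqF// ltr_pwDl.
have h2 : 1 + d' 0 j != 0 by rewrite gt_eqF// ltr_pwDl.
by field; rewrite h1 h2.
Qed.

(** The weighted sum rebuilds A^-1 - z between two copies of A, so the left side equals tr (Sigma_i
    A) - z tr (Sigma_i A^2). *)
Lemma tildeQ_sum_le (i : 'I_n) J d (A := tildeQ_on Sigma z J d) :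
  (forall i, 0 <= d 0 i) ->
  n%:R^-1 * \sum_(j < n | J j) \tr (Sigma i *m A *m Sigma j *m A) / (1 + d 0 j)
  <= \tr (Sigma i *m A).
Proof.
move=> d0; have cA := tildeQ_coercive J d0.
set M := n%:R^-1 *: _ + _ in cA; have AE : A = invmx M by [].
have uM := coercive_unit z0 cA.
have -> : n%:R^-1 * \sum_(j < n | J j) \tr (Sigma i *m A *m Sigma j *m A) / (1 + d 0 j)
   = \tr (Sigma i *m A *m (M - z%:M) *m A).
  rewrite /M addrK -scalemxAr -scalemxAl mxtraceZ; congr (_ * _).
  rewrite mulmx_sumr mulmx_suml raddf_sum; apply: eq_bigr => j _ /=.
  by rewrite -scalemxAr -scalemxAl mxtraceZ mulrC.
rewrite mulmxBr mulmxBl -(mulmxA _ M) AE mulmxV// mulmx1 raddfB /= gerBl.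
rewrite mul_mx_scalar -scalemxAl mxtraceZ mulr_ge0 ?(ltW z0)// -AE.
have [G SE] := psd_factor (hSigma i).
rewrite -mulmxA (ip_fact _ SE) -mulmxA ip_mulmr AE (coercive_inv_sym cA).
exact: ip_ge0.
Qed.

(** A contraction estimate at the index [im] where the weighted distance is largest. The contraction
    factor is sqrt (Delta / (1 + Delta)), because d' / (1 + d') increases with d'; the factor 1 +
    Delta converts the weighted distance back to a plain one. *)
Lemma fixed_point_stability d d' (eps Delta : R) :
  (forall i, 0 <= d 0 i <= Delta) -> (forall i, 0 <= d' 0 i <= Delta) ->
  (forall i, d' 0 i =
     n%:R^-1 * \tr (Sigma i *m tildeQ_on Sigma z (fun j => j != i) d')) ->
  (forall i, `|d 0 i -
     n%:R^-1 * \tr (Sigma i *m tildeQ_on Sigma z (fun j => j != i) d)| <= eps) ->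
  eps <= 1 ->
  forall i, `|d 0 i - d' 0 i| <=
    (1 + Delta) * (eps / (1 - Num.sqrt (Delta / (1 + Delta)))).
Proof.
move=> hd hd' fix' feps eps1 i0.
have d0 i : 0 <= d 0 i by case/andP: (hd i).
have d0' i : 0 <= d' 0 i by case/andP: (hd' i).
have n0 : 0 < n%:R :> R by rewrite ltr0n (leq_ltn_trans _ (ltn_ord i0)).
have D0 : 0 <= Delta by case/andP: (hd i0) => h1 h2; exact: le_trans h2.
have eps0 : 0 <= eps by apply: le_trans (feps i0).
pose a i := Num.sqrt (1 + d 0 i); pose b i := Num.sqrt (1 + d' 0 i).
have a2 i : a i ^+ 2 = 1 + d 0 i by rewrite sqr_sqrtr// addr_ge0.
have b2 i : b i ^+ 2 = 1 + d' 0 i by rewrite sqr_sqrtr// addr_ge0.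
have ap i : 1 <= a i by rewrite -[leLHS]sqrtr1 ler_wsqrtr// lerDl.
have bp i : 1 <= b i by rewrite -[leLHS]sqrtr1 ler_wsqrtr// lerDl.
have ap' i : 0 < a i by apply: lt_le_trans (ap i).
have bp' i : 0 < b i by apply: lt_le_trans (bp i).
have a0 i : 0 <= a i := ltW (ap' i).
have b0 i : 0 <= b i := ltW (bp' i).
have ab0 i : 0 <= a i * b i by rewrite mulr_ge0.
pose r i := `|d 0 i - d' 0 i| / (a i * b i).
have rE i : `|d 0 i - d' 0 i| = r i * (a i * b i).
  by rewrite /r divfK// gt_eqF// mulr_gt0.
have r0 i : 0 <= r i by rewrite divr_ge0// mulr_ge0.
have [im rmax] : exists im, forall i, r i <= r im.
  by exists [arg max_(i > i0) r i]%O; case: arg_maxP => // im _ h i; exact: h.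
pose D := r im.
set th := Num.sqrt _.
have th1 : th < 1.
  rewrite -[ltRHS]sqrtr1 ltr_sqrt// ltr_pdivrMr ?mul1r ?ltrDr//.
  by rewrite ltr_pwDl.
suff hD : D <= eps / (1 - th).
  rewrite rE mulrC; apply: ler_pM.
  - by rewrite mulr_ge0.
  - exact: r0.
  - rewrite -(@ler_sqr _ (a i0 * b i0)) ?nnegrE ?mulr_ge0 ?addr_ge0// //.
    rewrite exprMn a2 b2 expr2; apply: ler_pM; rewrite ?addr_ge0// lerD2l.
      by case/andP: (hd i0).
    by case/andP: (hd' i0).
  - exact: le_trans (rmax i0) hD.
rewrite ler_pdivlMr ?subr_gt0// mulrBr mulr1 lerBlDr.
set A := tildeQ_on Sigma z (fun j => j != im) d.
set B := tildeQ_on Sigma z (fun j => j != im) d'.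
pose I1 := n%:R^-1 * \tr (Sigma im *m A).
have ni0 : 0 <= n%:R^-1 :> R by rewrite invr_ge0 ltW.
have sA : A^T = A by exact: coercive_inv_sym (tildeQ_coercive _ d0).
have sB : B^T = B by exact: coercive_inv_sym (tildeQ_coercive _ d0').
pose al j := \tr (Sigma im *m A *m Sigma j *m A).
pose be j := \tr (Sigma im *m B *m Sigma j *m B).
have psdc (X : 'M[R]_p) j : X^T = X -> 0 <= \tr (Sigma im *m X *m Sigma j *m X).
  move=> sX; rewrite -!mulmxA; apply: trace_psd_ge0 => //; split=> [|u].
    by rewrite !trmx_mul sX (hSigma j).1 mulmxA.
  by rewrite -!mulmxA ip_mulmr sX; exact: (hSigma j).2.
have al0 j : 0 <= al j by apply: psdc.
have be0 j : 0 <= be j by apply: psdc.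
(* Cauchy-Schwarz is used twice, for the trace with two different resolvents and then for the sum
   over j. The two resulting sums are those of [tildeQ_sum_le], one for [d] and one for [d']. *)
have key : `|I1 - d' 0 im| <= D * Num.sqrt (I1 * d' 0 im).
  rewrite {1}fix' /I1 -mulrBr -raddfB /= -mulmxBr tildeQ_sub//.
  rewrite -scalemxAr mxtraceZ mulmx_sumr raddf_sum /=.
  rewrite mulrA normrM ger0_norm ?mulr_ge0//.
  apply: (@le_trans _ _ (n%:R^-1 * n%:R^-1 * \sum_(j < n | j != im)
     D * ((Num.sqrt (al j) / a j) * (Num.sqrt (be j) / b j)))).
    rewrite ler_wpM2l ?mulr_ge0//; apply: le_trans (ler_norm_sum _ _ _) _.
    apply: ler_sum => j _; rewrite -scalemxAr mxtraceZ normrM.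
    have h1 : `|\tr (Sigma im *m (A *m Sigma j *m B))| <= Num.sqrt (al j) * Num.sqrt (be j).
      rewrite -sqrtrM// -sqrtr_sqr ler_sqrt ?mulr_ge0// !mulmxA.
      exact: trace_CS.
    rewrite normrM normfV rE [`|(1 + _) * _|]ger0_norm ?mulr_ge0 ?addr_ge0//.
    rewrite -a2 -b2.
    have -> : r j * (a j * b j) / (a j ^+ 2 * b j ^+ 2) = r j / (a j * b j).
      by field; rewrite !gt_eqF.
    have -> : D * (Num.sqrt (al j) / a j * (Num.sqrt (be j) / b j)) =
       D / (a j * b j) * (Num.sqrt (al j) * Num.sqrt (be j)).
      by field; rewrite !gt_eqF.
    apply: ler_pM => //; first by rewrite divr_ge0 ?r0 ?ab0.
    by rewrite ler_wpM2r ?rmax// invr_ge0 ab0.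
  rewrite -mulr_sumr mulrCA ler_wpM2l ?r0//.
  rewrite -ler_sqr ?nnegrE ?sqrtr_ge0 ?mulr_ge0//; last first.
    by apply: sumr_ge0 => j _; rewrite mulr_ge0 ?divr_ge0 ?sqrtr_ge0.
  have hA := tildeQ_sum_le im (fun j => j != im) d0.
  have hB := tildeQ_sum_le im (fun j => j != im) d0'.
  rewrite -/A -/B in hA hB.
  have I10 : 0 <= I1.
    rewrite mulr_ge0//; apply: le_trans hA; rewrite mulr_ge0//; apply: sumr_ge0 => j _.
    by rewrite divr_ge0 ?al0 ?addr_ge0.
  rewrite (sqr_sqrtr (mulr_ge0 I10 (d0' im))) exprMn.
  apply: le_trans (ler_wpM2l (sqr_ge0 _) (sum_CS _ _ _)) _.
  have -> : (n%:R^-1 * n%:R^-1) ^+ 2 *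
     ((\sum_(j < n | j != im) (Num.sqrt (al j) / a j) ^+ 2) *
      (\sum_(j < n | j != im) (Num.sqrt (be j) / b j) ^+ 2)) =
     (n%:R^-1 * (n%:R^-1 * \sum_(j < n | j != im) (Num.sqrt (al j) / a j) ^+ 2)) *
     (n%:R^-1 * (n%:R^-1 * \sum_(j < n | j != im) (Num.sqrt (be j) / b j) ^+ 2)).
    by ring.
  rewrite fix'; apply: ler_pM.
  - by rewrite !mulr_ge0//; apply: sumr_ge0 => j _; rewrite sqr_ge0.
  - by rewrite !mulr_ge0//; apply: sumr_ge0 => j _; rewrite sqr_ge0.
  - rewrite ler_wpM2l//; apply: le_trans hA; rewrite ler_wpM2l//.
    by apply: ler_sum => j _; rewrite exprMn exprVn a2 sqr_sqrtr.
  - rewrite ler_wpM2l//; apply: le_trans hB; rewrite ler_wpM2l//.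
    by apply: ler_sum => j _; rewrite exprMn exprVn b2 sqr_sqrtr.
(* Here [eps <= 1] enters: the value of the map at an approximate solution must stay below 1 + d for
   the factor [th] to come out. *)
have I1d : I1 <= 1 + d 0 im.
  have := feps im; rewrite ler_norml -/A -/I1 => /andP[h _]; lra.
have hr : `|d 0 im - d' 0 im| <= eps + D * Num.sqrt (I1 * d' 0 im).
  have -> : d 0 im - d' 0 im = (d 0 im - I1) + (I1 - d' 0 im) by ring.
  apply: le_trans (ler_normD _ _) _; apply: lerD => //; exact: feps.
have hs : Num.sqrt (I1 * d' 0 im) <= th * (a im * b im).
  rewrite -sqrtrM ?addr_ge0// -sqrtrM ?divr_ge0 ?addr_ge0// ler_sqrt.
    have -> : Delta / (1 + Delta) * ((1 + d 0 im) * (1 + d' 0 im)) =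
      (1 + d 0 im) * (Delta / (1 + Delta) * (1 + d' 0 im)) by ring.
    apply: (@le_trans _ _ ((1 + d 0 im) * d' 0 im)); first by rewrite ler_wpM2r.
    rewrite ler_wpM2l ?addr_ge0// mulrAC ler_pdivlMr ?ltr_pwDl//.
    have := hd' im => /andP[_]; nra.
  by rewrite !mulr_ge0 ?invr_ge0 ?addr_ge0.
have abp : 1 <= a im * b im by rewrite -[leLHS]mulr1 ler_pM.
rewrite -(@ler_pM2r _ (a im * b im)) ?mulr_gt0// mulrDl -rE.
apply: le_trans hr _; apply: lerD; first by rewrite ler_peMr.
by rewrite -(mulrA D) ler_wpM2l //; exact: r0.
Qed.

End FixedPointStability.

(** * Expectations *)

Section Expectation.
Context d (T : measurableType d) (R : realType) (P : probability T R).
Implicit Types (f g : T -> R) (a c : R).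

Definition mfun f := measurable_fun [set: T] f.

Definition integ f := P.-integrable [set: T] (EFin \o f).

(** An infinite integral has the junk value 0, which is why the rules below carry integrability
    hypotheses. *)
Definition Ex f : R := Rintegral P setT f.

Lemma integ_mfun f : integ f -> mfun f.
Proof. by move=> /measurable_int/measurable_EFinP. Qed.

Lemma integ_dom g f : integ g -> mfun f -> (forall w, `|f w| <= g w) -> integ f.
Proof.
move=> ig mf fg; apply: (le_integrable _ _ _ ig) => //.
  exact/measurable_EFinP.
move=> w _; rewrite /= lee_fin; apply: le_trans (fg w) _; exact: ler_norm.
Qed.

Lemma integ_cst c : integ (fun=> c).
Proof. exact: finite_measure_integrable_cst. Qed.

Lemma integD f g : integ f -> integ g -> integ (fun w => f w + g w).
Proof. by move=> hf hg; have := integrableD measurableT hf hg. Qed.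

Lemma integZ c f : integ f -> integ (fun w => c * f w).
Proof. by move=> hf; have := integrableZl measurableT c hf. Qed.

Lemma integN f : integ f -> integ (fun w => - f w).
Proof.
move=> hf; have := integZ (-1) hf.
by rewrite (_ : (fun w => -1 * f w) = (fun w => - f w))//; apply/funext => w; rewrite mulN1r.
Qed.

Lemma integB f g : integ f -> integ g -> integ (fun w => f w - g w).
Proof. by move=> hf hg; exact: integD hf (integN hg). Qed.

Lemma integ_abs f : integ f -> integ (fun w => `|f w|).
Proof. by move=> hf; have := integrable_abse hf. Qed.

Lemma integ_sum (I : Type) (r : seq I) (Q : pred I) (F : I -> T -> R) :
  (forall i, integ (F i)) -> integ (fun w => \sum_(i <- r | Q i) F i w).
Proof.
move=> hF; elim: r => [|i r IH].
  rewrite (_ : (fun w => _) = (fun=> 0)); first exact: integ_cst.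
  by apply/funext => w; rewrite big_nil.
rewrite (_ : (fun w => _) = (fun w =>
    (if Q i then F i w else 0) + \sum_(j <- r | Q j) F j w)).
  by apply: integD => //; case: (Q i) => //; exact: integ_cst.
by apply/funext => w; rewrite big_cons; case: (Q i) => //; rewrite add0r.
Qed.

Lemma Ex_cst c : Ex (fun=> c) = c.
Proof.
rewrite /Ex Rintegral_cst//; transitivity (c * fine (1 : \bar R)).
  by congr (c * fine _); exact: probability_setT.
by rewrite mulr1.
Qed.

Lemma ExD f g : integ f -> integ g -> Ex (fun w => f w + g w) = Ex f + Ex g.
Proof. by move=> hf hg; rewrite /Ex RintegralD. Qed.

Lemma ExB f g : integ f -> integ g -> Ex (fun w => f w - g w) = Ex f - Ex g.
Proof. by move=> hf hg; rewrite /Ex RintegralB. Qed.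

Lemma ExZ c f : integ f -> Ex (fun w => c * f w) = c * Ex f.
Proof. by move=> hf; rewrite /Ex RintegralZl. Qed.

Lemma Ex_sum (I : Type) (r : seq I) (Q : pred I) (F : I -> T -> R) :
  (forall i, integ (F i)) ->
  Ex (fun w => \sum_(i <- r | Q i) F i w) = \sum_(i <- r | Q i) Ex (F i).
Proof.
move=> hF; elim: r => [|i r IH].
  by under [X in Ex X]funext do rewrite big_nil; rewrite big_nil Ex_cst.
rewrite big_cons; under [X in Ex X]funext do rewrite big_cons.
case: (Q i) => //; rewrite ExD ?IH//; exact: integ_sum.
Qed.

Lemma Ex_le f g : integ f -> integ g -> (forall w, f w <= g w) -> Ex f <= Ex g.
Proof. by move=> hf hg fg; apply: le_Rintegral. Qed.

Lemma Ex_ge0 f : (forall w, 0 <= f w) -> 0 <= Ex f.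
Proof. by move=> f0; apply: Rintegral_ge0. Qed.

Lemma Ex_abs f : integ f -> `|Ex f| <= Ex (fun w => `|f w|).
Proof. by move=> hf; apply: le_normr_Rintegral. Qed.

Lemma Ex_EFin f : integ f -> (\int[P]_w (f w)%:E)%E = (Ex f)%:E.
Proof.
by move=> hf; rewrite /Ex /Rintegral fineK//; exact: integrable_fin_num.
Qed.

Lemma mfun_sqr f : mfun f -> mfun (fun w => f w ^+ 2).
Proof. by move=> hf; exact: measurable_funX. Qed.

Lemma integ_prod f g : mfun f -> mfun g ->
  integ (fun w => f w ^+ 2) -> integ (fun w => g w ^+ 2) ->
  integ (fun w => f w * g w).
Proof.
move=> mf mg hf hg; apply: (@integ_dom (fun w => f w ^+ 2 + g w ^+ 2)).
- exact: integD.
- exact: measurable_funM.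
- move=> w; rewrite normrM -(real_normK (num_real (f w))) -(real_normK (num_real (g w))).
  have := sqr_ge0 (`|f w| - `|g w|); have := normr_ge0 (f w); have := normr_ge0 (g w); nra.
Qed.

Lemma Ex_CS f g : mfun f -> mfun g ->
  integ (fun w => f w ^+ 2) -> integ (fun w => g w ^+ 2) ->
  Ex (fun w => f w * g w) ^+ 2 <= Ex (fun w => f w ^+ 2) * Ex (fun w => g w ^+ 2).
Proof.
move=> mf mg hf hg; have hfg := integ_prod mf mg hf hg.
apply: discriminant_le; first by apply: Ex_ge0 => w; exact: sqr_ge0.
move=> t; rewrite -!ExZ// -ExB//; last exact: integZ.
rewrite -ExD; [|by apply: integB => //; exact: integZ|exact: integZ].
apply: Ex_ge0 => w.
have -> : f w ^+ 2 - 2 * t * (f w * g w) + t ^+ 2 * g w ^+ 2 = (f w - t * g w) ^+ 2 by ring.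
exact: sqr_ge0.
Qed.

Lemma Ex_sqr_le f : mfun f -> integ (fun w => f w ^+ 2) ->
  integ f /\ Ex f ^+ 2 <= Ex (fun w => f w ^+ 2).
Proof.
move=> mf hf; have h1 : integ (fun w => 1 ^+ 2 : R) by exact: integ_cst.
have e : (fun w => f w * 1) = f by apply/funext => w; rewrite mulr1.
have m1 : mfun (fun=> 1 : R) by exact: measurable_cst.
split; first by rewrite -e; exact: integ_prod.
by have := Ex_CS mf m1 hf h1; rewrite e expr1n Ex_cst mulr1.
Qed.

Lemma measurable_ge_set f a : mfun f -> measurable [set w | a <= f w].
Proof.
move=> mf; rewrite -[X in measurable X]setTI.
by apply: measurable_fun_le => //; exact: measurable_cst.
Qed.

Lemma measurable_lt_set f a : mfun f -> measurable [set w | f w < a].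
Proof.
move=> mf; have -> : [set w | f w < a] = ~` [set w | a <= f w].
  by apply/seteqP; split => w /=; rewrite ltNge => /negP.
by apply: measurableC; exact: measurable_ge_set.
Qed.

Lemma chebyshev_le f a : mfun f -> integ (fun w => f w ^+ 2) -> 0 < a ->
  (P [set w | (a <= `|f w|)%R] <= (Ex (fun w => f w ^+ 2) / a ^+ 2)%:E)%E.
Proof.
move=> mf hf a0.
have mA : measurable [set w | a <= `|f w|].
  by apply: measurable_ge_set; exact: measurableT_comp.
set A := [set w | _] in mA *.
have -> : P A = (\int[P]_w (\1_A w)%:E)%E by rewrite integral_indic// setIT.
apply: (@le_trans _ _ (\int[P]_w (a ^- 2 * f w ^+ 2)%:E)%E); last first.
  rewrite Ex_EFin; last exact: integZ.
  by rewrite ExZ// mulrC.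
apply: ge0_le_integral => //.
- by apply/measurable_EFinP; exact: measurable_indic.
- by apply/measurable_EFinP/measurable_funM => //; exact: mfun_sqr.
- move=> w _; rewrite lee_fin indicE; have [|] := boolP (w \in _).
    rewrite inE /= => h; rewrite mulrC ler_pdivlMr ?exprn_gt0// mul1r.
    by rewrite -(real_normK (num_real (f w))) ler_sqr ?nnegrE// ltW.
  by move=> _; rewrite mulr_ge0 ?sqr_ge0// invr_ge0 sqr_ge0.
Qed.

End Expectation.

Section TailMoment.
Context d (T : measurableType d) (R : realType) (mu : {measure set T -> \bar R}).

(* Y^4 <= sum_j (j+1)^4 1_(Y >= j), and the resulting series telescopes. *)
Lemma tail_moment4 (Y : T -> R) (A : R) : 0 <= A ->
  measurable_fun setT Y -> (forall w, 0 <= Y w) ->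
  (forall j : nat, mu [set w | (j%:R <= Y w)%R] <=
     (A / (j.+1%:R ^+ 5 * j.+2%:R))%:E)%E ->
  (\int[mu]_w (Y w ^+ 4)%:E <= A%:E)%E.
Proof.
move=> A0 mY Y0 tail.
pose F (j : nat) (w : T) : \bar R := (j.+1%:R ^+ 4 * \1_[set w | j%:R <= Y w] w)%:E.
have mset j : measurable [set w | j%:R <= Y w] by exact: measurable_ge_set.
have F0 j w : (0 <= F j w)%E by rewrite lee_fin mulr_ge0 ?exprn_ge0.
have mF j : measurable_fun setT (F j).
  by apply/measurable_EFinP/measurable_funM => //; exact: measurable_indic.
apply: (@le_trans _ _ (\int[mu]_w (\sum_(0 <= j <oo) F j w))%E).
  apply: ge0_le_integral => //.
  - by move=> w _; rewrite lee_fin exprn_ge0.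
  - by apply/measurable_EFinP; exact: measurable_funX.
  - by apply: ge0_emeasurable_sum.
  (* The single term at the integer part of [Y w] already dominates, since Y < j + 1 there. *)
  move=> w _; have := @nneseries_lim_ge R (F^~ w) xpredT 0 (Num.truncn (Y w)).+1.
  move=> /(_ (fun j _ _ => F0 j w)); apply: le_trans.
  rewrite big_nat_recr//=; apply: (@le_trans _ _ (F (Num.truncn (Y w)) w)); last first.
    by rewrite leeDr// sume_ge0.
  have /andP[h1 h2] := truncn_itv (Y0 w).
  rewrite lee_fin indicE mem_set//= mulr1.
  by rewrite lerXn2r ?nnegrE// ltW.
rewrite integral_nneseries//.
have FE j : (\int[mu]_w F j w <= (A / (j.+1%:R * j.+2%:R))%:E)%E.
  rewrite /F; under eq_integral do rewrite EFinM.
  rewrite ge0_integralZl; [|exact: measurableT| | |].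
  - have -> : (\int[mu]_x (\1_[set w | (j%:R <= Y w)%R] x)%:E =
        mu [set w | (j%:R <= Y w)%R])%E by rewrite integral_indic// setIT.
    apply: (@le_trans _ _ ((j.+1%:R ^+ 4)%:E * (A / (j.+1%:R ^+ 5 * j.+2%:R))%:E)%E).
      by rewrite lee_pmul2l ?tail// lte_fin exprn_gt0.
    rewrite -EFinM lee_fin le_eqVlt; apply/orP; left; apply/eqP.
    have h1 : j.+1%:R != 0 :> R by rewrite pnatr_eq0.
    have h2 : j.+2%:R != 0 :> R by rewrite pnatr_eq0.
    by move: (j.+1%:R) (j.+2%:R) h1 h2 => u v h1 h2; field; rewrite h1 h2.
  - by apply/measurable_EFinP; exact: measurable_indic.
  - by move=> w _; rewrite lee_fin.
  - by rewrite lee_fin exprn_ge0.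
apply: lime_le; first by apply: is_cvg_nneseries => j _ _; apply: integral_ge0.
apply: nearW => n.
apply: (@le_trans _ _ (\sum_(0 <= j < n) (A / (j.+1%:R * j.+2%:R))%:E)%E).
  by apply: lee_sum => j _.
rewrite sumEFin lee_fin.
have -> : \sum_(0 <= j < n) A / (j.+1%:R * j.+2%:R) = A - A / n.+1%:R.
  elim: n => [|n IH]; first by rewrite big_nil divr1 subrr.
  rewrite big_nat_recr//= IH.
  have h1 : n.+1%:R != 0 :> R by rewrite pnatr_eq0.
  have h2 : n.+2%:R != 0 :> R by rewrite pnatr_eq0.
  have h3 : n.+2%:R = n.+1%:R + 1 :> R by rewrite [LHS]mulrS addrC.
  rewrite h3 in h2 *; move: (n.+1%:R) h1 h2 => u h1 h2.
  by field; rewrite h1 h2.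
by rewrite gerBl divr_ge0.
Qed.

End TailMoment.

(** * Moments and tails from concentration *)

Section ExponentialConcentration.
Variable R : realType.
Implicit Types (C c q t M : R).

Definition decay C c q t : R := C * expR (- (t `^ q / c)).

(** The denominator, of degree 6 in j, is the one required by [tail_moment4]. For u = x^q / c one
    has x^6 = (c u)^s with s = 6 / q, and ln v <= v - 1 at v = u / s shows that exp u outgrows
    it. *)
Lemma decay_poly C c q : 0 <= C -> 0 < c -> 0 < q -> exists2 A, 0 <= A &
  forall j : nat, decay C c q j%:R <= A / (j.+1%:R ^+ 5 * j.+2%:R).
Proof.
move=> C0 c0 q0; pose s := 6 / q; have s0 : 0 < s by rewrite divr_gt0.
pose B := expR (s * ln c + s * ln s - s).
have B0 : 0 <= B by exact: expR_ge0.
(* [2 * C] settles j = 0, where the weight is 2. The factor 3^6 comes from (x + 1)^5 (x + 2) <= (3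
   x)^6 for x >= 1, and [B] bounds x^6 exp (- u). *)
exists (2 * C + C * 3 ^+ 6 * B).
  by rewrite addr_ge0 ?mulr_ge0// exprn_ge0.
move=> j; rewrite ler_pdivlMr; last by rewrite mulr_gt0 ?exprn_gt0.
have [->|jn] := eqVneq j 0%N.
  rewrite /decay powR0 ?gt_eqF// mul0r oppr0 expR0 mulr1 expr1n mul1r mulrC lerDl.
  by rewrite !mulr_ge0// exprn_ge0.
set x : R := j%:R; have x1 : 1 <= x by rewrite ler1n lt0n.
have x0 : 0 < x by apply: lt_le_trans x1.
have j1 : j.+1%:R = x + 1 :> R by rewrite -natr1.
have j2 : j.+2%:R = x + 2 :> R by rewrite -natr1 j1 -addrA.
rewrite j1 j2; set y := x `^ q; set u := y / c.
have y0 : 0 < y by exact: powR_gt0.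
have u0 : 0 < u by rewrite divr_gt0.
have x6 : x ^+ 6 = expR (s * (ln c + ln u)).
  rewrite -lnM ?posrE// /u (mulrC c) divfK ?gt_eqF//.
  rewrite -powR_mulrn ?(ltW x0)// (mulrC s) expRM lnK ?posrE// -powRrM /s.
  by congr (_ `^ _); field; rewrite gt_eqF.
have lnu : s * ln u <= s * ln s + u - s.
  have -> : u = s * (u / s) by field; rewrite gt_eqF.
  set v := u / s; have v0 : 0 < v by rewrite divr_gt0.
  rewrite lnM ?posrE//.
  have : ln v <= v - 1.
    have e : 1 + (v - 1) = v by ring.
    by have := @le_ln1Dx R (v - 1); rewrite e; apply; lra.
  by move=> /(ler_wpM2l (ltW s0)) ?; lra.
have key : x ^+ 6 * expR (- u) <= B.
  rewrite x6 -expRD ler_expR; lra.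
have hx : (x + 1) ^+ 5 * (x + 2) <= 3 ^+ 6 * x ^+ 6.
  have -> : 3 ^+ 6 * x ^+ 6 = (3 * x) ^+ 5 * (3 * x) by ring.
  apply: ler_pM; rewrite ?exprn_ge0 ?addr_ge0 ?(ltW x0)//; last lra.
  by apply: lerXn2r; rewrite ?nnegrE ?addr_ge0 ?mulr_ge0 ?(ltW x0)//; lra.
rewrite /decay -/y -/u.
apply: (@le_trans _ _ (C * 3 ^+ 6 * (x ^+ 6 * expR (- u)))).
  have -> : C * 3 ^+ 6 * (x ^+ 6 * expR (- u)) = C * expR (- u) * (3 ^+ 6 * x ^+ 6) by ring.
  by rewrite ler_wpM2l// mulr_ge0 ?expR_ge0.
apply: (@le_trans _ _ (C * 3 ^+ 6 * B)).
  by rewrite ler_wpM2l// mulr_ge0 ?exprn_ge0.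
by rewrite lerDr mulr_ge0.
Qed.

Lemma concentrated_moment4 C c q : 1 <= C -> 0 < c -> 0 < q ->
  exists2 M, 0 <= M & forall d (T : measurableType d) (P : probability T R)
    (W : T -> R), mfun W -> concentrated P W (decay C c q) ->
  [/\ integ P W, integ P (fun w => (W w - Ex P W) ^+ 4) &
      Ex P (fun w => (W w - Ex P W) ^+ 4) <= M].
Proof.
move=> C1 c0 q0; have Cp : 0 <= C by apply: le_trans C1.
have [A A0 hA] := decay_poly Cp c0 q0.
exists (16 * (A + 1)); first by rewrite mulr_ge0// addr_ge0.
move=> d T P W mW conc.
pose Y (w : T * T) := `|W w.1 - W w.2|.
have Y0 w : 0 <= Y w by exact: normr_ge0.
have mY : measurable_fun setT Y.
  apply: measurableT_comp => //; apply: measurable_funB.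
    exact: measurableT_comp.
  exact: measurableT_comp.
have hY : (\int[P \x P]_w (Y w ^+ 4)%:E <= A%:E)%E.
  apply: tail_moment4 => // j.
  apply: (@le_trans _ _ (decay C c q j%:R)%:E); last by rewrite lee_fin; exact: hA.
  (* Concentration is assumed for t > 0 only; at j = 0 the bound is [C], which is at least 1. *)
  have [->|j0] := eqVneq j 0%N; last by apply: conc; rewrite ltr0n lt0n.
  apply: (@le_trans _ _ 1%E).
    have <- : (P \x P)%E [set: T * T] = 1%E.
      rewrite -setXTT product_measure1E// -[RHS]mule1.
      by congr (_ * _)%E; exact: probability_setT.
    apply: le_measure; rewrite ?inE//.
    exact: measurable_ge_set.
  by rewrite lee_fin /decay powR0 ?gt_eqF// mul0r oppr0 expR0 mulr1.
rewrite fubini_tonelli1 in hY; last 2 first.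
- by apply/measurable_EFinP; exact: measurable_funX.
- by move=> w; rewrite lee_fin exprn_ge0 ?Y0.
have mY4 : measurable_fun setT (fun w => (Y w ^+ 4)%:E).
  by apply/measurable_EFinP; exact: measurable_funX.
(* Otherwise all sections would exceed A + 1, and so would the double integral, which is at most
   A. *)
have [w0 hw0] : exists w0, (\int[P]_w (`|W w0 - W w| ^+ 4)%:E <= (A + 1)%:E)%E.
  apply: contrapT => /forallNP h.
  suff : ((A + 1)%:E <= A%:E)%E by rewrite lee_fin; lra.
  apply: le_trans hY; have -> : (A + 1)%:E = (\int[P]_(w in setT) (A + 1)%:E)%E.
    rewrite integral_cst// -[LHS]mule1; congr (_ * _)%E; apply/esym.
    exact: probability_setT.
  apply: ge0_le_integral => //.
  - by move=> w _; rewrite lee_fin addr_ge0.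
  - by apply: measurable_fun_fubini_tonelli_F => // w; rewrite lee_fin exprn_ge0 ?Y0.
  - by move=> w _; apply: ltW; rewrite ltNge; apply/negP; exact: h.
set a := W w0; pose U w := W w - a.
have mU : mfun U by apply: measurable_funB => //; exact: measurable_cst.
have eU w : `|W w0 - W w| ^+ 4 = U w ^+ 4.
  by rewrite -normrX ger0_norm ?exprn_even_ge0// /U -opprB exprNn -signr_odd mul1r.
move: hw0; under eq_integral do rewrite eU.
move=> hw0.
have iU4 : integ P (fun w => U w ^+ 4).
  apply/integrableP; split; first by apply/measurable_EFinP; exact: measurable_funX.
  rewrite (_ : (fun w => _) = (fun w => (U w ^+ 4)%:E)).
    exact: le_lt_trans hw0 (ltry _).
  by apply/funext => w /=; rewrite ger0_norm// exprn_even_ge0.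
have EU4 : Ex P (fun w => U w ^+ 4) <= A + 1.
  by move: hw0; rewrite Ex_EFin// lee_fin.
have mU2 : mfun (fun w => U w ^+ 2) by exact: mfun_sqr.
have e4 x : x ^+ 4 = (x ^+ 2) ^+ 2 :> R by rewrite -exprM.
have [iU2 EU2] : integ P (fun w => U w ^+ 2) /\
    Ex P (fun w => U w ^+ 2) ^+ 2 <= Ex P (fun w => U w ^+ 4).
  have e : (fun w => (U w ^+ 2) ^+ 2) = (fun w => U w ^+ 4).
    by apply/funext => w; rewrite e4.
  have := @Ex_sqr_le _ _ _ P _ mU2; rewrite e; exact.
have [iU EU] := Ex_sqr_le mU iU2.
have WE : W = (fun w => U w + a) by apply/funext => w; rewrite subrK.
have iW : integ P W by rewrite WE; apply: integD => //; exact: integ_cst.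
have EW : Ex P W = Ex P U + a.
  by rewrite {1}WE ExD// ?Ex_cst//; exact: integ_cst.
have pt w : (W w - Ex P W) ^+ 4 <= 8 * (U w ^+ 4 + Ex P U ^+ 4).
  have -> : W w - Ex P W = U w - Ex P U by rewrite EW /U; ring.
  set u := U w; set v := Ex P U; rewrite !e4.
  have h1 : (u - v) ^+ 2 <= 2 * (u ^+ 2 + v ^+ 2) by have := sqr_ge0 (u + v); nra.
  apply: (@le_trans _ _ ((2 * (u ^+ 2 + v ^+ 2)) ^+ 2)).
    by apply: lerXn2r; rewrite ?nnegrE ?sqr_ge0// mulr_ge0 ?addr_ge0 ?sqr_ge0.
  have := sqr_ge0 (u ^+ 2 - v ^+ 2); nra.
have iB : integ P (fun w => 8 * (U w ^+ 4 + Ex P U ^+ 4)).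
  by apply: integZ; apply: integD => //; exact: integ_cst.
have i4 : integ P (fun w => (W w - Ex P W) ^+ 4).
  apply: integ_dom iB _ _.
    apply: measurable_funX; apply: measurable_funB => //; exact: measurable_cst.
  by move=> w; rewrite ger0_norm ?exprn_even_ge0.
split=> //; apply: le_trans (Ex_le i4 iB pt) _.
rewrite ExZ; last by apply: integD => //; exact: integ_cst.
rewrite ExD//; last exact: integ_cst.
rewrite Ex_cst; have h : Ex P U ^+ 4 <= A + 1.
  apply: le_trans EU4; apply: le_trans EU2; rewrite e4.
  by apply: lerXn2r; rewrite ?nnegrE ?sqr_ge0//; apply: Ex_ge0 => w; exact: sqr_ge0.
lra.
Qed.

Lemma concentrated_variance C c q : 1 <= C -> 0 < c -> 0 < q ->
  exists2 M, 1 <= M & forall d (T : measurableType d) (P : probability T R)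
    (W : T -> R), mfun W -> concentrated P W (decay C c q) ->
  [/\ integ P W, integ P (fun w => (W w - Ex P W) ^+ 4),
      Ex P (fun w => (W w - Ex P W) ^+ 4) <= M,
      integ P (fun w => (W w - Ex P W) ^+ 2) &
      Ex P (fun w => (W w - Ex P W) ^+ 2) <= M].
Proof.
move=> C1 c0 q0; have [M M0 hM] := concentrated_moment4 C1 c0 q0.
exists (1 + M); first by rewrite lerDl.
move=> d T P W mW conc; have [iW i4 E4] := hM _ _ _ _ mW conc.
set U := fun w => W w - Ex P W.
have mU : mfun U by apply: measurable_funB => //; exact: measurable_cst.
have i1 : integ P (fun w => 1 + U w ^+ 4) by apply: integD => //; exact: integ_cst.
have le1 w : U w ^+ 2 <= 1 + U w ^+ 4.
  rewrite -[4%N]/(2 * 2)%N exprM; have := sqr_ge0 (U w ^+ 2 - 1); have := sqr_ge0 (U w); nra.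
have i2 : integ P (fun w => U w ^+ 2).
  apply: integ_dom i1 _ _; first exact: mfun_sqr.
  by move=> w; rewrite ger0_norm ?sqr_ge0.
split=> //; first by apply: le_trans E4 _; rewrite lerDr.
apply: le_trans (Ex_le i2 i1 le1) _; rewrite ExD ?Ex_cst ?lerD2l//; exact: integ_cst.
Qed.

(** By Chebyshev the event B that W lies within s of its mean has probability at least 1/2. If W
    deviates by t >= 2 s while W' lies in B, then |W - W'| >= t / 2, so the tail of W costs at most
    twice that of W - W'. *)
Lemma concentrated_mean_tail C c q : 1 <= C -> 0 < c -> 0 < q ->
  exists C1 c1, [/\ C <= C1, 0 < c1 &
  forall d (T : measurableType d) (P : probability T R) (W : T -> R),
    mfun W -> concentrated P W (decay C c q) ->
  concentrated_around P W (Ex P W) (decay C1 c1 q)].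
Proof.
move=> C1 c0 q0; have [M M1 hM] := concentrated_variance C1 c0 q0.
have M0 : 0 < M by apply: lt_le_trans M1.
have Cp : 0 < C by apply: lt_le_trans C1.
pose s := Num.sqrt (2 * M).
have s2 : s ^+ 2 = 2 * M by rewrite sqr_sqrtr// mulr_ge0// ltW.
have s0 : 0 < s by rewrite sqrtr_gt0 mulr_gt0.
pose c1 := 2 `^ q * c.
have c10 : 0 < c1 by rewrite mulr_gt0// powR_gt0.
pose L := (2 * s) `^ q / c1.
have L0 : 0 <= L by rewrite divr_ge0 ?powR_ge0 ?ltW.
(* The 2 compensates P B >= 1/2, [expR L] makes the bound at least 1 for t < 2 s, and the power of 2
   in [c1] comes from evaluating at t / 2. *)
exists (2 * C * expR L), c1; split => //.
  have : 1 <= expR L by rewrite -expR0 ler_expR.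
  by rewrite mulrC => h; rewrite mulrA ler_peMl ?ltW//; lra.
move=> d T P W mW conc t t0.
have [iW _ _ i2 E2] := hM _ _ _ _ mW conc.
set b := Ex P W in i2 E2 *.
have mU : mfun (fun w => W w - b) by apply: measurable_funB => //; exact: measurable_cst.
have mA : measurable [set w | t <= `|W w - b|].
  by apply: measurable_ge_set; exact: measurableT_comp.
have expE x : expR L * expR x = expR (L + x) by rewrite expRD.
have [ts|ts] := leP (2 * s) t; last first.
  apply: le_trans (probability_le1 P mA) _; rewrite lee_fin /decay -mulrA expE.
  have : 1 <= expR (L - t `^ q / c1).
    rewrite -expR0 ler_expR subr_ge0 ler_wpM2r ?invr_ge0 ?(ltW c10)//.
    by rewrite ge0_ler_powR ?nnegrE ?(ltW q0) ?(ltW t0) ?(ltW ts)// mulr_ge0// ltW.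
  by nra.
pose B := [set w | `|W w - b| < s].
have mB : measurable B by apply: measurable_lt_set; exact: measurableT_comp.
have PB : (2^-1%:E <= P B)%E.
  have -> : B = ~` [set w | s <= `|W w - b|].
    by apply/seteqP; split => w; rewrite /B /= ltNge => /negP.
  have mB' : measurable [set w | s <= `|W w - b|].
    by apply: measurable_ge_set; exact: measurableT_comp.
  have h := chebyshev_le mU i2 s0.
  rewrite probability_setC//; set x := P _ in h *.
  have hx : (x <= 2^-1%:E)%E.
    apply: le_trans h _; rewrite lee_fin s2 ler_pdivrMr ?mulr_gt0//; lra.
  have xf : x \is a fin_num by apply: fin_num_measure.
  move: hx; rewrite -(fineK xf) -EFinB !lee_fin; lra.
set A := [set w | _] in mA *.
have PAB : (P A * P B <= (decay C c q (t / 2))%:E)%E.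
  rewrite -product_measure1E//; apply: le_trans (conc (t / 2) _); last by rewrite divr_gt0.
  apply: le_measure; rewrite ?inE.
  - exact: measurableX.
  - apply: measurable_ge_set; apply: measurableT_comp => //.
    apply: measurable_funB; exact: measurableT_comp.
  move=> [w w'] [] /= hA hB; rewrite /A /B /= in hA hB.
  have := ler_distD (W w') (W w) b.
  move: hA hB ts; lra.
have Af : P A \is a fin_num by apply: fin_num_measure.
have Bf : P B \is a fin_num by apply: fin_num_measure.
move: PB PAB; rewrite -(fineK Af) -(fineK Bf) -EFinM !lee_fin => PB PAB.
have A0 : 0 <= fine (P A) by apply: fine_ge0.
have hd : decay C c q (t / 2) = C * expR (- (t `^ q / c1)).
  rewrite /decay /c1 powRM ?(ltW t0)// ?invr_ge0//; congr (_ * expR (- _)).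
  rewrite -[2^-1]powR_inv1// -powRrM mulN1r powRN.
  by field; rewrite !gt_eqF// powR_gt0.
rewrite hd in PAB.
have hL : 1 <= expR L by rewrite -expR0 ler_expR.
rewrite /decay; set X := expR (- _) in PAB *.
have X0 : 0 <= X by exact: expR_ge0.
apply: (@le_trans _ _ (2 * (C * X))); first by nra.
have -> : 2 * C * expR L * X = 2 * (C * X) * expR L by ring.
by rewrite ler_peMr// !mulr_ge0// ltW.
Qed.

End ExponentialConcentration.

(** * Random matrices *)

Lemma frobeniusE (R : realType) m n (A : 'M[R]_(m, n)) : frobenius A = fnorm A.
Proof.
by rewrite /frobenius /fnorm ipE; congr Num.sqrt.
Qed.

Section MeasurableMatrices.
Context d (T : measurableType d) (R : realType).

Lemma rmx_cst m n (A : 'M[R]_(m, n)) : random_mx (fun _ : T => A).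
Proof. by move=> i j; exact: measurable_cst. Qed.

Lemma rmx_mul m n k (X : T -> 'M[R]_(m, n)) (Y : T -> 'M[R]_(n, k)) :
  random_mx X -> random_mx Y -> random_mx (fun w => X w *m Y w).
Proof.
move=> hX hY i j; rewrite (_ : (fun w => _) = (fun w => \sum_l X w i l * Y w l j)).
  by apply: measurable_sum => l; exact: measurable_funM.
by apply/funext => w; rewrite mxE.
Qed.

Lemma rmx_add m n (X Y : T -> 'M[R]_(m, n)) :
  random_mx X -> random_mx Y -> random_mx (fun w => X w + Y w).
Proof.
move=> hX hY i j; rewrite (_ : (fun w => _) = (fun w => X w i j + Y w i j)).
  exact: measurable_funD.
by apply/funext => w; rewrite mxE.
Qed.

Lemma rmx_scale m n (a : R) (X : T -> 'M[R]_(m, n)) :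
  random_mx X -> random_mx (fun w => a *: X w).
Proof.
move=> hX i j; rewrite (_ : (fun w => _) = (fun w => a * X w i j)).
  by apply: measurable_funM => //; exact: measurable_cst.
by apply/funext => w; rewrite mxE.
Qed.

Lemma rmx_tr m n (X : T -> 'M[R]_(m, n)) :
  random_mx X -> random_mx (fun w => (X w)^T).
Proof.
move=> hX i j; rewrite (_ : (fun w => _) = (fun w => X w j i))//.
by apply/funext => w; rewrite mxE.
Qed.

Lemma rmx_col m n k (X : T -> 'M[R]_(m, n)) :
  random_mx X -> random_mx (fun w => col k (X w)).
Proof.
move=> hX i j; rewrite (_ : (fun w => _) = (fun w => X w i k))//.
by apply/funext => w; rewrite mxE.
Qed.

Lemma mfun_trace n (X : T -> 'M[R]_n) :
  random_mx X -> mfun (fun w => \tr (X w)).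
Proof. by move=> hX; apply: measurable_sum. Qed.

Lemma mfun_ip m n (X Y : T -> 'M[R]_(m, n)) :
  random_mx X -> random_mx Y -> mfun (fun w => ip (X w) (Y w)).
Proof. by move=> hX hY; apply/mfun_trace/rmx_mul => //; exact: rmx_tr. Qed.

Lemma mfun_sqrt (f : T -> R) : mfun f -> mfun (fun w => Num.sqrt (f w)).
Proof.
move=> hf; apply: measurableT_comp => //.
by apply: continuous_measurable_fun; exact: sqrt_continuous.
Qed.

Lemma mfun_fnorm m n (X : T -> 'M[R]_(m, n)) :
  random_mx X -> mfun (fun w => fnorm (X w)).
Proof. by move=> hX; apply/mfun_sqrt/mfun_ip. Qed.

Lemma mfun_det n (X : T -> 'M[R]_n) : random_mx X -> mfun (fun w => \det (X w)).
Proof.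
move=> hX; apply: measurable_sum => s; apply: measurable_funM.
  exact: measurable_cst.
by apply: measurable_prod => i _.
Qed.

(** An entry of the inverse is a cofactor over the determinant, both polynomial in the entries. *)
Lemma rmx_inv n (X : T -> 'M[R]_n) : (forall w, X w \in unitmx) ->
  random_mx X -> random_mx (fun w => invmx (X w)).
Proof.
move=> uX hX i j.
rewrite (_ : (fun w => _) = (fun w => (\det (X w))^-1 *
    ((-1) ^+ (j + i) * \det (row' j (col' i (X w)))))); last first.
  by apply/funext => w; rewrite /invmx uX !mxE.
apply: measurable_funM.
  by apply: measurableT_comp; [exact: measurable_inv|exact: mfun_det].
apply: measurable_funM; first exact: measurable_cst.
apply: mfun_det => k l.
rewrite (_ : (fun w => _) = (fun w => X w (lift j k) (lift i l)))//.
by apply/funext => w; rewrite !mxE.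
Qed.

(* A Lipschitz function is the pointwise limit of its compositions with
   entrywise roundings of X, which take countably many values. *)
Lemma mfun_lipschitz m n (f : 'M[R]_(m, n) -> R) (L : R)
    (X : T -> 'M[R]_(m, n)) : 0 <= L ->
  (forall u v, `|f u - f v| <= L * fnorm (u - v)) ->
  random_mx X -> mfun (f \o X).
Proof.
move=> L0 fL hX.
pose h (k : nat) (N : 'M[int]_(m, n)) : 'M[R]_(m, n) :=
  \matrix_(i, j) ((N i j)%:~R / k.+1%:R).
pose N (k : nat) (w : T) : 'M[int]_(m, n) :=
  \matrix_(i, j) Num.floor (k.+1%:R * X w i j).
apply: (@measurable_fun_cvg _ _ _ _ (fun k => f \o h k \o N k)).
- move=> k _ B mB; rewrite setTI.
  have -> : (f \o h k \o N k) @^-1` B =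
      \bigcup_(M : 'M[int]_(m, n))
        (if f (h k M) \in B then [set w | N k w = M] else set0).
    apply/seteqP; split => [w hw|w [M _]].
      by exists (N k w) => //; rewrite (mem_set (hw : B (f (h k (N k w))))).
    by case: ifPn => // /set_mem hM /= ->.
  apply: countable_bigcupT_measurable.
    exact: countableP.
  move=> M; case: ifP => // _.
  have -> : [set w | N k w = M] = \bigcap_(ij in [set: 'I_m * 'I_n])
     [set w | (M ij.1 ij.2)%:~R <= k.+1%:R * X w ij.1 ij.2 <
              (M ij.1 ij.2 + 1)%:~R].
    apply/seteqP; split => [w <- [i j] _ /=|w hw /=].
      by rewrite mxE floor_itv.
    apply/matrixP => i j; have := hw (i, j) I; rewrite /= mxE.
    by move=> /floor_def.
  apply: fin_bigcap_measurable; first exact: finite_finset.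
  move=> [i j] _ /=.
  have mg : mfun (fun w => k.+1%:R * X w i j).
    by apply: measurable_funM => //; exact: measurable_cst.
  set a := (M i j)%:~R; set b := (M i j + 1)%:~R.
  have -> : [set w | a <= k.+1%:R * X w i j < b] =
     [set w | a <= k.+1%:R * X w i j] `&` [set w | k.+1%:R * X w i j < b].
    by apply/seteqP; split => w /= => [/andP[]|[-> ->]].
  by apply: measurableI; [exact: measurable_ge_set|exact: measurable_lt_set].
move=> w _; apply/cvgrPdist_lt => e e0.
pose c := L * Num.sqrt (m * n)%:R + 1.
have c0 : 0 < c by rewrite ltr_wpDl// mulr_ge0 ?sqrtr_ge0.
have ec : 0 < e / c by rewrite divr_gt0.
have [k0 _ hk0] := near_infty_natSinv_lt (PosNum ec).
exists k0 => // k /hk0 /= hk.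
apply: le_lt_trans (fL _ _) _.
have hn : fnorm (X w - h k (N k w)) <= Num.sqrt (m * n)%:R * k.+1%:R^-1.
  rewrite -ler_sqr ?nnegrE ?fnorm_ge0 ?mulr_ge0 ?sqrtr_ge0 ?invr_ge0//.
  rewrite sqr_fnorm exprMn sqr_sqrtr// ipE.
  have -> : (m * n)%:R * k.+1%:R^-1 ^+ 2 =
     \sum_(i < m) \sum_(j < n) (k.+1%:R^-1 ^+ 2 : R).
    by rewrite !sumr_const !card_ord -mulrnA mulr_natl mulnC.
  apply: ler_sum => i _; apply: ler_sum => j _; rewrite -expr2 !mxE.
  set a : R := k.+1%:R; have a0 : 0 < a by rewrite ltr0n.
  have /andP[h1 h2] := floor_itv (a * X w i j).
  set b := (Num.floor _)%:~R in h1 *; rewrite intrD -/b in h2.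
  have -> : X w i j - b / a = (a * X w i j - b) * a^-1 by field; rewrite gt_eqF.
  rewrite exprMn ler_piMl ?sqr_ge0// expr_le1//; lra.
apply: (@le_lt_trans _ _ (c * k.+1%:R^-1)).
  apply: le_trans (ler_wpM2l L0 hn) _; rewrite mulrA ler_wpM2r ?invr_ge0//.
  by rewrite lerDl.
by rewrite -ltr_pdivlMl// mulrC.
Qed.

End MeasurableMatrices.

(** * Convex Lipschitz functionals of the random matrix *)

Section ConvexConcentration.
Context d (T : measurableType d) (R : realType) (P : probability T R).
Variables (p n : nat) (X : T -> 'M[R]_(p, n)) (C c q : R).
Hypothesis hX : convexly_concentrated P (@frobenius R p n) X (decay C c q).

Lemma quasiconvexW (f : 'M[R]_(p, n) -> R) :
  (forall u v t a, 0 <= t -> t <= 1 -> f u <= a -> f v <= a ->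
     f (t *: u + (1 - t) *: v) <= a) -> quasiconvex f.
Proof.
move=> hf a u v k; rewrite !inE /= => hu hv.
by apply: hf.
Qed.

Lemma convex_concentrated_lipschitz (f : 'M[R]_(p, n) -> R) (L : R) : 0 < L ->
  (forall u v, `|f u - f v| <= L * fnorm (u - v)) ->
  (forall u v t a, 0 <= t -> t <= 1 -> f u <= a -> f v <= a ->
     f (t *: u + (1 - t) *: v) <= a) ->
  concentrated P (fun w => L^-1 * f (X w)) (decay C c q).
Proof.
move=> L0 fL fc; apply: (hX (f := fun M => L^-1 * f M)).
  move=> u v; rewrite frobeniusE -mulrBr normrM gtr0_norm ?invr_gt0//.
  by rewrite mulrC ler_pdivrMr// mulrC.
apply: quasiconvexW => u v t a t0 t1; rewrite ![L^-1 * _]mulrC !ler_pdivrMr//.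
exact: fc.
Qed.

Lemma concentrated_linear_norm k l (A : 'M[R]_(k, p)) (B : 'M[R]_(n, l)) (L : R) :
  0 < L -> (forall H, fnorm (A *m H *m B) <= L * fnorm H) ->
  concentrated P (fun w => L^-1 * fnorm (A *m X w *m B)) (decay C c q).
Proof.
move=> L0 hL; apply: (@convex_concentrated_lipschitz (fun M => fnorm (A *m M *m B))) => //.
  move=> u v; apply: le_trans (fnorm_dist _ _) _.
  by rewrite -mulmxBl -mulmxBr.
move=> u v t a t0 t1 hu hv.
rewrite mulmxDr mulmxDl -!scalemxAr -!scalemxAl.
apply: le_trans (fnormD _ _) _; rewrite !fnormZ !ger0_norm ?subr_ge0//.
have t1' : 0 <= 1 - t by rewrite subr_ge0.
nra.
Qed.

Lemma concentrated_ip (U : 'M[R]_(p, n)) (L : R) : 0 < L -> fnorm U <= L ->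
  concentrated P (fun w => L^-1 * ip U (X w)) (decay C c q).
Proof.
move=> L0 hL; apply: (@convex_concentrated_lipschitz (ip U)) => //.
  move=> u v; rewrite -ipBr; apply: le_trans (ip_le_fnorm _ _) _.
  by rewrite ler_wpM2r ?fnorm_ge0.
move=> u v t a t0 t1 hu hv; rewrite !ip_lin.
have t1' : 0 <= 1 - t by rewrite subr_ge0.
nra.
Qed.

End ConvexConcentration.

(** * Concentration of resolvent traces *)

Section DecayMonotone.
Variable R : realType.
Implicit Types (C c q t K : R).

Lemma decay_ge0 C c q t : 0 <= C -> 0 <= decay C c q t.
Proof. by move=> C0; rewrite mulr_ge0// expR_ge0. Qed.

Lemma decay_anti C c q s t : 0 <= C -> 0 < c -> 0 <= q -> 0 <= s -> s <= t ->
  decay C c q t <= decay C c q s.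
Proof.
move=> C0 c0 q0 s0 st; rewrite ler_wpM2l// ler_expR lerN2.
rewrite ler_wpM2r ?invr_ge0 ?(ltW c0)//.
by rewrite ge0_ler_powR ?nnegrE ?(le_trans s0 st).
Qed.

Lemma decay_le C c C' c' q t : 0 <= C -> C <= C' -> 0 < c -> c <= c' ->
  decay C c q t <= decay C' c' q t.
Proof.
move=> C0 CC c0 cc; apply: ler_pM; rewrite ?expR_ge0//.
rewrite ler_expR lerN2 ler_wpM2l ?powR_ge0//.
by rewrite lef_pV2// posrE (lt_le_trans c0).
Qed.

Lemma decay_div C c q t K : 0 < c -> 0 <= t -> 0 < K ->
  decay C c q (t / K) = decay C (c * K `^ q) q t.
Proof.
move=> c0 t0 K0; rewrite /decay powRM ?invr_ge0 ?(ltW K0)//.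
congr (_ * expR (- _)).
rewrite -[K^-1]powR_inv1 ?(ltW K0)// -powRrM mulN1r powRN.
by field; rewrite !gt_eqF// powR_gt0.
Qed.

End DecayMonotone.

Section TangentSup.
Variables (R : realType) (p n k : nat) (z b kap r : R) (B : 'M[R]_(p, k)).
Hypotheses (z0 : 0 < z) (b0 : 0 < b) (hzk : z^-1 <= kap) (r0 : 0 <= r).
Hypothesis hB : forall m (U : 'M[R]_(p, m)), fnorm (B^T *m U) <= b * fnorm U.
Hypothesis n0 : (0 < n)%N.

Let c := b / z.
Let Phi (X : 'M[R]_(p, n)) : R :=
  ip B (resolvent z X *m B) + c ^+ 2 * n%:R^-1 * ip X X.
Let tangents (Y : 'M[R]_(p, n)) : set R :=
  [set Phi X + gram_slope z B b X (Y - X) | X in [set X | fnorm X <= r]].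

(* The largest convex Lipschitz function below Phi that agrees with it on the
   ball of radius r. *)
Definition tangent_sup Y : R := sup (tangents Y).

Let L := 4 * n%:R^-1 * (b * kap) ^+ 2 * r.

Let tangents_ub Y : ubound (tangents Y) (Phi Y).
Proof. by move=> _ [X _ <-]; have := gram_tangent z0 (ltW b0) hB X Y; rewrite -/(Phi X) -/(Phi Y). Qed.

Let tangents_nonempty Y : tangents Y !=set0.
Proof.
by exists (Phi 0 + gram_slope z B b 0 (Y - 0)), 0; rewrite //= /fnorm ip0r sqrtr0.
Qed.

Let tangents_has_sup Y : has_sup (tangents Y).
Proof. by split; [exact: tangents_nonempty|exists (Phi Y); exact: tangents_ub]. Qed.

Let le_tangent_sup (X Y : 'M[R]_(p, n)) : fnorm X <= r ->
  Phi X + gram_slope z B b X (Y - X) <= tangent_sup Y.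
Proof. by move=> hX; apply: ub_le_sup; [exact: (tangents_has_sup Y).2|exists X]. Qed.

Let tangent_sup_le (Y : 'M[R]_(p, n)) a : (forall X, fnorm X <= r ->
  Phi X + gram_slope z B b X (Y - X) <= a) -> tangent_sup Y <= a.
Proof. by move=> h; apply: ge_sup => // _ [X hX <-]; exact: h. Qed.

Lemma tangent_supE Y : fnorm Y <= r ->
  tangent_sup Y = ip B (resolvent z Y *m B) + c ^+ 2 * n%:R^-1 * ip Y Y.
Proof.
move=> hY; apply/eqP; rewrite eq_le; apply/andP; split.
  by apply: ge_sup => //; exact: tangents_ub.
have := le_tangent_sup Y hY; rewrite subrr.
have := gram_slopeZ z B b Y 0 0; rewrite scale0r mul0r => ->.
by rewrite addr0.
Qed.

Lemma slope_le_lipschitz (X H : 'M[R]_(p, n)) : fnorm X <= r ->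
  `|gram_slope z B b X H| <= L * fnorm H.
Proof.
move=> hX; apply: le_trans (gram_slope_le z0 (ltW b0) hB X H) _.
rewrite ler_wpM2r ?fnorm_ge0//.
rewrite (_ : _ * fnorm X = 4 * n%:R^-1 * ((b / z) ^+ 2 * fnorm X)); last by ring.
rewrite (_ : L = 4 * n%:R^-1 * ((b * kap) ^+ 2 * r)); last by rewrite /L; ring.
rewrite ler_wpM2l ?mulr_ge0 ?invr_ge0//.
apply: ler_pM; rewrite ?sqr_ge0 ?fnorm_ge0//.
have c0 : 0 <= b / z by rewrite divr_ge0 ?ltW.
apply: lerXn2r; rewrite ?nnegrE//; last by rewrite ler_wpM2l// ltW.
by rewrite mulr_ge0 ?(ltW b0)//; apply: le_trans hzk; rewrite invr_ge0 ltW.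
Qed.

Lemma tangent_sup_lipschitz (Y Y' : 'M[R]_(p, n)) :
  `|tangent_sup Y - tangent_sup Y'| <= L * fnorm (Y - Y').
Proof.
have h U V : tangent_sup U <= tangent_sup V + L * fnorm (U - V).
  apply: tangent_sup_le => X hX; have := le_tangent_sup V hX.
  have := slope_le_lipschitz (U - V) hX; rewrite ler_norml => /andP[_].
  rewrite !gram_slopeB => h1 h2; lra.
have := h Y Y'; have := h Y' Y.
rewrite -(fnormN (Y' - Y)) opprB ler_norml => h1 h2; lra.
Qed.

Lemma tangent_sup_quasiconvex (u v : 'M[R]_(p, n)) t a : 0 <= t -> t <= 1 ->
  tangent_sup u <= a -> tangent_sup v <= a ->
  tangent_sup (t *: u + (1 - t) *: v) <= a.
Proof.
move=> t0 t1 hu hv; apply: tangent_sup_le => X hX.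
have := le_trans (le_tangent_sup u hX) hu.
have := le_trans (le_tangent_sup v hX) hv.
have t1' : 0 <= 1 - t by rewrite subr_ge0.
by rewrite !gram_slopeB gram_slopeD !gram_slopeZ; nra.
Qed.

End TangentSup.

(** On the ball of radius r the trace is [tangent_sup] minus a multiple of |X|^2. Both terms are
    controlled, the first as a convex Lipschitz function and the second through |X|, which is one
    itself. Four events are discarded: either copy of X outside the ball, or a deviation of one of
    the two functionals. *)
Lemma resolvent_trace_concentrated (R : realType) (C c q M1 kap b : R) :
  1 <= C -> 0 < c -> 0 < q -> 1 <= M1 -> 0 < kap -> 0 < b ->
  exists C' c', [/\ 1 <= C', 0 < c' &
    forall (n p : nat) (d : measure_display) (T : measurableType d)
      (P : probability T R) (X : T -> 'M[R]_(p, n)) (z : R) k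
      (B : 'M[R]_(p, k)),
    (0 < n)%N -> (0 < p)%N -> 0 < z -> z^-1 <= kap -> random_mx X ->
    convexly_concentrated P (@frobenius R p n) X (decay C c q) ->
    Ex P (fun w => fnorm (X w)) <= M1 * Num.sqrt (n * p)%:R ->
    (forall m (U : 'M[R]_(p, m)), fnorm (B^T *m U) <= b * fnorm U) ->
    ip B B <= b ^+ 2 * p%:R ->
    concentrated P (fun w => Num.sqrt n%:R *
       (ip B (resolvent z (X w) *m B) / p%:R)) (decay C' c' q)].
Proof.
move=> C1 c0 q0 M11 kap0 b0.
have Cp : 0 <= C by apply: le_trans C1.
have [C2 [c2 [CC2 c20 tailX]]] := concentrated_mean_tail C1 c0 q0.
have C2p : 0 <= C2 by apply: le_trans CC2.
have M10 : 0 < M1 by apply: lt_le_trans M11.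
(* The two Lipschitz contributions add up to 12 (b kap)^2 M1; the 16 leaves room for a strict
   inequality. *)
pose K1 := 16 * (b * kap) ^+ 2 * M1.
pose K2 := b ^+ 2 * kap.
have K10 : 0 < K1 by rewrite !mulr_gt0// exprn_gt0// mulr_gt0.
have K20 : 0 < K2 by rewrite mulr_gt0// exprn_gt0.
pose c' := c * K1 `^ q + c2 * K2 `^ q.
have h1 : 0 < c * K1 `^ q by rewrite mulr_gt0// powR_gt0.
have h2 : 0 < c2 * K2 `^ q by rewrite mulr_gt0// powR_gt0.
exists (2 * C + 2 * C2), c'; split.
- by rewrite -[leLHS]addr0 lerD//; lra.
- by rewrite addr_gt0.
move=> n p d T P X z k B n0 p0 z0 hzk rX hX EX hB hBB t t0.
set g := fun w => ip B (resolvent z (X w) *m B).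
have nR : 0 < n%:R :> R by rewrite ltr0n.
have pR : 0 < p%:R :> R by rewrite ltr0n.
have p1 : 1 <= p%:R :> R by rewrite ler1n.
pose sn : R := Num.sqrt n%:R; pose sp : R := Num.sqrt p%:R.
have sn0 : 0 < sn by rewrite sqrtr_gt0.
have sp0 : 0 < sp by rewrite sqrtr_gt0.
have snE : sn ^+ 2 = n%:R by rewrite sqr_sqrtr// ltW.
have spE : sp ^+ 2 = p%:R by rewrite sqr_sqrtr// ltW.
have sp1 : 1 <= sp by rewrite -[leLHS]sqrtr1 ler_wsqrtr.
have snp : Num.sqrt (n * p)%:R = sn * sp by rewrite natrM sqrtrM// ltW.
rewrite snp in EX.
have mN : mfun (fun w => fnorm (X w)) by exact: mfun_fnorm.
have cN : concentrated P (fun w => fnorm (X w)) (decay C c q).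
  have := @concentrated_linear_norm _ _ _ P _ _ X C c q hX _ _ 1%:M 1%:M 1 ltr01.
  have -> : (fun w => 1^-1 * fnorm (1%:M *m X w *m 1%:M)) = (fun w => fnorm (X w)).
    by apply/funext => w; rewrite invr1 mul1r mul1mx mulmx1.
  by apply => H; rewrite mul1mx mulmx1 mul1r.
(* Twice the bound on the mean of |X|, so that leaving the ball is a deviation of at least M1 sqrt
   (n p). *)
pose r := 2 * M1 * (sn * sp).
have r0 : 0 < r by rewrite !mulr_gt0.
pose L := 4 * n%:R^-1 * (b * kap) ^+ 2 * r.
have L0 : 0 < L by rewrite !mulr_gt0// ?invr_gt0// exprn_gt0// mulr_gt0.
pose Psi := tangent_sup z b r B (n := n).
have PsiL u v : `|Psi u - Psi v| <= L * fnorm (u - v).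
  by apply: tangent_sup_lipschitz => //; exact: ltW.
have cPsi : concentrated P (fun w => L^-1 * Psi (X w)) (decay C c q).
  apply: (convex_concentrated_lipschitz hX L0 PsiL) => u v a e a0 a1.
  by apply: tangent_sup_quasiconvex => //; exact: ltW.
have mPsi : mfun (fun w => L^-1 * Psi (X w)).
  apply: measurable_funM; first exact: measurable_cst.
  exact: (@mfun_lipschitz _ _ _ _ _ Psi L X (ltW L0)).
have gb w : 0 <= g w <= K2 * p%:R.
  rewrite /g (psd_ip (coercive_inv_psd z0 (gram_coercive z (X w)))) /=.
  apply: le_trans (coercive_inv_le z0 (gram_coercive z (X w)) B) _.
  apply: (@le_trans _ _ (kap * (b ^+ 2 * p%:R))).
    by apply: ler_pM => //; [rewrite invr_ge0 ltW|exact: ip_ge0].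
  by rewrite /K2 mulrA (mulrC kap).
pose s := t / K1; have s0 : 0 < s by rewrite divr_gt0.
pose E1 := [set w : T | r <= fnorm (X w)].
have mE1 : measurable E1 by exact: measurable_ge_set.
pose E3 := [set w : T * T | s <= `|L^-1 * Psi (X w.1) - L^-1 * Psi (X w.2)|].
pose E4 := [set w : T * T | s <= `|fnorm (X w.1) - fnorm (X w.2)|].
have mdiff (W : T -> R) : mfun W -> measurable [set w : T * T | s <= `|W w.1 - W w.2|].
  move=> mW; apply: measurable_ge_set; apply: measurableT_comp => //.
  by apply: measurable_funB; exact: measurableT_comp.
have mE3 : measurable E3 by exact: (mdiff (fun w => L^-1 * Psi (X w))).
have mE4 : measurable E4 by exact: (mdiff (fun w => fnorm (X w))).
set E := [set w : T * T | _].
have mres : random_mx (fun w => resolvent z (X w)).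
  apply: rmx_inv => [w|]; first exact: (coercive_unit z0 (gram_coercive z (X w))).
  apply: rmx_add; last exact: rmx_cst.
  by apply/rmx_scale/rmx_mul => //; exact: rmx_tr.
have mg : mfun g.
  by apply: mfun_ip; [exact: rmx_cst|apply: rmx_mul => //; exact: rmx_cst].
have mE : measurable E.
  apply: measurable_ge_set; apply: measurableT_comp => //.
  have mW : mfun (fun w => sn * (g w / p%:R)).
    apply: measurable_funM; first exact: measurable_cst.
    by apply: measurable_funM => //; exact: measurable_cst.
  by apply: measurable_funB; apply: (measurableT_comp mW).
have rhs0 : 0 <= decay (2 * C + 2 * C2) c' q t.
  by rewrite decay_ge0// addr_ge0// mulr_ge0.
(* Since 0 <= g / p <= K2, the event is empty for larger t. In the remaining range t / K2 <= sqrt n,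
   so the probability of leaving the ball is itself bounded by a decay in t. *)
have [tb|tb] := leP t (sn * K2); last first.
  rewrite (_ : E = set0) ?measure0// -subset0 => -[w w'] /=; apply/negP.
  rewrite -ltNge; apply: le_lt_trans tb.
  rewrite -mulrBr normrM gtr0_norm// ler_wpM2l ?(ltW sn0)// -mulrBl normrM.
  rewrite normfV (gtr0_norm pR) ler_pdivrMr//.
  have /andP[a1 a2] := gb w; have /andP[a3 a4] := gb w'.
  rewrite ler_norml; lra.
have sub : E `<=` ((E1 `*` setT) `|` (setT `*` E1)) `|` (E3 `|` E4).
  move=> [w w'] hE; apply: contrapT => /not_orP[/not_orP[n1 n2] /not_orP[n3 n4]].
  have {}n1 : fnorm (X w) < r.
    by rewrite ltNge; apply/negP => h; apply: n1; split.
  have {}n2 : fnorm (X w') < r.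
    by rewrite ltNge; apply/negP => h; apply: n2; split.
  have {}n3 : `|L^-1 * Psi (X w) - L^-1 * Psi (X w')| < s.
    by rewrite ltNge; apply/negP.
  have {}n4 : `|fnorm (X w) - fnorm (X w')| < s by rewrite ltNge; apply/negP.
  move: hE; rewrite /E /=; apply/negP; rewrite -ltNge.
  have PsiE u : fnorm (X u) < r ->
      g u = Psi (X u) - (b / z) ^+ 2 * n%:R^-1 * fnorm (X u) ^+ 2.
    move=> hu; rewrite /Psi (tangent_supE z0 b0 (ltW r0) hB (ltW hu)) sqr_fnorm /g; ring.
  rewrite -mulrBr normrM gtr0_norm// -mulrBl normrM normfV (gtr0_norm pR).
  have dPsi : `|Psi (X w) - Psi (X w')| < L * s.
    by move: n3; rewrite -mulrBr normrM gtr0_norm ?invr_gt0// ltr_pdivrMl.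
  have bz : (b / z) ^+ 2 <= (b * kap) ^+ 2.
    have h0 : 0 <= b / z by rewrite divr_ge0 ?ltW.
    have h0' : 0 <= b * kap by rewrite mulr_ge0 ?(ltW b0) ?(ltW kap0).
    by apply: lerXn2r; rewrite ?nnegrE// ler_wpM2l// ltW.
  have dN : `|fnorm (X w) ^+ 2 - fnorm (X w') ^+ 2| <= 2 * r * s.
    rewrite subr_sqr normrM mulrC.
    apply: (@le_trans _ _ ((r + r) * s)); last by lra.
    apply: ler_pM => //; last exact: ltW.
    rewrite ger0_norm ?addr_ge0 ?fnorm_ge0//; lra.
  have dg : `|g w - g w'| <= L * s + (b * kap) ^+ 2 * n%:R^-1 * (2 * r * s).
    rewrite !PsiE//.
    have -> : Psi (X w) - (b / z) ^+ 2 / n%:R * fnorm (X w) ^+ 2 -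
      (Psi (X w') - (b / z) ^+ 2 / n%:R * fnorm (X w') ^+ 2) =
      (Psi (X w) - Psi (X w')) -
      (b / z) ^+ 2 * n%:R^-1 * (fnorm (X w) ^+ 2 - fnorm (X w') ^+ 2) by ring.
    apply: le_trans (ler_normB _ _) _; apply: lerD; first exact: ltW.
    have ni : 0 <= n%:R^-1 :> R by rewrite invr_ge0.
    have cz := mulr_ge0 (sqr_ge0 (b / z)) ni.
    rewrite normrM (ger0_norm cz); apply: ler_pM => //.
    by rewrite ler_wpM2r.
  rewrite mulrA ltr_pdivrMr//.
  apply: (@le_lt_trans _ _ (sn * (L * s + (b * kap) ^+ 2 * n%:R^-1 * (2 * r * s)))).
    by rewrite ler_wpM2l// ltW.
  have -> : sn * (L * s + (b * kap) ^+ 2 * n%:R^-1 * (2 * r * s)) =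
      12 / 16 * t * sp.
    rewrite /L /s /K1 /r -snE; field.
    by rewrite !gt_eqF.
  rewrite -spE expr2 mulrA; apply: (@le_lt_trans _ _ (12 / 16 * t * sp * sp)).
    by rewrite ler_peMr// !mulr_ge0// ltW.
  by rewrite !ltr_pM2r//; lra.
have PE1 : (P E1 <= (decay C2 c2 q (t / K2))%:E)%E.
  have tl := tailX _ _ P _ mN cN (M1 * (sn * sp)) _.
  apply: le_trans (le_trans (tl _) _); last 2 first.
  - by rewrite !mulr_gt0.
  - rewrite lee_fin; apply: decay_anti => //; rewrite ?(ltW q0) ?divr_ge0 ?(ltW t0) ?(ltW K20)//.
    rewrite ler_pdivrMr//; apply: le_trans tb _.
    rewrite ler_pM2r//; apply: (@le_trans _ _ (sn * sp)); first by rewrite ler_peMr// ltW.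
    by rewrite ler_peMl// mulr_ge0 ?(ltW sn0) ?(ltW sp0).
  apply: le_measure; rewrite ?inE//.
    apply: measurable_ge_set; apply: measurableT_comp => //.
    by apply: measurable_funB => //; exact: measurable_cst.
  move=> w /=; rewrite /E1 /= /r => hw.
  apply: le_trans (ler_norm _); lra.
have P1 : ((P \x P) (E1 `*` setT) = P E1)%E.
  by rewrite product_measure1E// -[RHS]mule1; congr (_ * _)%E; exact: probability_setT.
have P2 : ((P \x P) (setT `*` E1) = P E1)%E.
  by rewrite product_measure1E// -[RHS]mul1e; congr (_ * _)%E; exact: probability_setT.
have m1 : measurable (E1 `*` [set: T]) by exact: measurableX.
have m2 : measurable ([set: T] `*` E1) by exact: measurableX.
apply: (@le_trans _ _ ((P \x P) (((E1 `*` setT) `|` (setT `*` E1)) `|` (E3 `|` E4)))%E).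
  by apply: le_measure; rewrite ?inE//; do ![apply: measurableU => //].
have Q1 : ((P \x P) (E1 `*` setT) <= (decay C2 c2 q (t / K2))%:E)%E by rewrite P1.
have Q2 : ((P \x P) (setT `*` E1) <= (decay C2 c2 q (t / K2))%:E)%E by rewrite P2.
have m12 := measurableU _ _ m1 m2; have m34 := measurableU _ _ mE3 mE4.
apply: (le_trans (measureU2 _ m12 m34)).
apply: (@le_trans _ _ (((decay C2 c2 q (t / K2))%:E + (decay C2 c2 q (t / K2))%:E) +
   ((decay C c q s)%:E + (decay C c q s)%:E))%E).
  apply: leeD.
    by apply: (le_trans (measureU2 _ m1 m2)); apply: leeD.
  apply: (le_trans (measureU2 _ mE3 mE4)); apply: leeD; [exact: cPsi|exact: cN].
rewrite -!EFinD lee_fin /s !decay_div ?(ltW t0)//.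
have d1 : decay C (c * K1 `^ q) q t <= decay C c' q t.
  by apply: decay_le => //; rewrite /c' lerDl ltW.
have d2 : decay C2 (c2 * K2 `^ q) q t <= decay C2 c' q t.
  by apply: decay_le => //; rewrite /c' lerDr ltW.
have -> : decay (2 * C + 2 * C2) c' q t = 2 * decay C c' q t + 2 * decay C2 c' q t.
  by rewrite /decay; ring.
lra.
Qed.

(** * Independence *)

Section ProductRule.
Context d (T : measurableType d) (R : realType) (P : probability T R).

Lemma integrable_distribution d' (T' : measurableType d')
    (X : {RV P >-> T'}) (h : T' -> \bar R) :
  measurable_fun setT h -> P.-integrable setT (h \o X) ->
  (distribution P X).-integrable setT h.
Proof.
move=> mh /integrableP[_ hf]; apply/integrableP; split => //.
rewrite (@ge0_integral_distribution _ _ _ _ _ _ X (fun x => `|h x|%E))//.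
exact: measurableT_comp.
Qed.

Lemma Ex_independent (f g : T -> R) : mfun f -> mfun g ->
  (forall A B : set R, measurable A -> measurable B ->
    P (f @^-1` A `&` g @^-1` B) = (P (f @^-1` A) * P (g @^-1` B))%E) ->
  integ P f -> integ P g -> integ P (fun w => f w * g w) ->
  Ex P (fun w => f w * g w) = Ex P f * Ex P g.
Proof.
move=> mf mg hfg If Ig Ifg.
pose X : {RV P >-> R} := mfun_Sub (mem_set mf).
pose Y : {RV P >-> R} := mfun_Sub (mem_set mg).
have mZ : measurable_fun setT (fun w => (f w, g w)) by exact: measurable_fun_pair.
pose Z : {RV P >-> (R * R)%type} := mfun_Sub (mem_set mZ).
have eqm (B : set (R * R)) : measurable B ->
    (distribution P X \x distribution P Y)%E B = distribution P Z B.
  apply: product_measure_unique => A1 A2 m1 m2.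
  by rewrite /distribution /pushforward /= -hfg.
pose h := (fun x : R * R => (x.1 * x.2)%:E).
have mh : measurable_fun setT h.
  by apply/measurable_EFinP/measurable_funM.
have IZ : (distribution P Z).-integrable setT h by apply: integrable_distribution.
have IXY : (distribution P X \x distribution P Y)%E.-integrable setT h.
  move/integrableP : IZ => [_ hI]; apply/integrableP; split => //.
  rewrite (eq_measure_integral (distribution P Z))// => A mA _; exact: eqm.
have mid : measurable_fun [set: R] (EFin \o @idfun R).
  by apply/measurable_EFinP; exact: measurable_id.
have IX : (distribution P X).-integrable setT (EFin \o idfun).
  by apply: (@integrable_distribution _ _ X).
have IY : (distribution P Y).-integrable setT (EFin \o idfun).
  by apply: (@integrable_distribution _ _ Y).
have eX : (\int[distribution P X]_x (x%:E) = (Ex P f)%:E)%E.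
  by rewrite (@integral_distribution _ _ _ _ _ _ X EFin)//; exact: Ex_EFin.
have eY : (\int[distribution P Y]_x (x%:E) = (Ex P g)%:E)%E.
  by rewrite (@integral_distribution _ _ _ _ _ _ Y EFin)//; exact: Ex_EFin.
apply: EFin_inj; rewrite EFinM -eX -eY -Ex_EFin//.
transitivity (\int[distribution P Z]_x h x)%E.
  by rewrite (@integral_distribution _ _ _ _ _ _ Z h).
rewrite -(eq_measure_integral _ (fun A mA _ => eqm A mA)).
rewrite -integral12_prod_meas1//.
transitivity (\int[distribution P X]_x (x%:E * (Ex P g)%:E))%E.
  apply: eq_integral => x _; rewrite /fubini_F /h /= -eY.
  under eq_integral do rewrite EFinM.
  by rewrite integralZl.
by rewrite integralZr// eY.
Qed.

End ProductRule.

Section Independence.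
Context d (T : measurableType d) (R : realType) (P : probability T R).
Variables (p n : nat) (x : 'I_n -> T -> 'cV[R]_p).
Hypotheses (rx : forall i, random_mx (x i)) (ix : independent_vectors P x).

Let coord_gen : set (set 'cV[R]_p) :=
  [set A | exists i j, exists2 B : set R, measurable B &
    A = (fun M : 'cV[R]_p => M i j) @^-1` B].

Lemma mx_borel_coord i j (B : set R) : measurable B ->
  mx_borel ((fun M : 'cV[R]_p => M i j) @^-1` B).
Proof. by move=> mB; apply: sub_sigma_algebra; exists i, j, B. Qed.

Lemma mx_borelT : mx_borel [set: 'cV[R]_p].
Proof.
exact: (@measurableT _ (g_sigma_algebraType coord_gen)).
Qed.

Lemma mx_borelI (A B : set 'cV[R]_p) : mx_borel A -> mx_borel B -> mx_borel (A `&` B).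
Proof.
move=> hA hB.
exact: (@measurableI _ (g_sigma_algebraType coord_gen) A B hA hB).
Qed.

Lemma mx_borel_preimage i (B : set 'cV[R]_p) : mx_borel B -> measurable (x i @^-1` B).
Proof.
move=> hB; suff : image_set_system setT (x i) measurable B.
  by rewrite /image_set_system /= setTI.
apply: smallest_sub hB.
  by apply: sigma_algebra_image; exact: sigma_algebra_measurable.
move=> _ [k [j [A mA ->]]]; rewrite /image_set_system /= setTI.
by rewrite -[X in measurable X]setTI; exact: rx.
Qed.

(* Cylinders not constraining x i; they generate the sigma-algebra of the other
   vectors. *)
Definition others_gen (i : 'I_n) : set (set T) :=
  [set A | exists B : 'I_n -> set 'cV[R]_p, [/\ forall j, mx_borel (B j),
     B i = setT & A = [set w | forall j, B j (x j w)]]].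

(** [T] with a coarser sigma-algebra: measurability on it says that a quantity depends only on the
    vectors other than [x i]. *)
Definition othersType (i : 'I_n) := g_sigma_algebraType (others_gen i).

Lemma others_coord i j k l : j != i ->
  @measurable_fun _ _ (othersType i) R setT (fun w => x j w k l).
Proof.
move=> ji _ B mB; rewrite setTI; apply: sub_sigma_algebra.
exists (fun j' => if j' == j then (fun M : 'cV[R]_p => M k l) @^-1` B else setT).
split.
- by move=> j'; case: ifP => _; [exact: mx_borel_coord|exact: mx_borelT].
- by rewrite eq_sym (negbTE ji).
- apply/seteqP; split => [w hw j'|w /(_ j)]; last by rewrite eqxx.
  by case: eqP => // ->.
Qed.

Let others_measurable i : others_gen i `<=` measurable.
Proof.
move=> _ [B [mB _ ->]].
rewrite (_ : [set w | _] = \bigcap_(j in [set: 'I_n]) (x j @^-1` B j)).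
  apply: fin_bigcap_measurable; first exact: finite_finset.
  by move=> j _; exact: mx_borel_preimage.
by apply/seteqP; split => w /= h j; [move=> _; exact: h|exact: h].
Qed.

(** For fixed [B], the two sides are finite measures in [A] that agree on the cylinders, a
    generating family stable under intersection. *)
Lemma independent_others i (B : set 'cV[R]_p) (A : set T) : mx_borel B ->
  <<s others_gen i >> A -> measurable A /\
  P (x i @^-1` B `&` A) = (P (x i @^-1` B) * P A)%E.
Proof.
move=> mB hA; have mA : measurable A.
  by apply: (smallest_sub _ (@others_measurable i)) hA; exact: sigma_algebra_measurable.
split => //; have mE := mx_borel_preimage i mB.
set E := x i @^-1` B in mE *.
have PE0 : 0 <= fine (P E) by rewrite fine_ge0.
pose r := NngNum PE0.
have PEf : P E \is a fin_num by apply: fin_num_measure.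
rewrite setIC -(fineK PEf).
apply: (@g_sigma_algebra_measure_unique _ R T (others_gen i)
  (@others_measurable i) (fun=> setT) _ _ (mrestr P mE) (mscale r P) _ _ _ A hA).
- move=> _; exists (fun=> setT); split => //.
    by move=> _; exact: mx_borelT.
  by apply/seteqP; split.
- by rewrite bigcup_const//; exists 0%N.
- move=> _ _ [B1 [m1 e1 ->]] [B2 [m2 e2 ->]].
  exists (fun j => B1 j `&` B2 j); split => //.
  + by move=> j; exact: mx_borelI.
  + by rewrite e1 e2 setTI.
  + apply/seteqP; split => w /= => [[h1 h2] j|h]; first by split.
    by split => j; case: (h j).
- move=> _ [B1 [m1 e1 ->]].
  set S := [set w | _].
  change (P (S `&` E) = ((fine (P E))%:E * P S)%E); rewrite fineK// /S.
  have -> : [set w | forall j, B1 j (x j w)] `&` E =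
     [set w | forall j, (if j == i then B else B1 j) (x j w)].
    apply/seteqP; split => [w /= [h1 h2] j|w /= h]; first by case: eqP => // ->.
    split => [j|]; last by have := h i; rewrite eqxx.
    by have := h j; case: eqP => // -> _; rewrite e1.
  have mB' j : mx_borel (if j == i then B else B1 j) by case: ifP.
  rewrite (ix mB') (ix m1).
  rewrite (bigD1 i)//= eqxx [in RHS](bigD1 i)//= e1.
  have -> : [set w | [set: 'cV[R]_p] (x i w)] = setT by apply/seteqP; split.
  have -> : P [set: T] = 1%E by exact: probability_setT.
  rewrite mul1e; congr (_ * _)%E; apply: eq_bigr => j /negbTE ->//.
- move=> _; change (P (setT `&` E) < +oo)%E.
  by rewrite setTI ltey_eq PEf.
Qed.

Lemma Ex_independent_others i (F : 'cV[R]_p -> R) (g : T -> R) :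
  (forall A : set R, measurable A -> mx_borel (F @^-1` A)) ->
  @measurable_fun _ _ (othersType i) R setT g ->
  integ P (fun w => F (x i w)) -> integ P g ->
  integ P (fun w => F (x i w) * g w) ->
  Ex P (fun w => F (x i w) * g w) = Ex P (fun w => F (x i w)) * Ex P g.
Proof.
move=> mF mg IF Ig IFg; apply: Ex_independent => //; [exact: integ_mfun IF|exact: integ_mfun Ig|].
move=> A B mA mB; have := mg measurableT B mB; rewrite setTI => hg.
by have [_ ->] := independent_others (mF A mA) hg.
Qed.

(** Sums of products cover polynomials in x_i whose coefficients come from the other vectors. The
    inner expectation integrates x_i with those coefficients frozen at w, which replaces
    conditioning. *)
Lemma decouple (I : finType) i (F : I -> 'cV[R]_p -> R) (g : I -> T -> R) :
  (forall k (A : set R), measurable A -> mx_borel (F k @^-1` A)) ->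
  (forall k, @measurable_fun _ _ (othersType i) R setT (g k)) ->
  (forall k, integ P (fun w => F k (x i w))) -> (forall k, integ P (g k)) ->
  (forall k, integ P (fun w => F k (x i w) * g k w)) ->
  Ex P (fun w => \sum_k F k (x i w) * g k w) =
  Ex P (fun w => Ex P (fun w' => \sum_k F k (x i w') * g k w)).
Proof.
move=> mF mg IF Ig IFg; rewrite Ex_sum//.
have -> : (fun w => Ex P (fun w' => \sum_k F k (x i w') * g k w)) =
   (fun w => \sum_k Ex P (fun w' => F k (x i w')) * g k w).
  apply/funext => w; rewrite Ex_sum; last first.
    move=> k; under [X in integ P X]funext do rewrite mulrC; exact: integZ.
  apply: eq_bigr => k _; rewrite mulrC -ExZ//.
  by congr (Ex P _); apply/funext => w'; rewrite mulrC.
rewrite Ex_sum; last by move=> k; exact: integZ.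
by apply: eq_bigr => k _; rewrite ExZ//;
  exact: (Ex_independent_others (mF k) (mg k) (IF k) (Ig k) (IFg k)).
Qed.

Lemma others_random_mx i (m l : nat) (Z : T -> 'M[R]_(m, l)) :
  @random_mx _ (othersType i) R m l Z -> random_mx Z.
Proof.
move=> hZ a b _ B mB; have := hZ a b measurableT B mB; rewrite !setTI => h.
by have [] := independent_others mx_borelT h.
Qed.

End Independence.

(** * Moments of the columns *)

Lemma mulmx_tr_sum_col (R : comNzRingType) p n (X : 'M[R]_(p, n)) :
  X *m X^T = \sum_j col j X *m (col j X)^T.
Proof.
apply/matrixP => a b; rewrite mxE summxE; apply: eq_bigr => j _.
by rewrite [in RHS]mxE big_ord1 !mxE.
Qed.

Section ScaledMoments.
Context d (T : measurableType d) (R : realType) (P : probability T R).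

Definition moment_bound (V : R) (W : T -> R) : Prop :=
  [/\ integ P W, integ P (fun w => (W w - Ex P W) ^+ 4),
      Ex P (fun w => (W w - Ex P W) ^+ 4) <= V,
      integ P (fun w => (W w - Ex P W) ^+ 2) &
      Ex P (fun w => (W w - Ex P W) ^+ 2) <= V].

Definition scaled_moments (V L : R) (W : T -> R) : Prop :=
  [/\ integ P W, integ P (fun w => (W w - Ex P W) ^+ 4),
      Ex P (fun w => (W w - Ex P W) ^+ 4) <= V * L ^+ 4,
      integ P (fun w => (W w - Ex P W) ^+ 2) &
      Ex P (fun w => (W w - Ex P W) ^+ 2) <= V * L ^+ 2].

Lemma moment_bound_scale (V L : R) (W : T -> R) : 0 < L ->
  moment_bound V (fun w => L^-1 * W w) ->
  scaled_moments V L W.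
Proof.
move=> L0 [h1 h2 h3 h4 h5]; have LN : L != 0 by rewrite gt_eqF.
have iW : integ P W.
  have := integZ L h1; congr (integ P _); apply/funext => w.
  by rewrite mulVKf.
have EW : Ex P (fun w => L^-1 * W w) = L^-1 * Ex P W by rewrite ExZ.
have e k : (fun w => (W w - Ex P W) ^+ k) =
     (fun w => L ^+ k * (L^-1 * W w - Ex P (fun w => L^-1 * W w)) ^+ k).
  apply/funext => w; rewrite EW -mulrBr exprMn mulrA -exprMn mulfV// expr1n mul1r.
  by [].
split => //.
- by rewrite e; exact: integZ.
- by rewrite e ExZ// mulrC ler_wpM2r// exprn_ge0// ltW.
- by rewrite e; exact: integZ.
- by rewrite e ExZ// mulrC ler_wpM2r// exprn_ge0// ltW.
Qed.

Lemma integ_sqr_center (W : T -> R) (a : R) : mfun W -> integ P W ->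
  integ P (fun w => (W w - a) ^+ 2) -> integ P (fun w => W w ^+ 2).
Proof.
move=> mW iW i2.
have -> : (fun w => W w ^+ 2) = (fun w => (W w - a) ^+ 2 + (2 * a * W w - a ^+ 2)).
  by apply/funext => w; ring.
by apply: integD => //; apply: integB; [exact: integZ|exact: integ_cst].
Qed.

Lemma Ex_variance_le (W : T -> R) (a : R) : mfun W -> integ P W ->
  integ P (fun w => W w ^+ 2) ->
  Ex P (fun w => (W w - Ex P W) ^+ 2) <= Ex P (fun w => (W w - a) ^+ 2).
Proof.
move=> mW iW i2; set e := Ex P W.
have h b : Ex P (fun w => (W w - b) ^+ 2) = Ex P (fun w => W w ^+ 2) - 2 * b * e + b ^+ 2.
  have -> : (fun w => (W w - b) ^+ 2) = (fun w => W w ^+ 2 + (b ^+ 2 - 2 * b * W w)).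
    by apply/funext => w; ring.
  have i3 := integZ (2 * b) iW; have i4 := integ_cst P (b ^+ 2).
  by rewrite ExD//; [rewrite ExB// Ex_cst ExZ// -/e; ring|exact: integB].
rewrite !h; have := sqr_ge0 (a - e); nra.
Qed.

Lemma integ_pow4_center (W : T -> R) (a : R) : mfun W ->
  integ P (fun w => (W w - a) ^+ 4) ->
  integ P (fun w => W w ^+ 4) /\
  Ex P (fun w => W w ^+ 4) <= 8 * (Ex P (fun w => (W w - a) ^+ 4) + a ^+ 4).
Proof.
move=> mW i4.
have iB : integ P (fun w => 8 * ((W w - a) ^+ 4 + a ^+ 4)).
  by apply: integZ; apply: integD => //; exact: integ_cst.
have pt w : W w ^+ 4 <= 8 * ((W w - a) ^+ 4 + a ^+ 4).
  have e4 x : x ^+ 4 = (x ^+ 2) ^+ 2 :> R by rewrite -exprM.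
  set u := W w - a; have -> : W w = u + a by rewrite /u subrK.
  rewrite !e4.
  apply: (@le_trans _ _ ((2 * (u ^+ 2 + a ^+ 2)) ^+ 2)).
    apply: lerXn2r; rewrite ?nnegrE ?sqr_ge0 ?mulr_ge0 ?addr_ge0 ?sqr_ge0//.
    have := sqr_ge0 (u - a); nra.
  have := sqr_ge0 (u ^+ 2 - a ^+ 2); nra.
have iW : integ P (fun w => W w ^+ 4).
  apply: integ_dom iB _ _; first exact: measurable_funX.
  by move=> w; rewrite ger0_norm ?exprn_even_ge0.
split => //; apply: le_trans (Ex_le iW iB pt) _.
by rewrite ExZ ?ExD ?Ex_cst//; [exact: integ_cst|apply: integD => //; exact: integ_cst].
Qed.

End ScaledMoments.

(** Up to the powers of p and n: [a1] bounds tr Sigma_i, [a2] the fourth moment of |x_i|, [a3] the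
    variance of a quadratic form, [a4] and [a5] the forms of m_i in the random and deterministic
    inverses, [a6] the mean square of lam - delta, [a7] the bias of a trace, [a8] the defect in the
    fixed point equation, [a9] the total; [Dl] bounds delta and delta'. Including [a8] in the
    maximum makes B <= sqrt n imply a defect at most 1. *)
Definition bias_constant (R : realType) (V Km V' K kap : R) : R :=
  let a1 := V + Km ^+ 2 in
  let a2 := 8 * (a1 ^+ 2 + V) in
  let a3 := 2 * V * kap ^+ 2 + 8 * kap ^+ 2 * a1 * V in
  let a4 := 2 * (2 + kap * (8 * K ^+ 2 + 4 * V * kap)) in
  let Dl := kap ^+ 2 * a1 in
  let a5 := 2 * (2 * (1 + Dl) + 4 * kap * K ^+ 2) in
  let a6 := 4 * (a3 * kap + kap ^+ 2 * Km ^+ 2 * a4 +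
    kap ^+ 6 * V ^+ 2 * a2 + kap ^+ 2 * V') in
  let a7 := kap ^+ 2 * Num.sqrt (a2 * a6) +
    a1 * (kap ^+ 3 * V + kap ^+ 2 * Num.sqrt (kap * a5) * Km * Num.sqrt kap) in
  let a8 := a7 * V * kap + a5 + kap ^+ 3 * V * a1 in
  let a9 := a7 + kap ^+ 2 * a1 *
    ((1 + Dl) * (a8 / (1 - Num.sqrt (Dl / (1 + Dl))))) in
  Num.max 0 (Num.max a8 a9).

Section ColumnMoments.
Context d (T : measurableType d) (R : realType) (P : probability T R).
Variables (p n : nat) (X : T -> 'M[R]_(p, n)) (C c q V Km : R).
Hypothesis rX : random_mx X.
Hypothesis cX : convexly_concentrated P (@frobenius R p n) X (decay C c q).
Hypothesis hV : forall W : T -> R, mfun W -> concentrated P W (decay C c q) ->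
  moment_bound P V W.
Hypothesis V1 : 1 <= V.
Hypothesis p0 : (0 < p)%N.

Let x (i : 'I_n) (w : T) : 'cV[R]_p := col i (X w).
Let m (i : 'I_n) : 'cV[R]_p := mx_expectation P (x i).
Let Sigma (i : 'I_n) : 'M[R]_p := second_moment P (x i).
Let a1 := V + Km ^+ 2.

Hypothesis hm : forall i, fnorm (m i) <= Km * Num.sqrt p%:R.

Lemma rmx_x i : random_mx (x i).
Proof. exact: rmx_col. Qed.

Lemma linear_moments (U : 'M[R]_(p, n)) :
  [/\ integ P (fun w => ip U (X w)),
     integ P (fun w => (ip U (X w) - Ex P (fun w => ip U (X w))) ^+ 2) &
     Ex P (fun w => (ip U (X w) - Ex P (fun w => ip U (X w))) ^+ 2) <= V * ip U U].
Proof.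
have mU : mfun (fun w => ip U (X w)) by apply: mfun_ip => //; exact: rmx_cst.
have [U0|U0] := eqVneq (ip U U) 0.
  have z w : ip U (X w) = 0.
    by move/eqP : U0; rewrite ip_eq0 => /eqP ->; rewrite ipC ip0r.
  have -> : (fun w => ip U (X w)) = (fun=> 0) by apply/funext.
  rewrite Ex_cst U0 mulr0.
  have -> : (fun w => (ip U (X w) - 0) ^+ 2) = (fun=> 0).
    by apply/funext => w; rewrite z subrr expr0n.
  by rewrite Ex_cst; split => //; exact: integ_cst.
have fU : 0 < fnorm U by rewrite sqrtr_gt0 lt_def U0 ip_ge0.
have cc := concentrated_ip cX fU (lexx _).
have mL : mfun (fun w => (fnorm U)^-1 * ip U (X w)).
  by apply: measurable_funM => //; exact: measurable_cst.
have [i1 _ _ i2 e2] := moment_bound_scale fU (hV mL cc).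
by rewrite -sqr_fnorm; split.
Qed.

Lemma linear_norm_moments k l (A : 'M[R]_(k, p)) (B : 'M[R]_(n, l)) (L : R) :
  0 < L -> (forall H, fnorm (A *m H *m B) <= L * fnorm H) ->
  scaled_moments P V L (fun w => fnorm (A *m X w *m B)).
Proof.
move=> L0 hL; apply: moment_bound_scale => //; apply: hV.
  apply: measurable_funM; first exact: measurable_cst.
  by apply/mfun_fnorm/rmx_mul; [apply: rmx_mul => //|]; exact: rmx_cst.
exact: (concentrated_linear_norm cX L0 hL).
Qed.

Lemma fnorm_col_le i (H : 'M[R]_(p, n)) : fnorm (col i H) <= fnorm H.
Proof.
rewrite -ler_sqr ?nnegrE ?fnorm_ge0// !sqr_fnorm (ip_le_cols H).
by rewrite (bigD1 i)//= lerDl; apply: sumr_ge0 => j _; exact: ip_ge0.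
Qed.

(** Multiplying X on the right by a basis vector selects the column, so this is the norm of a linear
    image of X. *)
Lemma quad_norm_moments i k (G : 'M[R]_(p, k)) (L : R) : 0 < L ->
  (forall u : 'cV[R]_p, fnorm (G^T *m u) <= L * fnorm u) ->
  scaled_moments P V L (fun w => fnorm (G^T *m x i w)).
Proof.
move=> L0 hL.
pose D : 'M[R]_(n, 1) := delta_mx i 0.
have e (H : 'M[R]_(p, n)) : G^T *m H *m D = G^T *m col i H.
  by rewrite -mulmxA -colE.
have hH (H : 'M[R]_(p, n)) : fnorm (G^T *m H *m D) <= L * fnorm H.
  rewrite e; apply: le_trans (hL _) _; rewrite ler_wpM2l ?(ltW L0)//.
  exact: fnorm_col_le.
have -> : (fun w => fnorm (G^T *m x i w)) = (fun w => fnorm (G^T *m X w *m D)).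
  by apply/funext => w; rewrite e.
exact: linear_norm_moments.
Qed.

Lemma integ_entry4 i : integ P (fun w => fnorm (x i w) ^+ 4).
Proof.
have h1 (u : 'cV[R]_p) : fnorm ((1%:M : 'M[R]_p)^T *m u) <= 1 * fnorm u.
  by rewrite trmx1 mul1mx mul1r.
have := quad_norm_moments i ltr01 h1.
have -> : (fun w => fnorm ((1%:M : 'M[R]_p)^T *m x i w)) = (fun w => fnorm (x i w)).
  by apply/funext => w; rewrite trmx1 mul1mx.
move=> [_ i4 _ _ _]; apply: (integ_pow4_center _ i4).1.
exact/mfun_fnorm/rmx_x.
Qed.

(** Growth at most quartic in |x_i| suffices for integrability. *)
Lemma integ_entry_poly i (f : T -> R) (a : R) : mfun f ->
  (forall w, `|f w| <= a * (1 + fnorm (x i w) ^+ 4)) -> integ P f.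
Proof.
move=> mf hf; apply: integ_dom mf hf; apply: integZ; apply: integD.
  exact: integ_cst.
exact: integ_entry4.
Qed.

Lemma pow_le_14 (u : R) : 0 <= u ->
  [/\ u <= 1 + u ^+ 4, u ^+ 2 <= 1 + u ^+ 4 & u ^+ 3 <= 1 + u ^+ 4].
Proof.
move=> u0; have [u1|u1] := leP u 1.
  have h k : u ^+ k <= 1 by apply: exprn_ile1.
  have h4 : 0 <= u ^+ 4 by exact: exprn_ge0.
  split; [|have := h 2%N|have := h 3%N]; lra.
have h1 : u <= u ^+ 4 by rewrite -[leLHS]expr1 ler_eXn2l.
have h2 : u ^+ 2 <= u ^+ 4 by rewrite ler_eXn2l.
have h3 : u ^+ 3 <= u ^+ 4 by rewrite ler_eXn2l.
split; lra.
Qed.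

Lemma integ_fnorm2 i : integ P (fun w => fnorm (x i w) ^+ 2).
Proof.
apply: (@integ_entry_poly i _ 1); first exact/mfun_sqr/mfun_fnorm/rmx_x.
move=> w; rewrite mul1r ger0_norm ?sqr_ge0//.
by have [] := pow_le_14 (fnorm_ge0 (x i w)).
Qed.

Lemma entry_le i a w : `|x i w a 0| <= fnorm (x i w).
Proof.
rewrite -ler_sqr ?nnegrE ?fnorm_ge0// sqr_fnorm ipE (bigD1 a)//= big_ord1.
rewrite real_normK ?num_real// -expr2 lerDl.
by apply: sumr_ge0 => b _; apply: sumr_ge0 => j _; exact: sqr_ge0.
Qed.

Lemma integ_entry i a : integ P (fun w => x i w a 0).
Proof.
apply: (@integ_entry_poly i _ 1); first exact: rmx_x.
move=> w; rewrite mul1r; apply: le_trans (entry_le i a w) _.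
by have [] := pow_le_14 (fnorm_ge0 (x i w)).
Qed.

Lemma integ_entry2 i a b : integ P (fun w => x i w a 0 * x i w b 0).
Proof.
apply: (@integ_entry_poly i _ 1).
  by apply: measurable_funM; exact: rmx_x.
move=> w; rewrite mul1r normrM.
have [_ h _] := pow_le_14 (fnorm_ge0 (x i w)).
by apply: le_trans h; rewrite expr2; apply: ler_pM => //; exact: entry_le.
Qed.

Lemma SigmaE i a b : Sigma i a b = Ex P (fun w => x i w a 0 * x i w b 0).
Proof.
rewrite mxE /Ex /Rintegral unlock; congr fine; apply: eq_integral => w _.
by congr (_%:E); rewrite mxE big_ord1 [_^T _ _]mxE.
Qed.

Lemma mE i a : m i a 0 = Ex P (fun w => x i w a 0).
Proof. by rewrite mxE /Ex /Rintegral unlock. Qed.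

Lemma trace_Sigma i (M : 'M[R]_p) :
  \tr (Sigma i *m M) = Ex P (fun w => ip (x i w) (M *m x i w)).
Proof.
have -> : (fun w => ip (x i w) (M *m x i w)) =
   (fun w => \sum_a \sum_b M a b * (x i w a 0 * x i w b 0)).
  apply/funext => w; rewrite ipE; apply: eq_bigr => a _.
  rewrite big_ord1 [(M *m _) _ _]mxE mulr_sumr; apply: eq_bigr => b _; ring.
have iab a b : integ P (fun w => M a b * (x i w a 0 * x i w b 0)).
  by apply: integZ; exact: integ_entry2.
rewrite Ex_sum; last by move=> a; apply: integ_sum.
rewrite /mxtrace; under eq_bigr do rewrite mxE.
rewrite exchange_big /=; apply: eq_bigr => a _.
rewrite Ex_sum//; apply: eq_bigr => b _; rewrite ExZ; last exact: integ_entry2.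
rewrite SigmaE mulrC; congr (_ * Ex P _); apply/funext => w; exact: mulrC.
Qed.

Definition cov i : 'M[R]_p := Sigma i - m i *m (m i)^T.

Lemma cov_Sigma i : Sigma i = cov i + m i *m (m i)^T.
Proof. by rewrite subrK. Qed.

Lemma ip_outer_self (u v : 'cV[R]_p) : ip v (u *m u^T *m v) = ip u v ^+ 2.
Proof.
rewrite -mulmxA ip_mulmr ipE !big_ord1 -expr2; congr (_ ^+ 2).
by rewrite /ip /mxtrace big_ord1.
Qed.

Lemma ExpipE i (u : 'cV[R]_p) : Ex P (fun w => ip u (x i w)) = ip u (m i).
Proof.
have -> : (fun w => ip u (x i w)) = (fun w => \sum_a u a 0 * x i w a 0).
  by apply/funext => w; rewrite ipE; apply: eq_bigr => a _; rewrite big_ord1.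
rewrite Ex_sum; last by move=> a; apply: integZ; exact: integ_entry.
rewrite ipE; apply: eq_bigr => a _; rewrite big_ord1 ExZ; last exact: integ_entry.
by rewrite mE.
Qed.

Lemma ip_col_embed i (u : 'cV[R]_p) (H : 'M[R]_(p, n)) :
  ip u (col i H) = ip (u *m (delta_mx 0 i : 'M[R]_(1, n))) H.
Proof. by rewrite ip_mulmxr trmx_delta -colE. Qed.

Lemma ip_embed i (u : 'cV[R]_p) :
  ip (u *m (delta_mx 0 i : 'M[R]_(1, n))) (u *m (delta_mx 0 i : 'M[R]_(1, n))) = ip u u.
Proof.
rewrite -ip_col_embed colE -mulmxA mul_delta_mx.
suff -> : (delta_mx 0 0 : 'M[R]_1) = 1%:M by rewrite mulmx1.
by apply/matrixP => a b; rewrite !ord1 !mxE.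
Qed.

Lemma integ_ip i (u : 'cV[R]_p) : integ P (fun w => ip u (x i w)).
Proof.
have [h _ _] := linear_moments (u *m (delta_mx 0 i : 'M[R]_(1, n))).
by move: h; congr (integ P _); apply/funext => w; rewrite ip_col_embed.
Qed.

Lemma mfun_ip_x i (u : 'cV[R]_p) : mfun (fun w => ip u (x i w)).
Proof. by apply: mfun_ip; [exact: rmx_cst|exact: rmx_x]. Qed.

Lemma ip_cov i (u : 'cV[R]_p) :
  ip u (cov i *m u) = Ex P (fun w => (ip u (x i w) - ip u (m i)) ^+ 2).
Proof.
have [_ i2 _] := linear_moments (u *m (delta_mx 0 i : 'M[R]_(1, n))).
have e : (fun w => ip (u *m (delta_mx 0 i : 'M[R]_(1, n))) (X w)) =
  (fun w => ip u (x i w)) by apply/funext => w; rewrite ip_col_embed.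
have i2' : integ P (fun w => (ip u (x i w) - ip u (m i)) ^+ 2).
  move: i2; rewrite e ExpipE; congr (integ P _); apply/funext => w.
  by rewrite -ip_col_embed.
have i3 := integ_sqr_center (mfun_ip_x i u) (integ_ip i u) i2'.
rewrite mulmxBl ipBr ip_outer_self ipC.
have -> : ip (Sigma i *m u) u = \tr (Sigma i *m (u *m u^T)).
  by rewrite ip_outer ipC.
rewrite trace_Sigma.
have -> : (fun w => ip (x i w) (u *m u^T *m x i w)) = (fun w => ip u (x i w) ^+ 2).
  by apply/funext => w; rewrite ip_outer_self.
have -> : (fun w => (ip u (x i w) - ip u (m i)) ^+ 2) =
   (fun w => ip u (x i w) ^+ 2 - (2 * ip u (m i) * ip u (x i w) - ip u (m i) ^+ 2)).
  by apply/funext => w; ring.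
have i4 := integZ (2 * ip u (m i)) (integ_ip i u).
have i5 := integ_cst P (ip u (m i) ^+ 2).
rewrite ExB//; last exact: integB.
rewrite ExB// Ex_cst ExZ; last exact: integ_ip.
by rewrite ExpipE (ipC (m i)); ring.
Qed.

(** The form is the variance of a linear functional of X of norm |u|, so the bound is free of the
    dimension. *)
Lemma cov_le i (u : 'cV[R]_p) : ip u (cov i *m u) <= V * ip u u.
Proof.
rewrite ip_cov.
have [_ _] := linear_moments (u *m (delta_mx 0 i : 'M[R]_(1, n))).
rewrite ip_embed; apply: le_trans; rewrite le_eqVlt; apply/orP; left; apply/eqP.
have e : (fun w => ip (u *m (delta_mx 0 i : 'M[R]_(1, n))) (X w)) =
  (fun w => ip u (x i w)) by apply/funext => w; rewrite ip_col_embed.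
rewrite e ExpipE; congr (Ex P _); apply/funext => w; by rewrite -ip_col_embed.
Qed.

Lemma second_moment_sym i : (Sigma i)^T = Sigma i.
Proof.
apply/matrixP => a b; rewrite mxE !SigmaE; congr (Ex P _); apply/funext => w.
exact: mulrC.
Qed.

Lemma cov_psd i : psd (cov i).
Proof.
split=> [|u]; last by rewrite ip_cov; apply: Ex_ge0 => w; exact: sqr_ge0.
by rewrite /cov raddfB /= second_moment_sym trmx_mul trmxK.
Qed.

Lemma second_moment_psd i : psd (Sigma i).
Proof. by rewrite cov_Sigma; apply: psdD; [exact: cov_psd|exact: psd_gram]. Qed.

Lemma trace_cov_le i : \tr (cov i) <= V * p%:R.
Proof.
have -> : V * p%:R = \sum_(a < p) V by rewrite sumr_const card_ord mulr_natr.
apply: ler_sum => a _.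
pose e : 'cV[R]_p := delta_mx a 0.
have -> : cov i a a = ip e (cov i *m e).
  have ee b : e b 0 = (b == a)%:R by rewrite mxE eqxx andbT.
  rewrite -colE ipE (bigD1 a)//= big_ord1 ee eqxx mul1r big1 ?addr0 => [|b /negbTE ba].
    by rewrite [in RHS]mxE.
  by rewrite big_ord1 ee ba mul0r.
apply: le_trans (cov_le i e) _.
have -> : ip e e = 1.
  rewrite ipE (bigD1 a)//= big_ord1 !mxE !eqxx mul1r big1 ?addr0// => b /negbTE ba.
  by rewrite big_ord1 !mxE ba mul0r.
by rewrite mulr1.
Qed.

Lemma ip_mean_le i : ip (m i) (m i) <= Km ^+ 2 * p%:R.
Proof.
have -> : Km ^+ 2 * p%:R = (Km * Num.sqrt p%:R) ^+ 2 by rewrite exprMn sqr_sqrtr.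
rewrite -sqr_fnorm; apply: lerXn2r; rewrite ?nnegrE ?fnorm_ge0//.
exact: le_trans (fnorm_ge0 _) (hm i).
Qed.

Lemma trace_Sigma_le i : \tr (Sigma i) <= a1 * p%:R.
Proof.
rewrite cov_Sigma mxtraceD mxtrace_mulC /a1 mulrDl.
by apply: lerD; [exact: trace_cov_le|exact: ip_mean_le].
Qed.

Let V0 : 0 <= V := le_trans ler01 V1.

Lemma a1_ge1 : 1 <= a1.
Proof. by apply: le_trans V1 _; rewrite lerDl sqr_ge0. Qed.

Lemma Ex_fnorm2 i : Ex P (fun w => fnorm (x i w) ^+ 2) = \tr (Sigma i).
Proof.
rewrite -[Sigma i]mulmx1 trace_Sigma; congr (Ex P _); apply/funext => w.
by rewrite mul1mx sqr_fnorm.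
Qed.

Lemma mfun_fnorm_x i : mfun (fun w => fnorm (x i w)).
Proof. exact/mfun_fnorm/rmx_x. Qed.

Lemma Ex_fnorm4_le i :
  Ex P (fun w => fnorm (x i w) ^+ 4) <= 8 * (a1 ^+ 2 + V) * p%:R ^+ 2.
Proof.
have h1 (u : 'cV[R]_p) : fnorm ((1%:M : 'M[R]_p)^T *m u) <= 1 * fnorm u.
  by rewrite trmx1 mul1mx mul1r.
have := quad_norm_moments i ltr01 h1.
have -> : (fun w => fnorm ((1%:M : 'M[R]_p)^T *m x i w)) = (fun w => fnorm (x i w)).
  by apply/funext => w; rewrite trmx1 mul1mx.
move=> [_ i4 e4 _ _]; rewrite expr1n mulr1 in e4.
apply: le_trans (integ_pow4_center (mfun_fnorm_x i) i4).2 _.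
have [_ h2] := Ex_sqr_le (mfun_fnorm_x i) (integ_fnorm2 i).
rewrite Ex_fnorm2 in h2; have h3 := le_trans h2 (trace_Sigma_le i).
set e := Ex P (fun w => fnorm (x i w)) in e4 h2 h3 *.
have p1 : 1 <= p%:R :> R by rewrite ler1n.
have a0 : 0 <= a1 by apply: le_trans a1_ge1.
have e0 : e ^+ 4 <= a1 ^+ 2 * p%:R ^+ 2.
  have -> : e ^+ 4 = (e ^+ 2) ^+ 2 by rewrite -exprM.
  have ap0 : 0 <= a1 * p%:R by rewrite mulr_ge0.
  by rewrite -exprMn; apply: lerXn2r; rewrite ?nnegrE ?sqr_ge0.
have p2 : 1 <= p%:R ^+ 2 :> R by exact: exprn_ege1.
have VV : V <= V * p%:R ^+ 2 by rewrite ler_peMr.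
rewrite -mulrA ler_wpM2l// mulrDl; lra.
Qed.

Lemma Ex_fnorm_mx_le :
  Ex P (fun w => fnorm (X w)) <= (1 + a1) * Num.sqrt (n * p)%:R.
Proof.
have e w : fnorm (X w) ^+ 2 = \sum_j fnorm (x j w) ^+ 2.
  by rewrite sqr_fnorm ip_le_cols; apply: eq_bigr => j _; rewrite sqr_fnorm.
have mN : mfun (fun w => fnorm (X w)) by exact: mfun_fnorm.
have i2 : integ P (fun w => fnorm (X w) ^+ 2).
  rewrite (_ : (fun w => _) = (fun w => \sum_j fnorm (x j w) ^+ 2)).
    by apply: integ_sum => j; exact: integ_fnorm2.
  by apply/funext => w; rewrite e.
have [_ h] := Ex_sqr_le mN i2.
have a0 := a1_ge1.
rewrite -ler_sqr ?nnegrE; last 2 first.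
- by apply: Ex_ge0 => w; exact: fnorm_ge0.
- by rewrite mulr_ge0 ?sqrtr_ge0//; lra.
apply: le_trans h _; rewrite exprMn sqr_sqrtr//.
rewrite (_ : (fun w => fnorm (X w) ^+ 2) = (fun w => \sum_j fnorm (x j w) ^+ 2)); last first.
  by apply/funext => w; rewrite e.
rewrite Ex_sum; last by move=> j; exact: integ_fnorm2.
apply: (@le_trans _ _ (\sum_(j < n) a1 * p%:R)).
  by apply: ler_sum => j _; rewrite Ex_fnorm2 trace_Sigma_le.
rewrite sumr_const card_ord -(mulr_natl _ n) natrM.
rewrite (_ : n%:R * (a1 * p%:R) = a1 * (n%:R * p%:R)); last by ring.
by rewrite ler_wpM2r ?mulr_ge0//; nra.
Qed.

(** Cauchy-Schwarz for the form of C gives |C U|^4 <= <C U, C (C U)> <U, C U> <= V |C U|^2 V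
    |U|^2. *)
Lemma cov_fnorm_le i k (U : 'M[R]_(p, k)) : fnorm (cov i *m U) <= V * fnorm U.
Proof.
have h := ip_psd_CS (cov_psd i) (cov i *m U) U.
have leV l (W : 'M[R]_(p, l)) : ip W (cov i *m W) <= V * ip W W.
  rewrite !(ip_le_cols W) mulr_sumr; apply: ler_sum => j _.
  by rewrite [col j (cov i *m W)]colE -mulmxA -colE cov_le.
have [->|N0] := eqVneq (fnorm (cov i *m U)) 0; first by rewrite mulr_ge0 ?fnorm_ge0.
have Np : 0 < fnorm (cov i *m U) by rewrite lt_def N0 fnorm_ge0.
rewrite -ler_sqr ?nnegrE ?mulr_ge0 ?fnorm_ge0// exprMn.
rewrite -(@ler_pM2r _ (fnorm (cov i *m U) ^+ 2)) ?exprn_gt0//.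
rewrite -expr2 {1}sqr_fnorm; apply: le_trans h _.
apply: (@le_trans _ _ ((V * ip (cov i *m U) (cov i *m U)) * (V * ip U U))).
  by apply: ler_pM => //; exact: (psd_ip (cov_psd i)).
by rewrite -!sqr_fnorm le_eqVlt; apply/orP; left; apply/eqP; ring.
Qed.

(** For A^-1 = G G^T the form is the square of W = |G^T x_i|, a convex function of X with Lipschitz
    constant sqrt kap. With e = E W, W^2 - e^2 = (W - e) (W - e + 2 e), where e^2 is of order p
    while the central moments of W are bounded. *)
Lemma quad_form_variance i (z kap : R) (A : 'M[R]_p) : 0 < z -> z^-1 <= kap ->
  coercive z A ->
  Ex P (fun w => (ip (x i w) (invmx A *m x i w) - \tr (Sigma i *m invmx A)) ^+ 2) <=
  (2 * V * kap ^+ 2 + 8 * kap ^+ 2 * a1 * V) * p%:R.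
Proof.
move=> z0 zk cA; have [G QE] := psd_factor (coercive_inv_psd z0 cA).
have kap0 : 0 < kap by apply: lt_le_trans zk; rewrite invr_gt0.
pose L := Num.sqrt kap; have L0 : 0 < L by rewrite sqrtr_gt0.
have L2 : L ^+ 2 = kap by rewrite sqr_sqrtr// ltW.
have qE (u : 'cV[R]_p) : ip u (invmx A *m u) = fnorm (G^T *m u) ^+ 2.
  by rewrite QE sqr_fnorm -mulmxA ip_mulmr.
have hL (u : 'cV[R]_p) : fnorm (G^T *m u) <= L * fnorm u.
  rewrite -ler_sqr ?nnegrE ?mulr_ge0 ?fnorm_ge0 ?(ltW L0)// -qE exprMn L2 sqr_fnorm.
  apply: le_trans (coercive_inv_le z0 cA u) _.
  by rewrite ler_wpM2r ?ip_ge0.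
have [iW i4 e4 i2 e2] := quad_norm_moments i L0 hL.
set W := fun w => fnorm (G^T *m x i w) in iW i4 e4 i2 e2.
have mW : mfun W by apply/mfun_fnorm/rmx_mul; [exact: rmx_cst|exact: rmx_x].
set e := Ex P W in i4 e4 i2 e2.
have iW2 := integ_sqr_center mW iW i2.
have [iW4 _] := integ_pow4_center mW i4.
have EW2 : Ex P (fun w => W w ^+ 2) = \tr (Sigma i *m invmx A).
  by rewrite trace_Sigma; congr (Ex P _); apply/funext => w; rewrite qE.
have e2le : e ^+ 2 <= kap * (a1 * p%:R).
  have [_ h] := Ex_sqr_le mW iW2; apply: le_trans h _; rewrite EW2.
  have /andP[_ h] := trace_inv_le (second_moment_psd i) z0 cA.
  apply: le_trans h _; apply: ler_pM => //; first by rewrite invr_ge0 ltW.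
    have := trace_psd_ge0 (second_moment_psd i) (psd_gram (1%:M : 'M[R]_p)).
    by rewrite mul1mx trmx1 mulmx1.
  exact: trace_Sigma_le.
have -> : (fun w => (ip (x i w) (invmx A *m x i w) - \tr (Sigma i *m invmx A)) ^+ 2) =
   (fun w => (W w ^+ 2 - Ex P (fun w => W w ^+ 2)) ^+ 2).
  by apply/funext => w; rewrite EW2 qE.
have mW2 := mfun_sqr mW.
have iW4' : integ P (fun w => (W w ^+ 2) ^+ 2).
  by move: iW4; congr (integ P _); apply/funext => w; rewrite -exprM.
apply: le_trans (Ex_variance_le (e ^+ 2) mW2 iW2 iW4') _.
have iB : integ P (fun w => 2 * (W w - e) ^+ 4 + 8 * e ^+ 2 * (W w - e) ^+ 2).
  by apply: integD; exact: integZ.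
have pt w : (W w ^+ 2 - e ^+ 2) ^+ 2 <= 2 * (W w - e) ^+ 4 + 8 * e ^+ 2 * (W w - e) ^+ 2.
  set v := W w - e; have -> : W w ^+ 2 - e ^+ 2 = v * (v + 2 * e) by rewrite /v; ring.
  rewrite exprMn.
  have -> : 2 * v ^+ 4 + 8 * e ^+ 2 * v ^+ 2 = v ^+ 2 * (2 * (v ^+ 2 + (2 * e) ^+ 2)) by ring.
  rewrite ler_wpM2l ?sqr_ge0//; have := sqr_ge0 (v - 2 * e); nra.
have iL : integ P (fun w => (W w ^+ 2 - e ^+ 2) ^+ 2).
  apply: integ_dom iB _ _.
    by apply/mfun_sqr/measurable_funB => //; exact: measurable_cst.
  by move=> w; rewrite ger0_norm ?sqr_ge0.
apply: le_trans (Ex_le iL iB pt) _.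
rewrite ExD; [|exact: integZ|exact: integZ]; rewrite !ExZ//.
have L4 : L ^+ 4 = kap ^+ 2 by rewrite -L2 -exprM.
rewrite L4 in e4; rewrite L2 in e2.
have p1 : 1 <= p%:R :> R by rewrite ler1n.
rewrite [leRHS]mulrDl; apply: lerD.
  apply: (@le_trans _ _ (2 * V * kap ^+ 2)); first by rewrite -mulrA ler_wpM2l.
  have VK : 0 <= 2 * V * kap ^+ 2 by rewrite mulr_ge0 ?sqr_ge0// mulr_ge0.
  by rewrite ler_peMr.
apply: (@le_trans _ _ (8 * (kap * (a1 * p%:R)) * (V * kap))).
  apply: ler_pM => //; first by rewrite mulr_ge0 ?sqr_ge0.
  - by apply: Ex_ge0 => w; exact: sqr_ge0.
  - by rewrite ler_wpM2l.
by rewrite le_eqVlt; apply/orP; left; apply/eqP; ring.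
Qed.

(** Each of the p coordinates is a centred linear functional of X whose squared norm is a^2 times
    the cardinality of J. *)
Lemma Ex_mean_fluctuation (J : pred 'I_n) (a : R) :
  Ex P (fun w => ip (a *: \sum_(j | J j) (x j w - m j)) (a *: \sum_(j | J j) (x j w - m j)))
   <= p%:R * (V * (a ^+ 2 * \sum_(j | J j) 1)) /\
  integ P (fun w => ip (a *: \sum_(j | J j) (x j w - m j)) (a *: \sum_(j | J j) (x j w - m j))).
Proof.
pose e k : 'cV[R]_p := delta_mx k 0.
pose U k : 'M[R]_(p, n) := a *: (e k *m (\row_j (J j)%:R)).
have ipU k (H : 'M[R]_(p, n)) : ip (U k) H = a * \sum_(j | J j) H k j.
  rewrite ipZl ip_mulmxr; congr (_ * _).
  rewrite ipE (bigD1 k)//= [X in _ + X]big1 ?addr0 => [|b /negbTE bk]; last first.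
    by rewrite big_ord1 !mxE bk mul0r.
  rewrite big_ord1 !mxE !eqxx mul1r [RHS]big_mkcond; apply: eq_bigr => j _.
  by rewrite !mxE; case: (J j); rewrite ?mulr1 ?mulr0.
have UU k : ip (U k) (U k) = a ^+ 2 * \sum_(j | J j) 1.
  rewrite ipU expr2 -mulrA; congr (_ * _); rewrite mulr_sumr; apply: eq_bigr => j Jj.
  by rewrite !mxE big_ord1 !mxE !eqxx Jj mul1r.
have EU k : Ex P (fun w => ip (U k) (X w)) = a * \sum_(j | J j) m j k 0.
  have -> : (fun w => ip (U k) (X w)) = (fun w => a * \sum_(j | J j) x j w k 0).
    apply/funext => w; rewrite ipU; congr (_ * _); apply: eq_bigr => j _.
    by rewrite mxE.
  have ix j := integ_entry j k.
  by rewrite ExZ ?Ex_sum//; [congr (_ * _); apply: eq_bigr => j _; rewrite mE|exact: integ_sum].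
have E : (fun w => ip (a *: \sum_(j | J j) (x j w - m j)) (a *: \sum_(j | J j) (x j w - m j)))
   = (fun w => \sum_k (ip (U k) (X w) - Ex P (fun w => ip (U k) (X w))) ^+ 2).
  apply/funext => w; rewrite ipE; apply: eq_bigr => k _; rewrite big_ord1 -expr2.
  congr (_ ^+ 2); rewrite EU ipU -mulrBr -sumrB mxE; congr (_ * _).
  by rewrite summxE; apply: eq_bigr => j _; rewrite !mxE.
have iU k : integ P (fun w => (ip (U k) (X w) - Ex P (fun w => ip (U k) (X w))) ^+ 2).
  by have [] := linear_moments (U k).
rewrite E; split; last by apply: integ_sum.
rewrite Ex_sum//.
apply: (@le_trans _ _ (\sum_(k < p) (V * (a ^+ 2 * \sum_(j | J j) 1)))); last first.
  by rewrite sumr_const card_ord mulr_natl.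
by apply: ler_sum => k _; have [_ _] := linear_moments (U k); rewrite UU.
Qed.

(** * Leave-one-out resolvents *)

Variables (V' K z kap : R).
Hypothesis K0 : 0 <= K.
Hypothesis hmm : forall i j, fnorm (m i - m j) <= 2 * K.
Hypothesis n2 : (1 < n)%N.
Hypothesis pn : p%:R <= kap * n%:R.
Hypothesis kap1 : 1 <= kap.
Hypothesis z0 : 0 < z.
Hypothesis zk : z^-1 <= kap.
Hypothesis ix : independent_vectors P x.
(** The width [p + p] is that of the factors produced by [psd_factor]; in use, [B] is a factor of a
    covariance matrix. *)
Hypothesis hres : forall B : 'M[R]_(p, p + p),
  (forall k (U : 'M[R]_(p, k)), fnorm (B^T *m U) <= Num.sqrt V * fnorm U) ->
  ip B B <= V * p%:R ->
  let g w := ip B (resolvent z (X w) *m B) / p%:R in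
  Ex P (fun w => (g w - Ex P g) ^+ 2) <= V' / n%:R.

Let kap0 : 0 < kap := lt_le_trans ltr01 kap1.
Let nR : 0 < n%:R :> R.
Proof. by rewrite ltr0n (ltn_trans _ n2). Qed.
Let pR : 0 < p%:R :> R.
Proof. by rewrite ltr0n. Qed.
Let a1p : 0 < a1 := lt_le_trans ltr01 a1_ge1.
Let ni0 : 0 <= n%:R^-1 :> R.
Proof. by rewrite invr_ge0 ltW. Qed.

Let Q w := resolvent z (X w).
(** Normalised by n although n - 1 columns enter: adding the missing rank one term then gives back
    the full matrix. *)
Let A_ i w := n%:R^-1 *: (\sum_(j | j != i) x j w *m (x j w)^T) + z%:M.
Let Q_ i w := invmx (A_ i w).
Let lam i w := n%:R^-1 * ip (x i w) (Q_ i w *m x i w).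
Let tau i w := (1 + lam i w)^-1.

Let cQ w : coercive z (n%:R^-1 *: (X w *m (X w)^T) + z%:M) := gram_coercive z (X w).

Let cA i w : coercive z (A_ i w).
Proof.
by apply/coercive_psdD/psdZ => //; apply: psd_sum => j _; exact: psd_gram.
Qed.

Let QE i w : Q w = invmx (A_ i w + n%:R^-1 *: (x i w *m (x i w)^T)).
Proof.
rewrite /Q /resolvent mulmx_tr_sum_col (bigD1 i)//= scalerDr /A_; congr invmx.
by rewrite addrAC addrC addrA [in RHS]addrAC addrC.
Qed.

Let sQ w : (Q w)^T = Q w := coercive_inv_sym (cQ w).
Let sQ_ i w : (Q_ i w)^T = Q_ i w := coercive_inv_sym (cA i w).

Let rQ : random_mx Q.
Proof.
apply: rmx_inv => [w|]; first exact: (coercive_unit z0 (cQ w)).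
apply: rmx_add; last exact: rmx_cst.
by apply/rmx_scale/rmx_mul => //; exact: rmx_tr.
Qed.

Let rQ_others i : @random_mx _ (othersType x i) R p p (Q_ i).
Proof.
have rj j : j != i -> @random_mx _ (othersType x i) R p 1 (x j).
  by move=> ji a b; exact: others_coord.
apply: (@rmx_inv _ (othersType x i)) => [w|]; first exact: (coercive_unit z0 (cA i w)).
apply: (@rmx_add _ (othersType x i)); last exact: (@rmx_cst _ (othersType x i)).
apply: (@rmx_scale _ (othersType x i)) => a b.
rewrite (_ : (fun w => _) = (fun w => \sum_j if j != i then (x j w *m (x j w)^T) a b else 0)).
  apply: (@measurable_sum _ (othersType x i)) => j.
  have [ji|_] := boolP (j != i); last exact: measurable_cst.
  apply: (@rmx_mul _ (othersType x i)); first exact: rj.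
  by apply: (@rmx_tr _ (othersType x i)); exact: rj.
by apply/funext => w; rewrite summxE big_mkcond.
Qed.

Let rQ_ i : random_mx (Q_ i).
Proof. by apply: (others_random_mx _ ix); [exact: rmx_x|exact: rQ_others]. Qed.

Let ltk u : 0 <= u -> z^-1 * u <= kap * u.
Proof. by move=> u0; rewrite ler_wpM2r. Qed.

Let Q_norm w k (U : 'M[R]_(p, k)) : fnorm (Q w *m U) <= kap * fnorm U.
Proof. exact: le_trans (coercive_inv_norm z0 (cQ w) U) (ltk (fnorm_ge0 U)). Qed.

Let Q__norm i w k (U : 'M[R]_(p, k)) : fnorm (Q_ i w *m U) <= kap * fnorm U.
Proof. exact: le_trans (coercive_inv_norm z0 (cA i w) U) (ltk (fnorm_ge0 U)). Qed.

Let lam_ge0 i w : 0 <= lam i w.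
Proof. exact: (update_quad_ge0 _ z0 ni0 (cA i w)). Qed.

Let tau_bounds i w : 0 < tau i w <= 1.
Proof. exact: (update_tau _ z0 ni0 (cA i w)). Qed.

Let Qx i w : Q w *m x i w = tau i w *: (Q_ i w *m x i w).
Proof. by rewrite (QE i); exact: (invmx_update_mul _ z0 ni0 (cA i w)). Qed.

Let QQ_ i w : Q w - Q_ i w =
  - ((n%:R^-1 * tau i w) *: (Q_ i w *m x i w *m (Q_ i w *m x i w)^T)).
Proof. by rewrite {1}(QE i); exact: (invmx_update_sub _ z0 ni0 (cA i w)). Qed.

Let mx_x i : random_mx (x i) := rmx_x i.

Let mlam i : mfun (lam i).
Proof.
apply: measurable_funM; first exact: measurable_cst.
by apply: mfun_ip => //; apply: rmx_mul.
Qed.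

Let mtau i : mfun (tau i).
Proof.
apply: measurableT_comp; first exact: measurable_inv.
by apply: measurable_funD; [exact: measurable_cst|exact: mlam].
Qed.

Let n_half : n%:R <= 2 * (n.-1)%:R :> R.
Proof.
rewrite -natrM ler_nat; case: n n2 => [|[|k]]//= _.
by rewrite mul2n -addnn addSnnS leq_addl.
Qed.

Let card_others i : \sum_(j < n | j != i) 1 = (n.-1)%:R :> R.
Proof.
rewrite sumr_const; congr _%:R; rewrite -[in RHS](card_ord n).
have := cardC1 i; by rewrite card_ord => <-; apply: eq_card => j; rewrite !inE.
Qed.

Lemma ip_sub_le (u v : 'cV[R]_p) : ip (u - v) (u - v) <= 2 * ip u u + 2 * ip v v.
Proof. by have := ip_ge0 (u + v); rewrite !ip_lin (ipC v u); lra. Qed.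

Lemma weighted_mean_dist (I : finType) (J : pred I) (w : I -> R) (y : I -> 'cV[R]_p)
    (u : 'cV[R]_p) (W B : R) : 0 < W -> W = \sum_(j | J j) w j ->
  (forall j, J j -> 0 <= w j) -> (forall j, J j -> fnorm (u - y j) <= B) ->
  fnorm (u - W^-1 *: \sum_(j | J j) w j *: y j) <= B.
Proof.
move=> W0 WE w0 hB; have WN : W != 0 by rewrite gt_eqF.
have -> : u - W^-1 *: \sum_(j | J j) w j *: y j =
    W^-1 *: \sum_(j | J j) w j *: (u - y j).
  under [in RHS]eq_bigr do rewrite scalerBr.
  by rewrite sumrB -scaler_suml -WE scalerBr scalerA mulVf// scale1r.
rewrite fnormZ gtr0_norm ?invr_gt0// mulrC ler_pdivrMr//.
apply: (@le_trans _ _ (\sum_(j | J j) fnorm (w j *: (u - y j)))).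
  elim/big_ind2 : _ => [|u1 v1 u2 v2 h1 h2|j Jj] //; first by rewrite /fnorm ip0r sqrtr0.
  by apply: le_trans (fnormD _ _) _; exact: lerD.
rewrite WE mulr_sumr; apply: ler_sum => j Jj.
rewrite fnormZ ger0_norm ?w0// mulrC ler_wpM2r ?w0//; exact: hB.
Qed.

Let a4 := 2 * (2 + kap * (8 * K ^+ 2 + 4 * V * kap)).

(** [inv_mean_bound] with the columns x_j, j != i, and equal weights. The distance from m_i to their
    average is at most 2 K plus a fluctuation of mean square O(p / n). *)
Lemma Ex_mean_quad i : Ex P (fun w => ip (m i) (Q_ i w *m m i)) <= a4 /\
  integ P (fun w => ip (m i) (Q_ i w *m m i)).
Proof.
have n1R : 0 < (n.-1)%:R :> R by rewrite ltr0n -ltnS prednK// (ltn_trans _ n2).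
pose W : R := \sum_(j < n | j != i) n%:R^-1.
have WE : W = (n.-1)%:R / n%:R by rewrite -(card_others i) mulr_suml; apply: eq_bigr => j _; rewrite mul1r.
have W0 : 0 < W by rewrite WE divr_gt0.
have Wi : W^-1 = n%:R / (n.-1)%:R by rewrite WE invf_div.
have W2 : W^-1 <= 2 by rewrite Wi ler_pdivrMr.
pose fl w := (n.-1)%:R^-1 *: \sum_(j | j != i) (x j w - m j).
pose r0 := m i - W^-1 *: \sum_(j | j != i) n%:R^-1 *: m j.
have hr0 : ip r0 r0 <= 4 * K ^+ 2.
  have -> : 4 * K ^+ 2 = (2 * K) ^+ 2 by ring.
  rewrite -sqr_fnorm; apply: lerXn2r; rewrite ?nnegrE ?fnorm_ge0 ?mulr_ge0//.
  by apply: weighted_mean_dist.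
have rE w : m i - W^-1 *: \sum_(j | j != i) n%:R^-1 *: x j w = r0 - fl w.
  rewrite /r0 /fl sumrB scalerBr opprB addrA -!scaler_sumr !scalerA.
  have -> : W^-1 * n%:R^-1 = (n.-1)%:R^-1.
    by rewrite Wi mulrAC mulfV ?gt_eqF// mul1r.
  by rewrite subrK.
have [efl ifl] := Ex_mean_fluctuation (fun j => j != i) (n.-1)%:R^-1.
rewrite -/fl card_others in efl ifl.
have pt w : ip (m i) (Q_ i w *m m i) <=
    2 * (2 + kap * (2 * (4 * K ^+ 2))) + 4 * kap * ip (fl w) (fl w).
  apply: le_trans (inv_mean_bound (J := fun j => j != i) (w := fun=> n%:R^-1)
    (y := fun j => x j w) (W := W) (m i) z0 (cA i w).1 _ W0 _ _) _ => //.
    move=> u; rewrite /A_ mulmxDl mul_scalar_mx ipDr ipZr lerD2r.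
    rewrite -scalemxAl ipZr mulmx_suml ip_sumr mulr_sumr.
    by apply: ler_sum => j _; rewrite ip_outer_self ipC.
  rewrite rE; set f := fl w.
  have h : ip (r0 - f) (r0 - f) <= 2 * (4 * K ^+ 2) + 2 * ip f f.
    by apply: le_trans (ip_sub_le r0 f) _; lra.
  have h' := le_trans (ltk (ip_ge0 (r0 - f))) (ler_wpM2l (ltW kap0) h); lra.
have mq : mfun (fun w => ip (m i) (Q_ i w *m m i)).
  by apply: mfun_ip; [exact: rmx_cst|apply: rmx_mul => //; exact: rmx_cst].
have iB : integ P (fun w => 2 * (2 + kap * (2 * (4 * K ^+ 2))) + 4 * kap * ip (fl w) (fl w)).
  by apply: integD; [exact: integ_cst|exact: integZ].
have iq : integ P (fun w => ip (m i) (Q_ i w *m m i)).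
  apply: integ_dom iB mq _ => w; rewrite ger0_norm//.
  exact: (coercive_inv_psd z0 (cA i w)).2.
split => //; apply: le_trans (Ex_le iq iB pt) _.
rewrite ExD; [|exact: integ_cst|exact: integZ].
rewrite Ex_cst ExZ//.
have hp : p%:R <= 2 * kap * (n.-1)%:R.
  apply: le_trans pn _; rewrite -mulrA mulrCA ler_wpM2l// ltW//.
have h : Ex P (fun w => ip (fl w) (fl w)) <= 2 * kap * V.
  apply: le_trans efl _.
  rewrite expr2 -mulrA mulVf ?gt_eqF// mulr1 mulrCA mulrC.
  by rewrite ler_wpM2r// ler_pdivrMr.
have h' := ler_wpM2l (ltW kap0) h; rewrite /a4; lra.
Qed.

Let a2 := 8 * (a1 ^+ 2 + V).
Let a3 := 2 * V * kap ^+ 2 + 8 * kap ^+ 2 * a1 * V.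

Let integ_bounded (f : T -> R) (B : R) : mfun f -> (forall w, `|f w| <= B) -> integ P f.
Proof. by move=> mf hf; exact: integ_dom (integ_cst P B) mf hf. Qed.

Let mborel (F : 'cV[R]_p -> R) :
  @measurable_fun _ _ (g_sigma_algebraType [set A | exists i j, exists2 B : set R, measurable B &
    A = (fun M : 'cV[R]_p => M i j) @^-1` B]) R setT F ->
  forall A : set R, measurable A -> mx_borel (F @^-1` A).
Proof. by move=> mF A mA; have := mF measurableT A mA; rewrite setTI. Qed.

Let mcoord a : @measurable_fun _ _ (g_sigma_algebraType [set A | exists i j, exists2 B : set R, measurable B &
    A = (fun M : 'cV[R]_p => M i j) @^-1` B]) R setT (fun v : 'cV[R]_p => v a 0).
Proof. by move=> _ B mB; rewrite setTI; exact: mx_borel_coord. Qed.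

Let entryE (M : 'M[R]_p) a b : M a b = ip (delta_mx a 0 : 'cV[R]_p) (M *m delta_mx b 0).
Proof.
rewrite -colE ipE (bigD1 a)//= big_ord1 [delta_mx _ _ _ _]mxE !eqxx mul1r.
rewrite big1 ?addr0 => [|e /negbTE ea]; first by rewrite [in RHS]mxE.
by rewrite big_ord1 [delta_mx _ _ _ _]mxE ea mul0r.
Qed.

Let fnorm_delta a : fnorm (delta_mx a 0 : 'cV[R]_p) = 1.
Proof.
have -> : 1 = Num.sqrt 1 :> R by rewrite sqrtr1.
rewrite /fnorm; congr Num.sqrt.
have := entryE 1%:M a a; rewrite mul1mx => <-; by rewrite mxE eqxx.
Qed.

Let Q__entry i w a b : `|Q_ i w a b| <= kap.
Proof.
rewrite entryE; apply: le_trans (ip_le_fnorm _ _) _; rewrite fnorm_delta mul1r.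
by apply: le_trans (Q__norm _ _ _) _; rewrite fnorm_delta mulr1.
Qed.

(** The identity is exact, so the leave-one-out terms cancel without error in
    [Ex_equivalent_term]. *)
Lemma Ex_quad_others i (N : 'M[R]_p) :
  Ex P (fun w => ip (Q_ i w *m x i w) (N *m x i w)) =
  Ex P (fun w => \tr (N *m Sigma i *m Q_ i w)).
Proof.
pose F (k : 'I_p * 'I_p) (v : 'cV[R]_p) := v k.1 0 * v k.2 0.
pose g (k : 'I_p * 'I_p) w := (Q_ i w *m N) k.1 k.2.
have E w w' : ip (Q_ i w *m x i w') (N *m x i w') = \sum_k F k (x i w') * g k w.
  rewrite ip_mulml sQ_ mulmxA.
  rewrite -(pair_bigA _ (fun a b => F (a, b) (x i w') * g (a, b) w)) /=.
  rewrite ipE; apply: eq_bigr => a _; rewrite big_ord1 [(_ *m x i w') _ _]mxE mulr_sumr.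
  by apply: eq_bigr => b _; rewrite /F /g /=; ring.
have -> : (fun w => ip (Q_ i w *m x i w) (N *m x i w)) =
   (fun w => \sum_k F k (x i w) * g k w) by apply/funext => w; rewrite -E.
have rg : @random_mx _ (othersType x i) R p p (fun w => Q_ i w *m N).
  by apply: (@rmx_mul _ (othersType x i)); [exact: rQ_others|exact: (@rmx_cst _ (othersType x i))].
have mg k : mfun (g k) by apply: (others_random_mx (@rmx_x) ix rg).
have gb k w : `|g k w| <= kap * fnorm (col k.2 N).
  rewrite /g entryE -mulmxA -colE; apply: le_trans (ip_le_fnorm _ _) _.
  by rewrite fnorm_delta mul1r; exact: Q__norm.
have Ig k : integ P (g k) by apply: (integ_bounded (mg k) (gb k)).
have IF k : integ P (fun w => F k (x i w)) by exact: integ_entry2.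
rewrite (decouple (@rmx_x) ix (i := i))//; last 3 first.
- move=> k A mA; apply: mborel => //; apply: measurable_funM; exact: mcoord.
- by move=> k; exact: rg.
- move=> k; apply: (@integ_dom _ _ _ P (fun w => kap * fnorm (col k.2 N) * `|F k (x i w)|)).
  + by apply: integZ; exact: integ_abs.
  + by apply: measurable_funM; [exact: (integ_mfun (IF k))|exact: mg].
  + by move=> w; rewrite normrM mulrC ler_wpM2r.
congr (Ex P _); apply/funext => w.
transitivity (Ex P (fun w' => ip (x i w') (Q_ i w *m N *m x i w'))).
  by congr (Ex P _); apply/funext => w'; rewrite -E ip_mulml sQ_ mulmxA.
by rewrite -trace_Sigma mulmxA mxtrace_mulC !mulmxA -mulmxA mxtrace_mulC.
Qed.

(** The squared centred form is a polynomial in x_i with products of two entries of Q_i as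
    coefficients. Freezing Q_i leaves the deterministic case [quad_form_variance]. *)
Lemma Ex_quad_variance i :
  Ex P (fun w => (ip (x i w) (Q_ i w *m x i w) - \tr (Sigma i *m Q_ i w)) ^+ 2)
    <= a3 * p%:R /\
  integ P (fun w => (ip (x i w) (Q_ i w *m x i w) - \tr (Sigma i *m Q_ i w)) ^+ 2).
Proof.
pose I4 := (('I_p * 'I_p) * ('I_p * 'I_p))%type.
pose h (k : 'I_p * 'I_p) (v : 'cV[R]_p) := v k.1 0 * v k.2 0 - Sigma i k.1 k.2.
pose F (k : I4) (v : 'cV[R]_p) := h k.1 v * h k.2 v.
pose g (k : I4) w := Q_ i w k.1.1 k.1.2 * Q_ i w k.2.1 k.2.2.
have E1 w w' : ip (x i w') (Q_ i w *m x i w') - \tr (Sigma i *m Q_ i w) =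
    \sum_k h k (x i w') * Q_ i w k.1 k.2.
  rewrite -(pair_bigA _ (fun a b => h (a, b) (x i w') * Q_ i w a b)) /=.
  rewrite ipE /mxtrace -sumrB; apply: eq_bigr => a _.
  rewrite big_ord1 [(Q_ i w *m _) _ _]mxE mulr_sumr [(Sigma i *m _) _ _]mxE -sumrB.
  apply: eq_bigr => b _; rewrite /h /=.
  have -> : Q_ i w b a = Q_ i w a b by rewrite -[in LHS](sQ_ i w) mxE.
  by ring.
have E w w' : (ip (x i w') (Q_ i w *m x i w') - \tr (Sigma i *m Q_ i w)) ^+ 2 =
    \sum_k F k (x i w') * g k w.
  rewrite E1 expr2 big_distrlr /= pair_big /=; apply: eq_bigr => k _.
  by rewrite /F /g; ring.
have eqf : (fun w => (ip (x i w) (Q_ i w *m x i w) - \tr (Sigma i *m Q_ i w)) ^+ 2) =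
   (fun w => \sum_k F k (x i w) * g k w) by apply/funext => w; rewrite -E.
have rg := @rQ_others i.
have mg k : mfun (g k) by apply: measurable_funM; exact: rQ_.
have gb k w : `|g k w| <= kap * kap by rewrite normrM; apply: ler_pM.
have Ig k : integ P (g k) by apply: (integ_bounded (mg k) (gb k)).
have mF k : mfun (fun w => F k (x i w)).
  by apply: measurable_funM; apply: measurable_funB;
    [apply: measurable_funM; exact: rmx_x|exact: measurable_cst|
     apply: measurable_funM; exact: rmx_x|exact: measurable_cst].
have IF k : integ P (fun w => F k (x i w)).
  pose B := 1 + `|Sigma i k.1.1 k.1.2| + `|Sigma i k.2.1 k.2.2|.
  have B1 : 1 <= B by rewrite /B -addrA lerDl addr_ge0.
  apply: (@integ_entry_poly i _ (4 * B ^+ 2)) => // w.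
  have h1 k' : `|Sigma i k'.1 k'.2| <= B -> `|h k' (x i w)| <= B * (1 + fnorm (x i w) ^+ 2).
    move=> hB; apply: le_trans (ler_normB _ _) _; rewrite mulrDr mulr1 addrC; apply: lerD => //.
    apply: (@le_trans _ _ (fnorm (x i w) ^+ 2)); last by rewrite ler_peMl ?sqr_ge0.
    by rewrite normrM expr2; apply: ler_pM => //; exact: entry_le.
  have hb1 : `|Sigma i k.1.1 k.1.2| <= B by rewrite /B; have := normr_ge0 (Sigma i k.2.1 k.2.2); lra.
  have hb2 : `|Sigma i k.2.1 k.2.2| <= B by rewrite /B; have := normr_ge0 (Sigma i k.1.1 k.1.2); lra.
  rewrite normrM; apply: le_trans (ler_pM _ _ (h1 _ hb1) (h1 _ hb2)) _ => //.
  have -> : B * (1 + fnorm (x i w) ^+ 2) * (B * (1 + fnorm (x i w) ^+ 2)) =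
     B ^+ 2 * (1 + fnorm (x i w) ^+ 2) ^+ 2 by ring.
  rewrite (_ : 4 * B ^+ 2 * _ = B ^+ 2 * (4 * (1 + fnorm (x i w) ^+ 4))); last by ring.
  rewrite ler_wpM2l ?sqr_ge0//.
  have -> : fnorm (x i w) ^+ 4 = (fnorm (x i w) ^+ 2) ^+ 2 by rewrite -exprM.
  have := sqr_ge0 (fnorm (x i w) ^+ 2 - 1); have := sqr_ge0 (fnorm (x i w)); nra.
have IFg k : integ P (fun w => F k (x i w) * g k w).
  apply: (@integ_dom _ _ _ P (fun w => kap * kap * `|F k (x i w)|)).
  - by apply: integZ; exact: integ_abs.
  - by apply: measurable_funM; [exact: mF|exact: mg].
  - by move=> w; rewrite normrM mulrC ler_wpM2r.
rewrite eqf; split; last by apply: integ_sum.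
rewrite (decouple (@rmx_x) ix (i := i))//; last 2 first.
- move=> k A mA; apply: mborel => //; apply: measurable_funM; apply: measurable_funB;
  [apply: measurable_funM; exact: mcoord|exact: measurable_cst|
   apply: measurable_funM; exact: mcoord|exact: measurable_cst].
- move=> k; apply: (@measurable_funM _ (othersType x i)); exact: rg.
have e : (fun w => Ex P (fun w' => \sum_k F k (x i w') * g k w)) =
    (fun w => \sum_k Ex P (fun w' => F k (x i w')) * g k w).
  apply/funext => w; rewrite Ex_sum; last first.
    move=> k; have := integZ (g k w) (IF k); congr (integ P _); apply/funext => w'.
    exact: mulrC.
  apply: eq_bigr => k _; rewrite mulrC -ExZ//; congr (Ex P _); apply/funext => w'.
  exact: mulrC.
have -> : a3 * p%:R = Ex P (fun=> a3 * p%:R) by rewrite Ex_cst.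
apply: Ex_le; [|exact: integ_cst|].
  by rewrite e; apply: integ_sum => k; exact: integZ.
move=> w; apply: le_trans (quad_form_variance i z0 zk (cA i w)).
rewrite le_eqVlt; apply/orP; left; apply/eqP; congr (Ex P _); apply/funext => w'.
by rewrite -E.
Qed.

(** * Concentration of the leave-one-out quadratic forms around [delta] *)

Let delta i := n%:R^-1 * Ex P (fun w => \tr (cov i *m Q w)).

Let a6 := 4 * (a3 * kap + kap ^+ 2 * Km ^+ 2 * a4 + kap ^+ 6 * V ^+ 2 * a2 + kap ^+ 2 * V').

Let pn' : p%:R / n%:R <= kap.
Proof. by rewrite ler_pdivrMr. Qed.

Let invn_le1 : n%:R^-1 <= 1 :> R.
Proof. by rewrite invf_le1// ler1n (ltn_trans _ n2). Qed.

Let sqr4 (u v s t : R) :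
  (u + v + s + t) ^+ 2 <= 4 * (u ^+ 2 + v ^+ 2 + s ^+ 2 + t ^+ 2).
Proof.
have := sqr_ge0 (u - v); have := sqr_ge0 (u - s); have := sqr_ge0 (u - t).
have := sqr_ge0 (v - s); have := sqr_ge0 (v - t); have := sqr_ge0 (s - t); nra.
Qed.

Let mtrQ (N : 'M[R]_p) : mfun (fun w => \tr (N *m Q w)).
Proof. by apply/mfun_trace/rmx_mul => //; exact: rmx_cst. Qed.

Let mtrQ_ (N : 'M[R]_p) i : mfun (fun w => \tr (N *m Q_ i w)).
Proof. by apply/mfun_trace/rmx_mul => //; exact: rmx_cst. Qed.

Let tr_cov_Q_bounds i w : 0 <= \tr (cov i *m Q w) <= kap * (V * p%:R).
Proof.
have /andP[h1 h2] := trace_inv_le (cov_psd i) z0 (cQ w); rewrite h1 /=.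
apply: le_trans h2 _; apply: ler_pM => //; first by rewrite invr_ge0 ltW.
  have := trace_psd_ge0 (cov_psd i) (psd_gram (1%:M : 'M[R]_p)).
  by rewrite mul1mx trmx1 mulmx1.
exact: trace_cov_le.
Qed.

Let integ_tr_cov_Q i : integ P (fun w => \tr (cov i *m Q w)).
Proof.
apply: (integ_bounded (mtrQ _) (B := kap * (V * p%:R))) => w.
by have /andP[h1 h2] := tr_cov_Q_bounds i w; rewrite ger0_norm.
Qed.

Let delta_bounds i : 0 <= delta i <= kap ^+ 2 * a1.
Proof.
rewrite mulr_ge0//=; last first.
  by apply: Ex_ge0 => w; case/andP: (tr_cov_Q_bounds i w).
have h : Ex P (fun w => \tr (cov i *m Q w)) <= kap * (V * p%:R).
  rewrite -(Ex_cst P (kap * (V * p%:R))); apply: Ex_le => //; first exact: integ_cst.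
  by move=> w; case/andP: (tr_cov_Q_bounds i w).
apply: le_trans (ler_wpM2l ni0 h) _.
rewrite (_ : n%:R^-1 * _ = kap * V * (p%:R / n%:R)); last by ring.
apply: (@le_trans _ _ (kap * V * kap)); first by rewrite ler_wpM2l// mulr_ge0// ltW.
rewrite (_ : kap * V * kap = kap ^+ 2 * V); last by ring.
by rewrite ler_wpM2l ?sqr_ge0// /a1 lerDl sqr_ge0.
Qed.

Lemma Ex_cov_Q_variance i :
  Ex P (fun w => (n%:R^-1 * \tr (cov i *m Q w) - delta i) ^+ 2) <= kap ^+ 2 * V' / n%:R.
Proof.
have [B CE] := psd_factor (cov_psd i).
have hB k (U : 'M[R]_(p, k)) : fnorm (B^T *m U) <= Num.sqrt V * fnorm U.
  rewrite -ler_sqr ?nnegrE ?mulr_ge0 ?fnorm_ge0 ?sqrtr_ge0// exprMn (sqr_sqrtr V0).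
  rewrite !sqr_fnorm.
  have -> : ip (B^T *m U) (B^T *m U) = ip U (cov i *m U) by rewrite CE -mulmxA [RHS]ip_mulmr.
  apply: le_trans (ler_norm _) _; apply: le_trans (ip_le_fnorm _ _) _.
  by rewrite -sqr_fnorm expr2 mulrCA ler_wpM2l ?fnorm_ge0 ?cov_fnorm_le.
have hBB : ip B B <= V * p%:R.
  by rewrite /ip mxtrace_mulC -CE; exact: trace_cov_le.
have := hres hB hBB; set g := fun w => _ => hg.
have gE w : n%:R^-1 * \tr (cov i *m Q w) = p%:R / n%:R * g w.
  by rewrite (ip_fact _ CE) /g; field; rewrite !gt_eqF.
have dE : delta i = p%:R / n%:R * Ex P g.
  rewrite /delta -ExZ//.
  have -> : (fun w => n%:R^-1 * \tr (cov i *m Q w)) = (fun w => p%:R / n%:R * g w).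
    by apply/funext => w; rewrite gE.
  rewrite ExZ//.
  have -> : g = (fun w => p%:R^-1 * \tr (cov i *m Q w)).
    by apply/funext => w; rewrite (ip_fact _ CE) /g mulrC.
  exact: integZ.
have -> : (fun w => (n%:R^-1 * \tr (cov i *m Q w) - delta i) ^+ 2) =
   (fun w => (p%:R / n%:R) ^+ 2 * (g w - Ex P g) ^+ 2).
  by apply/funext => w; rewrite gE dE -mulrBr exprMn.
have mg : mfun g.
  have -> : g = (fun w => p%:R^-1 * \tr (cov i *m Q w)).
    by apply/funext => w; rewrite (ip_fact _ CE) /g mulrC.
  by apply: measurable_funM; [exact: measurable_cst|exact: mtrQ].
have gb w : 0 <= g w <= kap * V.
  have /andP[h1 h2] := tr_cov_Q_bounds i w; rewrite (ip_fact _ CE) in h1 h2.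
  by rewrite /g divr_ge0//= ler_pdivrMr// -mulrA.
have ig2 : integ P (fun w => (g w - Ex P g) ^+ 2).
  apply: (integ_bounded (B := (kap * V + `|Ex P g|) ^+ 2)).
    by apply/mfun_sqr/measurable_funB => //; exact: measurable_cst.
  move=> w; rewrite normrX; apply: lerXn2r; rewrite ?nnegrE ?addr_ge0 ?mulr_ge0 ?(ltW kap0)//.
  apply: le_trans (ler_normB _ _) _; rewrite lerD2r.
  by have /andP[h1 h2] := gb w; rewrite ger0_norm.
rewrite ExZ// -mulrA; apply: ler_pM => //.
  by apply: Ex_ge0 => w; exact: sqr_ge0.
by apply: lerXn2r; rewrite ?nnegrE ?divr_ge0// ltW.
Qed.

Let lam_delta_integ i : integ P (fun w => (lam i w - delta i) ^+ 2).
Proof.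
apply: (@integ_entry_poly i _ (2 * (kap ^+ 2 + delta i ^+ 2))).
  by apply/mfun_sqr/measurable_funB; [exact: mlam|exact: measurable_cst].
move=> w; rewrite ger0_norm ?sqr_ge0//.
have l1 : lam i w <= kap * fnorm (x i w) ^+ 2.
  rewrite /lam; apply: (@le_trans _ _ (1 * ip (x i w) (Q_ i w *m x i w))).
    by rewrite ler_wpM2r//; exact: (coercive_inv_psd z0 (cA i w)).2.
  rewrite mul1r; apply: le_trans (coercive_inv_le z0 (cA i w) _) _.
  by rewrite sqr_fnorm; exact: ltk (ip_ge0 _).
have l2 : lam i w ^+ 2 <= kap ^+ 2 * fnorm (x i w) ^+ 4.
  rewrite (_ : kap ^+ 2 * _ = (kap * fnorm (x i w) ^+ 2) ^+ 2); last by ring.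
  by apply: lerXn2r; rewrite ?nnegrE ?lam_ge0 // (mulr_ge0 (ltW kap0)) ?sqr_ge0.
have x4 : 0 <= fnorm (x i w) ^+ 4 by rewrite exprn_ge0 ?fnorm_ge0.
have d2 := sqr_ge0 (delta i); have k2 := sqr_ge0 kap.
have := sqr_ge0 (lam i w + delta i); nra.
Qed.

Lemma Ex_lam_delta i : Ex P (fun w => (lam i w - delta i) ^+ 2) <= a6 / n%:R.
Proof.
(* [t1] is the fluctuation of the form given Q_i, [t2] the share of the mean in Sigma_i, [t3] the
   effect of deleting column i, and [t4] the fluctuation of the trace. *)
pose t1 w := n%:R^-1 * (ip (x i w) (Q_ i w *m x i w) - \tr (Sigma i *m Q_ i w)).
pose t2 w := n%:R^-1 * ip (m i) (Q_ i w *m m i).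
pose t3 w := n%:R^-1 * \tr (cov i *m (Q_ i w - Q w)).
pose t4 w := n%:R^-1 * \tr (cov i *m Q w) - delta i.
have E w : lam i w - delta i = t1 w + t2 w + t3 w + t4 w.
  rewrite /t1 /t2 /t3 /t4 /lam mulmxBr raddfB /= cov_Sigma mulmxDl mxtraceD.
  have -> : \tr (m i *m (m i)^T *m Q_ i w) = ip (m i) (Q_ i w *m m i).
    by rewrite mxtrace_mulC ip_outer.
  ring.
have [e1 i1] := Ex_quad_variance i.
have [e2 i2] := Ex_mean_quad i.
have n2R : n%:R^-1 ^+ 2 <= n%:R^-1 :> R by rewrite expr2 ler_piMl.
have n2R0 : 0 <= n%:R^-1 ^+ 2 :> R := sqr_ge0 _.
have a10 : 0 <= a1 := ltW a1p.
have a30 : 0 <= a3 by rewrite /a3 addr_ge0// !mulr_ge0// ltW.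
have k2 := sqr_ge0 kap.
have It1 : integ P (fun w => t1 w ^+ 2).
  by under [X in integ P X]funext do rewrite exprMn; exact: integZ.
have B1 : Ex P (fun w => t1 w ^+ 2) <= a3 * kap / n%:R.
  under [X in Ex P X]funext do rewrite exprMn.
  rewrite ExZ//; apply: le_trans (ler_wpM2l n2R0 e1) _.
  rewrite (_ : _ * (a3 * p%:R) = a3 * (p%:R / n%:R) / n%:R); last by ring.
  by rewrite ler_wpM2r// ler_wpM2l.
have mq : mfun (fun w => ip (m i) (Q_ i w *m m i)) := integ_mfun i2.
have q0 w : 0 <= ip (m i) (Q_ i w *m m i) by exact: (coercive_inv_psd z0 (cA i w)).2.
have qb w : ip (m i) (Q_ i w *m m i) <= kap * (Km ^+ 2 * p%:R).
  apply: le_trans (coercive_inv_le z0 (cA i w) _) _.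
  apply: le_trans (ltk (ip_ge0 _)) _; rewrite ler_wpM2l ?(ltW kap0)//; exact: ip_mean_le.
have It2 : integ P (fun w => t2 w ^+ 2).
  apply: (integ_bounded (B := (n%:R^-1 * (kap * (Km ^+ 2 * p%:R))) ^+ 2)).
    by apply/mfun_sqr/measurable_funM => //; exact: measurable_cst.
  move=> w; have h0 : 0 <= t2 w by rewrite mulr_ge0.
  rewrite ger0_norm ?sqr_ge0//; apply: lerXn2r; rewrite ?nnegrE//.
    by apply: le_trans h0 _; rewrite ler_wpM2l.
  by rewrite ler_wpM2l.
have B2 : Ex P (fun w => t2 w ^+ 2) <= kap ^+ 2 * Km ^+ 2 * a4 / n%:R.
  (* Only the first moment of the form in m_i is known to be O(1). Since [t2] is bounded, its square
     is at most a constant times [t2], of mean O(1 / n). *)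
  have pt w : t2 w ^+ 2 <= kap ^+ 2 * Km ^+ 2 / n%:R * ip (m i) (Q_ i w *m m i).
    rewrite /t2 expr2 mulrACA -mulrA [leRHS]mulrAC.
    have h : n%:R^-1 * ip (m i) (Q_ i w *m m i) <= kap ^+ 2 * Km ^+ 2.
      apply: le_trans (ler_wpM2l ni0 (qb w)) _.
      rewrite (_ : _ * (kap * _) = kap * Km ^+ 2 * (p%:R / n%:R)); last by ring.
      rewrite (_ : kap ^+ 2 * Km ^+ 2 = kap * Km ^+ 2 * kap); last by ring.
      by rewrite ler_wpM2l// mulr_ge0 ?sqr_ge0// ltW.
    have h' := ler_wpM2r (mulr_ge0 ni0 (q0 w)) h.
    by move: h'; congr (_ <= _); ring.
  have i2' := integZ (kap ^+ 2 * Km ^+ 2 / n%:R) i2.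
  apply: le_trans (Ex_le It2 i2' pt) _; rewrite ExZ//.
  by rewrite [leRHS]mulrAC ler_wpM2l// mulr_ge0// mulr_ge0// sqr_ge0.
have pt3 w : `|t3 w| <= kap ^+ 2 * V / n%:R ^+ 2 * fnorm (x i w) ^+ 2.
  rewrite /t3 -opprB QQ_ opprK -scalemxAr mxtraceZ ip_outer normrM ger0_norm//.
  rewrite normrM ger0_norm; last first.
    by rewrite mulr_ge0//; case/andP: (tau_bounds i w) => h _; exact: ltW.
  have /andP[u0 u1] := tau_bounds i w.
  have h : `|ip (Q_ i w *m x i w) (cov i *m (Q_ i w *m x i w))| <= kap ^+ 2 * V * fnorm (x i w) ^+ 2.
    apply: le_trans (ip_le_fnorm _ _) _.
    apply: (@le_trans _ _ ((kap * fnorm (x i w)) * (V * (kap * fnorm (x i w))))); last first.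
      by rewrite le_eqVlt; apply/orP; left; apply/eqP; ring.
    apply: ler_pM; rewrite ?fnorm_ge0 ?Q__norm//.
    by apply: le_trans (cov_fnorm_le _ _) _; rewrite ler_wpM2l ?Q__norm.
  apply: (@le_trans _ _ (n%:R^-1 * (n%:R^-1 * 1 * (kap ^+ 2 * V * fnorm (x i w) ^+ 2)))).
    rewrite ler_wpM2l//; apply: ler_pM => //; first by rewrite mulr_ge0// ltW.
    by rewrite ler_wpM2l.
  rewrite le_eqVlt; apply/orP; left; apply/eqP; field; by rewrite gt_eqF.
have mt3 : mfun t3.
  apply: measurable_funM; first exact: measurable_cst.
  have -> : (fun w => \tr (cov i *m (Q_ i w - Q w))) =
     (fun w => \tr (cov i *m Q_ i w) - \tr (cov i *m Q w)).
    by apply/funext => w; rewrite mulmxBr raddfB.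
  by apply: measurable_funB; [exact: mtrQ_|exact: mtrQ].
have i4 := integ_entry4 i.
pose c3 := (kap ^+ 2 * V / n%:R ^+ 2) ^+ 2.
have pt3' w : t3 w ^+ 2 <= c3 * fnorm (x i w) ^+ 4.
  rewrite -(real_normK (num_real (t3 w))).
  rewrite (_ : c3 * _ = (kap ^+ 2 * V / n%:R ^+ 2 * fnorm (x i w) ^+ 2) ^+ 2); last by rewrite /c3; ring.
  apply: lerXn2r; rewrite ?nnegrE//; exact: le_trans (pt3 w).
have ic3 : integ P (fun w => c3 * fnorm (x i w) ^+ 4) by exact: integZ.
have It3 : integ P (fun w => t3 w ^+ 2).
  apply: integ_dom ic3 (mfun_sqr mt3) _ => w.
  by rewrite ger0_norm ?sqr_ge0.
have B3 : Ex P (fun w => t3 w ^+ 2) <= kap ^+ 6 * V ^+ 2 * a2 / n%:R.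
  apply: le_trans (Ex_le It3 ic3 pt3') _; rewrite ExZ//.
  have c30 : 0 <= c3 by exact: sqr_ge0.
  apply: le_trans (ler_wpM2l c30 (Ex_fnorm4_le i)) _; rewrite -/a2 /c3.
  rewrite (_ : _ * (a2 * _) = kap ^+ 4 * V ^+ 2 * a2 * (p%:R / n%:R) ^+ 2 * n%:R^-1 ^+ 2); last first.
    by field; rewrite gt_eqF.
  have a20 : 0 <= a2 by rewrite mulr_ge0// addr_ge0 ?sqr_ge0.
  have f0 : 0 <= kap ^+ 4 * V ^+ 2 * a2.
    by rewrite mulr_ge0// mulr_ge0 ?sqr_ge0// exprn_ge0// ltW.
  have h2 : (p%:R / n%:R) ^+ 2 <= kap ^+ 2.
    by apply: lerXn2r; rewrite ?nnegrE ?divr_ge0// ltW.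
  rewrite (_ : kap ^+ 6 * V ^+ 2 * a2 = kap ^+ 4 * V ^+ 2 * a2 * kap ^+ 2); last by ring.
  apply: ler_pM => //; last by rewrite ler_wpM2l.
  by rewrite mulr_ge0// sqr_ge0.
have B4 := Ex_cov_Q_variance i.
have It4 : integ P (fun w => t4 w ^+ 2).
  apply: (integ_bounded (B := (kap * (V * p%:R) + `|delta i|) ^+ 2)).
    apply/mfun_sqr/measurable_funB; last exact: measurable_cst.
    by apply: measurable_funM; [exact: measurable_cst|exact: mtrQ].
  move=> w; have /andP[h1 h2] := tr_cov_Q_bounds i w.
  rewrite normrX; apply: lerXn2r; rewrite ?nnegrE ?addr_ge0//; first exact: le_trans h2.
  apply: le_trans (ler_normB _ _) _; rewrite lerD2r ger0_norm ?mulr_ge0//.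
  by apply: le_trans h2; rewrite ler_piMl.
have iS : integ P (fun w => 4 * (t1 w ^+ 2 + t2 w ^+ 2 + t3 w ^+ 2 + t4 w ^+ 2)).
  by apply: integZ; apply: integD => //; apply: integD => //; apply: integD.
have ptS w : (lam i w - delta i) ^+ 2 <= 4 * (t1 w ^+ 2 + t2 w ^+ 2 + t3 w ^+ 2 + t4 w ^+ 2).
  by rewrite E; exact: sqr4.
apply: le_trans (Ex_le (lam_delta_integ i) iS ptS) _.
rewrite ExZ; last by apply: integD => //; apply: integD => //; apply: integD.
rewrite ExD//; last by apply: integD => //; apply: integD.
rewrite ExD//; last by apply: integD.
rewrite ExD//.
rewrite (_ : a6 / n%:R = 4 * (a3 * kap / n%:R + kap ^+ 2 * Km ^+ 2 * a4 / n%:R +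
  kap ^+ 6 * V ^+ 2 * a2 / n%:R + kap ^+ 2 * V' / n%:R)); last by rewrite /a6; ring.
rewrite ler_wpM2l//.
by apply: lerD => //; apply: lerD => //; apply: lerD.
Qed.

(** * Deterministic equivalents *)

Hypothesis Km0 : 0 <= Km.

Let Dl := kap ^+ 2 * a1.
Let a5 := 2 * (2 * (1 + Dl) + 4 * kap * K ^+ 2).

Let Dl0 : 0 <= Dl.
Proof. by rewrite mulr_ge0 ?sqr_ge0// ltW. Qed.

Let K20 : 0 <= K ^+ 2 := sqr_ge0 K.

Let a50 : 0 <= a5.
Proof.
have h := mulr_ge0 (ltW kap0) K20.
by have := Dl0; rewrite /a5; lra.
Qed.

(** The damping now uses the means m_j themselves, because Sigma_j dominates m_j m_j^T. As e <= Dl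
    and J contains at least half of the indices, the total weight is at least 1 / (2 (1 + Dl)). *)
Lemma quad_mean_tildeQ i (J : pred 'I_n) (e : 'rV[R]_n) :
  (forall j, 0 <= e 0 j <= Dl) -> n%:R <= 2 * \sum_(j < n | J j) 1 :> R ->
  ip (m i) (tildeQ_on Sigma z J e *m m i) <= a5.
Proof.
move=> he hJ.
have e0 j : 0 <= e 0 j by case/andP: (he j).
pose v j := n%:R^-1 * (1 + e 0 j)^-1.
have v0 j : 0 <= v j by rewrite mulr_ge0// invr_ge0 addr_ge0.
pose W := \sum_(j | J j) v j.
have D1 : 0 < 1 + Dl by rewrite ltr_pwDl.
have hW : (2 * (1 + Dl))^-1 <= W.
  apply: (@le_trans _ _ (n%:R^-1 * (1 + Dl)^-1 * \sum_(j < n | J j) 1)); last first.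
    rewrite mulr_sumr; apply: ler_sum => j _; rewrite mulr1 ler_wpM2l// lef_pV2 ?posrE ?ltr_pwDl//.
    by rewrite lerD2l; case/andP: (he j).
  rewrite invfM mulrAC ler_wpM2r ?invr_ge0 ?(ltW D1)// ler_pdivlMl//.
  by rewrite ler_pdivrMr// mulrC.
have W0 : 0 < W by apply: lt_le_trans hW; rewrite invr_gt0 mulr_gt0.
have hWi : W^-1 <= 2 * (1 + Dl).
  by rewrite -[leRHS]invrK lef_pV2 ?posrE// invr_gt0 mulr_gt0.
have cT := tildeQ_coercive z second_moment_psd J e0.
apply: le_trans (inv_mean_bound (J := J) (w := v) (y := m) (W := W) (m i) z0 cT.1 _ W0 _ _) _ => //.
  move=> u; rewrite mulmxDl mul_scalar_mx ipDr ipZr lerD2r.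
  rewrite -scalemxAl ipZr mulmx_suml ip_sumr mulr_sumr.
  apply: ler_sum => j _; rewrite -scalemxAl ipZr mulrA ler_wpM2l//.
  have -> : ip u (second_moment P (x j) *m u) = ip u (cov j *m u) + ip u (m j) ^+ 2.
    by rewrite -/(Sigma j) cov_Sigma mulmxDl ipDr ip_outer_self (ipC (m j)).
  by rewrite lerDr; exact: (cov_psd j).2.
set r := m i - _.
have hr : ip r r <= 4 * K ^+ 2.
  have -> : 4 * K ^+ 2 = (2 * K) ^+ 2 by ring.
  rewrite -sqr_fnorm; apply: lerXn2r; rewrite ?nnegrE ?fnorm_ge0 ?mulr_ge0//.
  by apply: weighted_mean_dist.
have := le_trans (ltk (ip_ge0 r)) (ler_wpM2l (ltW kap0) hr); rewrite /a5; lra.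
Qed.

Let dv : 'rV[R]_n := \row_i delta i.
Let Qt := tildeQ Sigma z dv.

Let dvE i : dv 0 i = delta i.
Proof. by rewrite mxE. Qed.

Let dv_bounds i : 0 <= dv 0 i <= Dl.
Proof. by rewrite dvE. Qed.

Let dv0 i : 0 <= dv 0 i.
Proof. by case/andP: (dv_bounds i). Qed.

Let card_all : n%:R <= 2 * \sum_(j < n | predT j) 1 :> R.
Proof. by rewrite sumr_const card_ord ler_peMl// ?ler1n// ltW. Qed.

Let card_but i : n%:R <= 2 * \sum_(j < n | j != i) 1 :> R.
Proof. by rewrite card_others. Qed.

Let tildeQ_norm J (e : 'rV[R]_n) k (U : 'M[R]_(p, k)) : (forall j, 0 <= e 0 j) ->
  fnorm (tildeQ_on Sigma z J e *m U) <= kap * fnorm U.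
Proof.
move=> e0; have cT := tildeQ_coercive z second_moment_psd J e0.
exact: le_trans (coercive_inv_norm z0 cT U) (ltk (fnorm_ge0 U)).
Qed.

(** From z |Qt m|^2 <= <m, Qt m> <= a5: bounded, although |m| may be of order sqrt p. *)
Let Qt_mean i : fnorm (Qt *m m i) <= Num.sqrt (kap * a5).
Proof.
have cT := tildeQ_coercive z second_moment_psd predT dv0.
rewrite -ler_sqr ?nnegrE ?fnorm_ge0 ?sqrtr_ge0// sqr_fnorm sqr_sqrtr; last first.
  by rewrite mulr_ge0// ltW.
have h := cT.2 (Qt *m m i); rewrite mulmxA mulmxV ?(coercive_unit z0 cT)// mul1mx in h.
have h2 := quad_mean_tildeQ i dv_bounds card_all.
have h3 : ip (Qt *m m i) (m i) <= a5 by rewrite ipC; exact: h2.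
have h4 := le_trans h h3; rewrite mulrC -ler_pdivlMr// in h4.
by apply: le_trans h4 _; rewrite mulrC; exact: ltk.
Qed.

Let Q_entry w a b : `|Q w a b| <= kap.
Proof.
rewrite entryE; apply: le_trans (ip_le_fnorm _ _) _; rewrite fnorm_delta mul1r.
by apply: le_trans (Q_norm _ _) _; rewrite fnorm_delta mulr1.
Qed.

Let integ_tr (Y : T -> 'M[R]_p) (M : 'M[R]_p) : random_mx Y ->
  (forall w a b, `|Y w a b| <= kap) -> integ P (fun w => \tr (M *m Y w)).
Proof.
move=> rY hY.
have -> : (fun w => \tr (M *m Y w)) = (fun w => \sum_a \sum_b M a b * Y w b a).
  by apply/funext => w; apply: eq_bigr => a _; rewrite mxE.
apply: integ_sum => a; apply: integ_sum => b; apply: integZ.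
by apply: (integ_bounded (B := kap)) => [|w]; [exact: rY|exact: hY].
Qed.

Let integ_trQ M : integ P (fun w => \tr (M *m Q w)).
Proof. by apply: integ_tr. Qed.

Let integ_trQ_ M i : integ P (fun w => \tr (M *m Q_ i w)).
Proof. by apply: integ_tr. Qed.

Let rn : R := (Num.sqrt n%:R)^-1.

Let rn0 : 0 < rn.
Proof. by rewrite invr_gt0 sqrtr_gt0. Qed.

Let rn_sqr : n%:R^-1 = rn ^+ 2.
Proof. by rewrite exprVn sqr_sqrtr// ltW. Qed.

Let rn1 : rn <= 1.
Proof. by rewrite -ler_sqr ?nnegrE ?(ltW rn0)// expr1n -rn_sqr. Qed.

Let rn_p : rn * Num.sqrt p%:R <= Num.sqrt kap.
Proof.
rewrite /rn ler_pdivrMl ?sqrtr_gt0// -sqrtrM; last exact: ltW.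
by rewrite ler_wsqrtr// mulrC.
Qed.

Let a7 := kap ^+ 2 * Num.sqrt (a2 * a6) +
  a1 * (kap ^+ 3 * V + kap ^+ 2 * Num.sqrt (kap * a5) * Km * Num.sqrt kap).

Section EquivalentTerm.
Variables (D : 'M[R]_p) (beta : R).
Hypothesis beta0 : 0 <= beta.
Hypothesis hD : forall U : 'cV[R]_p, fnorm (D *m U) <= beta * fnorm U.

Let N := D *m Qt.

Let N_norm (U : 'cV[R]_p) : fnorm (N *m U) <= beta * (kap * fnorm U).
Proof.
rewrite -mulmxA; apply: le_trans (hD _) _; rewrite ler_wpM2l//; exact: tildeQ_norm.
Qed.

Let sd i := (1 + delta i)^-1.

Let sd_bounds i : 0 < sd i <= 1.
Proof.
have d0 : 0 <= delta i by case/andP: (delta_bounds i).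
by rewrite invr_gt0 ltr_pwDl//= invf_le1 ?ltr_pwDl// lerDl.
Qed.

Let sd_tau i w : `|sd i - tau i w| <= `|lam i w - delta i|.
Proof.
have d0 : 0 <= delta i by case/andP: (delta_bounds i).
have l0 := lam_ge0 i w.
have /andP[s0 s1] := sd_bounds i; have /andP[t0 t1] := tau_bounds i w.
have -> : sd i - tau i w = (lam i w - delta i) * (sd i * tau i w).
  by rewrite /sd /tau; field; rewrite !gt_eqF// ltr_pwDl.
rewrite normrM ler_piMr// ger0_norm ?mulr_ge0 ?(ltW s0) ?(ltW t0)//.
by rewrite -[leRHS]mulr1; apply: ler_pM => //; exact: ltW.
Qed.

Let c1 := n%:R^-1 * beta *
  (kap ^+ 3 * V + kap ^+ 2 * Num.sqrt (kap * a5) * Km * Num.sqrt p%:R).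

(** Sigma_i is split into covariance and mean. In the mean part [N *m m i] is bounded through
    [Qt_mean], so a single factor |m_i|, of order sqrt p, remains. *)
Let tr_update_le i w :
  `|\tr (N *m Sigma i *m Q w) - \tr (N *m Sigma i *m Q_ i w)| <= c1 * fnorm (x i w) ^+ 2.
Proof.
rewrite -raddfB -mulmxBr /= QQ_ mulmxN raddfN /= normrN -scalemxAr mxtraceZ ip_outer.
have /andP[t0 t1] := tau_bounds i w.
rewrite normrM ger0_norm ?mulr_ge0 ?(ltW t0)//.
set y := Q_ i w *m x i w.
have hy : fnorm y <= kap * fnorm (x i w) by exact: Q__norm.
have y0 := fnorm_ge0 y; have x0 := fnorm_ge0 (x i w); have k0 := ltW kap0.
have bk : 0 <= beta * kap by rewrite mulr_ge0.
have kx : 0 <= kap * fnorm (x i w) by rewrite mulr_ge0.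
have h1 : `|ip y (N *m (cov i *m y))| <=
    (kap * fnorm (x i w)) * (beta * kap * V * (kap * fnorm (x i w))).
  apply: le_trans (ip_le_fnorm _ _) _; apply: ler_pM; rewrite ?fnorm_ge0//.
  apply: le_trans (N_norm _) _; rewrite -!mulrA ler_wpM2l// ler_wpM2l//.
  by apply: le_trans (cov_fnorm_le _ _) _; rewrite ler_wpM2l.
have h2 : `|ip y (N *m m i) * ip (m i) y| <=
    (kap * fnorm (x i w)) * (beta * Num.sqrt (kap * a5)) *
    (Km * Num.sqrt p%:R * (kap * fnorm (x i w))).
  rewrite normrM; apply: ler_pM => //.
    apply: le_trans (ip_le_fnorm _ _) _; apply: ler_pM; rewrite ?fnorm_ge0//.
    by rewrite -mulmxA; apply: le_trans (hD _) _; rewrite ler_wpM2l.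
  by apply: le_trans (ip_le_fnorm _ _) _; apply: ler_pM; rewrite ?fnorm_ge0.
have E : ip y (N *m Sigma i *m y) = ip y (N *m (cov i *m y)) + ip y (N *m m i) * ip (m i) y.
  rewrite cov_Sigma -mulmxA mulmxDl mulmxDr ipDr; congr (_ + _).
  have -> : m i *m (m i)^T *m y = ip (m i) y *: m i.
    rewrite -mulmxA; have -> : (m i)^T *m y = (ip (m i) y)%:M.
      by rewrite [LHS]mx11_scalar /ip /mxtrace big_ord1.
    by rewrite mul_mx_scalar.
  by rewrite -scalemxAr ipZr mulrC.
rewrite E; set h3 := ip _ _ in h1 E *; set h4 := ip _ _ * _ in h2 E *.
apply: (@le_trans _ _ (n%:R^-1 * 1 * (kap * fnorm (x i w) * (beta * kap * V * (kap * fnorm (x i w)))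
   + kap * fnorm (x i w) * (beta * Num.sqrt (kap * a5)) *
       (Km * Num.sqrt p%:R * (kap * fnorm (x i w)))))); last first.
  by rewrite le_eqVlt /c1; apply/orP; left; apply/eqP; ring.
apply: ler_pM => //; first by rewrite mulr_ge0// ltW.
  by rewrite ler_wpM2l.
by apply: le_trans (ler_normD _ _) _; exact: lerD.
Qed.

(** [f1] exchanges Q for Q_i, [f2] and [f3] have equal means by independence, and [f4] exchanges the
    random weight tau for its limit, at a cost bounded by Cauchy-Schwarz and [Ex_lam_delta]. *)
Lemma Ex_equivalent_term i :
  `|Ex P (fun w => sd i * \tr (N *m Sigma i *m Q w) - ip (Q w *m x i w) (N *m x i w))|
    <= a7 * beta * p%:R * rn /\
  integ P (fun w => sd i * \tr (N *m Sigma i *m Q w) - ip (Q w *m x i w) (N *m x i w)).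
Proof.
pose f1 w := \tr (N *m Sigma i *m Q w) - \tr (N *m Sigma i *m Q_ i w).
pose f2 w := \tr (N *m Sigma i *m Q_ i w).
pose f3 w := ip (Q_ i w *m x i w) (N *m x i w).
pose f4 w := (sd i - tau i w) * f3 w.
have k0 := ltW kap0.
have bk : 0 <= beta * kap ^+ 2 by rewrite mulr_ge0 ?sqr_ge0.
have E w : sd i * \tr (N *m Sigma i *m Q w) - ip (Q w *m x i w) (N *m x i w) =
    sd i * f1 w + (sd i * f2 w - sd i * f3 w) + f4 w.
  by rewrite Qx ipZl /f4 /f3 /f1 /f2; ring.
have f3b w : `|f3 w| <= beta * kap ^+ 2 * fnorm (x i w) ^+ 2.
  apply: le_trans (ip_le_fnorm _ _) _.
  rewrite (_ : _ * fnorm (x i w) ^+ 2 = (kap * fnorm (x i w)) * (beta * (kap * fnorm (x i w)))); last by ring.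
  by apply: ler_pM; rewrite ?fnorm_ge0.
have mf3 : mfun f3.
  by apply: mfun_ip; apply: rmx_mul => //; exact: rmx_cst.
have ix2 := integ_fnorm2 i.
have if3 : integ P f3 by apply: integ_dom (integZ (beta * kap ^+ 2) ix2) mf3 f3b.
have if1 : integ P f1 by apply: integB; [exact: integ_trQ|exact: integ_trQ_].
have if2 : integ P f2 by exact: integ_trQ_.
have mf4 : mfun f4.
  apply: measurable_funM => //; apply: measurable_funB; [exact: measurable_cst|exact: mtau].
pose g w := fnorm (x i w) ^+ 2.
have g0 w : 0 <= g w by exact: sqr_ge0.
pose h w := `|lam i w - delta i|.
have f4b w : `|f4 w| <= beta * kap ^+ 2 * (h w * g w).
  rewrite normrM (_ : _ * (h w * g w) = h w * (beta * kap ^+ 2 * g w)); last by ring.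
  by apply: ler_pM => //; exact: sd_tau.
have mg : mfun g by exact/mfun_sqr/mfun_fnorm_x.
have mh : mfun h.
  by apply: measurableT_comp => //; apply: measurable_funB; [exact: mlam|exact: measurable_cst].
have ig2 : integ P (fun w => g w ^+ 2).
  by have := integ_entry4 i; congr (integ P _); apply/funext => w; rewrite /g -exprM.
have h2E : (fun w => h w ^+ 2) = (fun w => (lam i w - delta i) ^+ 2).
  by apply/funext => w; rewrite /h real_normK ?num_real.
have ih2 : integ P (fun w => h w ^+ 2) by rewrite h2E; exact: lam_delta_integ.
have ihg := integ_prod mh mg ih2 ig2.
have if4 : integ P f4 by apply: integ_dom (integZ (beta * kap ^+ 2) ihg) mf4 f4b.
have -> : (fun w => sd i * \tr (N *m Sigma i *m Q w) - ip (Q w *m x i w) (N *m x i w)) =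
   (fun w => sd i * f1 w + (sd i * f2 w - sd i * f3 w) + f4 w).
  by apply/funext => w; rewrite E.
have is1 := integZ (sd i) if1; have is2 := integZ (sd i) if2; have is3 := integZ (sd i) if3.
have is23 := integB is2 is3; have is123 := integD is1 is23.
split; last exact: integD.
rewrite ExD// ExD// ExB// !ExZ// /f3 Ex_quad_others subrr addr0.
have e1 : `|Ex P f1| <= c1 * (a1 * p%:R).
  apply: le_trans (Ex_abs if1) _.
  apply: le_trans (Ex_le (integ_abs if1) (integZ c1 ix2) (tr_update_le i)) _.
  rewrite ExZ// Ex_fnorm2 ler_wpM2l ?trace_Sigma_le//.
  rewrite /c1 mulr_ge0// ?mulr_ge0// addr_ge0//; first by rewrite mulr_ge0// exprn_ge0.
  by rewrite mulr_ge0 ?sqrtr_ge0// mulr_ge0// mulr_ge0 ?sqr_ge0 ?sqrtr_ge0.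
have hg0 : 0 <= Ex P (fun w => h w * g w) by apply: Ex_ge0 => w; exact: mulr_ge0 (normr_ge0 _) (g0 w).
have a20 : 0 <= a2 by rewrite mulr_ge0// addr_ge0 ?sqr_ge0.
have a60 : 0 <= a6.
  have := le_trans (Ex_ge0 P (fun w => sqr_ge0 (lam i w - delta i))) (Ex_lam_delta i).
  by rewrite pmulr_lge0 ?invr_gt0.
have ehg : Ex P (fun w => h w * g w) <= Num.sqrt (a2 * a6) * p%:R * rn.
  rewrite -ler_sqr ?nnegrE//; last first.
    by rewrite mulr_ge0 ?(ltW rn0)// mulr_ge0 ?sqrtr_ge0.
  apply: le_trans (Ex_CS mh mg ih2 ig2) _.
  have -> : (Num.sqrt (a2 * a6) * p%:R * rn) ^+ 2 = (a6 / n%:R) * (a2 * p%:R ^+ 2).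
    transitivity (Num.sqrt (a2 * a6) ^+ 2 * (p%:R ^+ 2 * rn ^+ 2)); first by ring.
    by rewrite (sqr_sqrtr (mulr_ge0 a20 a60)) rn_sqr; ring.
  rewrite h2E.
  apply: ler_pM; [by apply: Ex_ge0 => w; exact: sqr_ge0|by apply: Ex_ge0 => w; exact: sqr_ge0| |].
    exact: Ex_lam_delta.
  apply: le_trans (Ex_fnorm4_le i); rewrite le_eqVlt; apply/orP; left; apply/eqP.
  by congr (Ex P _); apply/funext => w; rewrite /g -exprM.
have e4 : `|Ex P f4| <= beta * kap ^+ 2 * (Num.sqrt (a2 * a6) * p%:R * rn).
  apply: le_trans (Ex_abs if4) _.
  apply: le_trans (Ex_le (integ_abs if4) (integZ (beta * kap ^+ 2) ihg) f4b) _.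
  by rewrite ExZ// ler_wpM2l.
have /andP[s0 s1] := sd_bounds i.
apply: le_trans (ler_normD _ _) _.
have e1' : `|sd i * Ex P f1| <= c1 * (a1 * p%:R).
  by rewrite normrM (ger0_norm (ltW s0)); apply: le_trans e1; rewrite ler_piMl.
apply: le_trans (lerD e1' e4) _.
have h3 : c1 * (a1 * p%:R) <= beta * p%:R * a1 *
    (kap ^+ 3 * V + kap ^+ 2 * Num.sqrt (kap * a5) * Km * Num.sqrt kap) * rn.
  rewrite /c1 rn_sqr (_ : _ * (a1 * p%:R) = beta * p%:R * a1 *
    (rn * (kap ^+ 3 * V) + kap ^+ 2 * Num.sqrt (kap * a5) * Km * (rn * Num.sqrt p%:R)) * rn); last by ring.
  rewrite ler_wpM2r ?(ltW rn0)// ler_wpM2l//; first by rewrite !mulr_ge0// ltW.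
  apply: lerD; first by rewrite ler_piMl// mulr_ge0// exprn_ge0.
  by rewrite ler_wpM2l// mulr_ge0// mulr_ge0 ?sqr_ge0 ?sqrtr_ge0.
by apply: le_trans (lerD h3 (lexx _)) _; rewrite le_eqVlt /a7; apply/orP; left; apply/eqP; ring.
Qed.

End EquivalentTerm.

(** * Bias of the trace and the approximate fixed point equation *)

Let Ex_trace_equivalent (D : 'M[R]_p) (beta : R) : 0 <= beta ->
  (forall U : 'cV[R]_p, fnorm (D *m U) <= beta * fnorm U) ->
  `|Ex P (fun w => \tr (D *m Q w)) - \tr (D *m Qt)| <= a7 * beta * p%:R * rn.
Proof.
move=> beta0 hD.
pose f i w := (1 + delta i)^-1 * \tr (D *m Qt *m Sigma i *m Q w) -
  ip (Q w *m x i w) (D *m Qt *m x i w).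
have hf i := Ex_equivalent_term beta0 hD i.
(* The resolvent identity for Qt and Q, with X X^T expanded into its columns, pairs each weighted
   Sigma_i with x_i x_i^T. *)
have E w : \tr (D *m Q w) - \tr (D *m Qt) = n%:R^-1 * \sum_i f i w.
  rewrite -raddfB -mulmxBr /= -opprB /Qt /tildeQ /tildeQ_on.
  rewrite (invmx_sub (coercive_unit z0 (tildeQ_coercive z second_moment_psd predT dv0))
    (coercive_unit z0 (cQ w))).
  rewrite -/(resolvent z (X w)) -/(Q w) -/(tildeQ_on Sigma z predT dv) -/Qt.
  rewrite opprD addrACA subrr addr0 -scalerBr mulmx_tr_sum_col -sumrB.
  rewrite -scalemxAr -scalemxAl mulmxN linearN /= -scalemxAr mxtraceZ -mulrN; congr (_ * _).
  rewrite mulmx_sumr mulmx_suml mulmx_sumr -[RHS]opprK; congr (- _).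
  rewrite raddf_sum -sumrN; apply: eq_bigr => i _ /=.
  rewrite mulmxBr mulmxBl mulmxBr raddfB /= dvE /f opprB.
  rewrite -scalemxAr -scalemxAl -scalemxAr mxtraceZ !mulmxA; congr (_ - _).
  have xQ : (x i w)^T *m Q w = (Q w *m x i w)^T by rewrite trmx_mul sQ.
  by rewrite -/(x i w) -/Qt -mulmxA xQ -mulmxA ip_outer.
have If : integ P (fun w => \sum_i f i w) by apply: integ_sum => i; exact: (hf i).2.
rewrite -(Ex_cst P (\tr (D *m Qt))) -ExB//; last exact: integ_cst.
under [X in Ex P X]funext do rewrite E.
rewrite ExZ// Ex_sum; last by move=> i; exact: (hf i).2.
rewrite normrM (ger0_norm ni0) ler_pdivrMl//.
apply: le_trans (ler_norm_sum _ _ _) _.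
apply: (@le_trans _ _ (\sum_(i < n) (a7 * beta * p%:R * rn))).
  by apply: ler_sum => i _; exact: (hf i).1.
by rewrite sumr_const card_ord mulr_natl.
Qed.

Let a70 : 0 <= a7.
Proof.
rewrite addr_ge0// ?(mulr_ge0 (sqr_ge0 _)) ?sqrtr_ge0// mulr_ge0 ?(ltW a1p)// addr_ge0//.
  by rewrite mulr_ge0// exprn_ge0// ltW.
by rewrite mulr_ge0 ?sqrtr_ge0// mulr_ge0// mulr_ge0 ?sqr_ge0 ?sqrtr_ge0.
Qed.

Let rn_n : n%:R^-1 <= rn.
Proof. by rewrite rn_sqr expr2 ler_piMl// ltW. Qed.

Let a8 := a7 * V * kap + a5 + kap ^+ 3 * V * a1.

(** Three errors: E tr (C_i Q) is replaced by tr (C_i Qt), index i is removed from Qt, and the mean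
    part of Sigma_i, absent from [delta] but present in the equation, contributes m_i^T Qm m_i /
    n. *)
Let Ex_delta_equation i :
  `|dv 0 i - n%:R^-1 * \tr (Sigma i *m tildeQ_on Sigma z (fun j => j != i) dv)|
    <= a8 * rn.
Proof.
set Qm := tildeQ_on _ _ _ _.
have cT := tildeQ_coercive z second_moment_psd predT dv0.
have cTm := tildeQ_coercive z second_moment_psd (fun j => j != i) dv0.
have k0 := ltW kap0.
have e1 : `|n%:R^-1 * (Ex P (fun w => \tr (cov i *m Q w)) - \tr (cov i *m Qt))| <= a7 * V * kap * rn.
  rewrite normrM (ger0_norm ni0).
  have h := @Ex_trace_equivalent (cov i) V V0 (fun U => cov_fnorm_le i U).
  apply: le_trans (ler_wpM2l ni0 h) _.
  rewrite [leLHS](_ : _ = a7 * V * (p%:R / n%:R) * rn); last by ring.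
  by rewrite ler_wpM2r ?(ltW rn0)// ler_wpM2l// mulr_ge0.
have e2 : `|n%:R^-1 * ip (m i) (Qm *m m i)| <= a5 * rn.
  rewrite ger0_norm; last by rewrite mulr_ge0//; exact: (coercive_inv_psd z0 cTm).2.
  rewrite mulrC; apply: ler_pM => //; first exact: (coercive_inv_psd z0 cTm).2.
  exact: quad_mean_tildeQ.
have QtE : Qt - Qm = - ((n%:R^-1 * (1 + delta i)^-1) *: (Qt *m Sigma i *m Qm)).
  rewrite /Qt /Qm /tildeQ /tildeQ_on invmx_sub; last 2 first.
  - exact: (coercive_unit z0 cT).
  - exact: (coercive_unit z0 cTm).
  rewrite -!/(tildeQ_on _ _ _ _) opprD addrACA subrr addr0 -scalerBr.
  have -> : \sum_(j < n | j != i) (1 + dv 0 j)^-1 *: Sigma j -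
      \sum_(j < n | predT j) (1 + dv 0 j)^-1 *: Sigma j = - ((1 + dv 0 i)^-1 *: Sigma i).
    by rewrite [X in _ - X](bigD1 i)//= opprD addrCA subrr addr0.
  by rewrite dvE scalerN mulmxN mulNmx scalerA -scalemxAr -scalemxAl.
have sT : Qt^T = Qt := coercive_inv_sym cT.
have sm : Qm^T = Qm := coercive_inv_sym cTm.
have e3 : `|n%:R^-1 * (\tr (cov i *m Qt) - \tr (cov i *m Qm))| <= kap ^+ 3 * V * a1 * rn.
  rewrite -raddfB -mulmxBr /= QtE mulmxN raddfN /= -scalemxAr mxtraceZ.
  rewrite mulrN normrN normrM (ger0_norm ni0) normrM.
  have /andP[s0 s1] : 0 < (1 + delta i)^-1 <= 1.
    have d0 : 0 <= delta i by case/andP: (delta_bounds i).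
    by rewrite invr_gt0 ltr_pwDl//= invf_le1 ?ltr_pwDl// lerDl.
  rewrite (ger0_norm (mulr_ge0 ni0 (ltW s0))).
  have h : `|\tr (cov i *m (Qt *m Sigma i *m Qm))| <= kap ^+ 2 * V * (a1 * p%:R).
    have [G SE] := psd_factor (second_moment_psd i).
    rewrite !mulmxA mxtrace_mulC !mulmxA mxtrace_mulC (ip_fact _ SE).
    apply: le_trans (ip_le_fnorm _ _) _.
    apply: (@le_trans _ _ (kap ^+ 2 * V * ip G G)); last first.
      rewrite ler_wpM2l ?mulr_ge0 ?sqr_ge0//.
      by rewrite /ip mxtrace_mulC -SE; exact: trace_Sigma_le.
    rewrite -sqr_fnorm (_ : _ * fnorm G ^+ 2 = fnorm G * (kap * (V * (kap * fnorm G)))); last by ring.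
    rewrite ler_wpM2l ?fnorm_ge0// -!mulmxA.
    apply: le_trans (tildeQ_norm _ _ dv0) _; rewrite ler_wpM2l//.
    apply: le_trans (cov_fnorm_le _ _) _; rewrite ler_wpM2l//.
    exact: tildeQ_norm.
  have h2 : n%:R^-1 * (1 + delta i)^-1 <= rn by apply: le_trans rn_n; rewrite ler_piMr// ltW.
  apply: le_trans (ler_wpM2l ni0 (ler_pM _ _ h2 h)) _ => //.
    by rewrite mulr_ge0// ltW.
  rewrite [leLHS](_ : _ = kap ^+ 2 * V * a1 * (p%:R / n%:R) * rn); last by ring.
  rewrite (_ : kap ^+ 3 * V * a1 = kap ^+ 2 * V * a1 * kap); last by ring.
  rewrite ler_wpM2r ?(ltW rn0)// ler_wpM2l// !mulr_ge0 ?(ltW a1p)//.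
have -> : dv 0 i - n%:R^-1 * \tr (Sigma i *m Qm) =
   n%:R^-1 * (Ex P (fun w => \tr (cov i *m Q w)) - \tr (cov i *m Qt)) +
   n%:R^-1 * (\tr (cov i *m Qt) - \tr (cov i *m Qm)) - n%:R^-1 * ip (m i) (Qm *m m i).
  have -> : \tr (Sigma i *m Qm) = \tr (cov i *m Qm) + ip (m i) (Qm *m m i).
    by rewrite cov_Sigma mulmxDl mxtraceD; congr (_ + _); rewrite mxtrace_mulC ip_outer.
  by rewrite dvE /delta; ring.
apply: le_trans (ler_normB _ _) _.
have h := ler_normD (n%:R^-1 * (Ex P (fun w => \tr (cov i *m Q w)) - \tr (cov i *m Qt)))
   (n%:R^-1 * (\tr (cov i *m Qt) - \tr (cov i *m Qm))).
rewrite /a8; lra.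
Qed.

Let a9 := a7 + kap ^+ 2 * a1 * ((1 + Dl) * (a8 / (1 - Num.sqrt (Dl / (1 + Dl))))).

(** E Q is compared with Qt at [dv], then [dv] with the exact solution by stability. The condition
    on [a8] makes the defect at most 1, as stability demands. *)
Lemma Ex_trace_resolvent_bias (e : 'rV[R]_n) : delta_equation Sigma z e ->
  a8 <= Num.sqrt n%:R ->
  `|Ex P (fun w => p%:R^-1 * \tr (Q w)) - p%:R^-1 * \tr (tildeQ Sigma z e)| <= a9 * rn.
Proof.
move=> [e0 he] ha8.
have k0 := ltW kap0.
have eb i : 0 <= e 0 i <= Dl.
  rewrite e0 /= he.
  have cT := tildeQ_coercive z second_moment_psd (fun j => j != i) e0.
  have /andP[_ h] := trace_inv_le (second_moment_psd i) z0 cT.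
  apply: le_trans (ler_wpM2l ni0 h) _.
  have h2 : z^-1 * \tr (Sigma i) <= kap * (a1 * p%:R).
    apply: ler_pM => //; first by rewrite invr_ge0 ltW.
      have := trace_psd_ge0 (second_moment_psd i) (psd_gram (1%:M : 'M[R]_p)).
      by rewrite mul1mx trmx1 mulmx1.
    exact: trace_Sigma_le.
  apply: le_trans (ler_wpM2l ni0 h2) _.
  rewrite [leLHS](_ : _ = kap * a1 * (p%:R / n%:R)); last by ring.
  rewrite (_ : Dl = kap * a1 * kap); last by rewrite /Dl; ring.
  by rewrite ler_wpM2l// mulr_ge0// ltW.
have eps1 : a8 * rn <= 1 by rewrite ler_pdivrMr ?mul1r// sqrtr_gt0.
have st := fixed_point_stability z0 second_moment_psd dv_bounds eb he Ex_delta_equation eps1.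
set eta := _ * (a8 * rn / _) in st.
have eta0 : 0 <= eta by apply: le_trans (st (Ordinal (ltn_trans (ltnSn 0) n2))).
have h1 : `|\tr Qt - \tr (tildeQ Sigma z e)| <= eta * (kap ^+ 2 * (a1 * p%:R)).
  rewrite -raddfB /= (tildeQ_sub z0 second_moment_psd predT dv0 e0) mxtraceZ.
  rewrite normrM (ger0_norm ni0) ler_pdivrMl//.
  rewrite raddf_sum; apply: le_trans (ler_norm_sum _ _ _) _.
  rewrite mulr_natl -[X in _ *+ X](card_ord n) -sumr_const; apply: ler_sum => j _.
  rewrite /= mxtraceZ normrM; apply: ler_pM => //.
    rewrite normrM normfV; have /andP[d1 _] := dv_bounds j; have d2 := e0 j.
    rewrite (@ger0_norm _ ((1 + dv 0 j) * _)); last by rewrite mulr_ge0// addr_ge0.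
    apply: le_trans (st j); rewrite ler_piMr// invf_le1; last by rewrite mulr_gt0// ltr_pwDl.
    by rewrite -[leLHS]mulr1; apply: ler_pM; rewrite ?ler01// lerDl.
  have cT := tildeQ_coercive z second_moment_psd predT dv0.
  have cTe := tildeQ_coercive z second_moment_psd predT e0.
  apply: le_trans (trace_inv2_le (second_moment_psd j) z0 cT cTe) _.
  have S0 : 0 <= \tr (Sigma j).
    have := trace_psd_ge0 (second_moment_psd j) (psd_gram (1%:M : 'M[R]_p)).
    by rewrite mul1mx trmx1 mulmx1.
  have zi0 : 0 <= z^-1 by rewrite invr_ge0 ltW.
  apply: ler_pM => //; [by rewrite mulr_ge0|by rewrite expr2 ler_pM|exact: trace_Sigma_le].
have h2 : `|Ex P (fun w => \tr (Q w)) - \tr Qt| <= a7 * p%:R * rn.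
  have hI (U : 'cV[R]_p) : fnorm ((1%:M : 'M[R]_p) *m U) <= 1 * fnorm U by rewrite mul1mx mul1r.
  have := Ex_trace_equivalent ler01 hI; rewrite mul1mx mulr1.
  by under [X in Ex P X]funext do rewrite mul1mx.
have iQ : integ P (fun w => \tr (Q w)).
  by have := integ_trQ 1%:M; under [X in integ P X]funext do rewrite mul1mx.
rewrite ExZ// -mulrBr normrM ger0_norm ?invr_ge0// ler_pdivrMl//.
apply: le_trans (ler_distD (\tr Qt) _ _) _.
apply: le_trans (lerD h2 h1) _.
by rewrite le_eqVlt /a9 /eta; apply/orP; left; apply/eqP; ring.
Qed.

Lemma trace_resolvent_bias (e : 'rV[R]_n) : delta_equation Sigma z e ->
  bias_constant V Km V' K kap <= Num.sqrt n%:R ->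
  `|Ex P (fun w => p%:R^-1 * \tr (resolvent z (X w))) -
    p%:R^-1 * \tr (tildeQ Sigma z e)| <= bias_constant V Km V' K kap / Num.sqrt n%:R.
Proof.
change (bias_constant V Km V' K kap) with (Num.max 0 (Num.max a8 a9)).
move=> he hn; have h8 : a8 <= Num.sqrt n%:R by apply: le_trans hn; rewrite !le_max lexx orbT.
apply: le_trans (Ex_trace_resolvent_bias he h8) _.
by rewrite ler_wpM2r ?(ltW rn0)// !le_max lexx !orbT.
Qed.

End ColumnMoments.

(** * Conclusion *)

Lemma expectation_Ex d (T : measurableType d) (R : realType) (P : probability T R)
  (f : T -> R) : integ P f -> ('E_P[f] = (Ex P f)%:E)%E.
Proof. by move=> fi; rewrite unlock -Ex_EFin. Qed.

(** If s t >= 2 B the bias is at most t / 2, so a deviation t from [a] forces one of t / 2 from the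
    mean. For smaller t the exponential prefactor makes the bound at least 1. *)
Lemma concentrated_around_shift d (T : measurableType d) (R : realType)
    (P : probability T R) (f : T -> R) (a s B C c q : R) :
  0 < s -> 0 <= B -> 0 <= C -> 0 < c -> 0 < q -> mfun f -> integ P f ->
  concentrated_around P (fun w => s * f w) (Ex P (fun w => s * f w)) (decay C c q) ->
  `|Ex P f - a| <= B / s ->
  concentrated_around P f a (fun t =>
    decay ((C + expR 1) * expR ((2 * B) `^ q / (c * 2 `^ q))) (c * 2 `^ q) q (s * t)).
Proof.
move=> s0 B0 C0 c0 q0 mf fi hc hB t t0; set L := expR (_ / _).
have cq : 0 < c * 2 `^ q by rewrite mulr_gt0// powR_gt0.
have L1 : 1 <= L.
  by rewrite -[leLHS]expR0 ler_expR divr_ge0 ?powR_ge0// ltW.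
have [h|h] := leP (2 * B) (s * t).
  have st0 : 0 < s * t / 2 by rewrite divr_gt0// mulr_gt0.
  apply: (@le_trans _ _ (decay C c q (s * t / 2))%:E); last first.
    rewrite lee_fin decay_div// ?mulr_ge0 ?(ltW s0) ?(ltW t0)//.
    apply: decay_le => //.
    rewrite -[leLHS]mulr1; apply: ler_pM => //.
    by rewrite lerDl expR_ge0.
  apply: le_trans (hc _ st0); apply: le_measure.
  - rewrite inE; apply: measurable_ge_set; apply: measurableT_comp => //.
    by apply: measurable_funB => //; exact: measurable_cst.
  - rewrite inE; apply: measurable_ge_set; apply: measurableT_comp => //.
    apply: measurable_funB; last exact: measurable_cst.
    by apply: measurable_funM => //; exact: measurable_cst.
  - move=> w /= hw; rewrite ExZ// -mulrBr normrM (gtr0_norm s0).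
    rewrite -mulrA ler_wpM2l ?(ltW s0)//.
    have hB2 : `|Ex P f - a| <= t / 2.
      by apply: le_trans hB _; rewrite ler_pdivrMr//; lra.
    have := ler_distD (Ex P f) (f w) a; lra.
apply: le_trans (probability_le1 P _) _.
  apply: measurable_ge_set; apply: measurableT_comp => //.
  by apply: measurable_funB => //; exact: measurable_cst.
rewrite lee_fin /decay -mulrA -expRD.
have e1 : 1 <= C + expR 1 by have := expR_ge1Dx (1 : R); lra.
rewrite -[leLHS]mulr1; apply: ler_pM => //.
rewrite -[leLHS]expR0 ler_expR subr_ge0 ler_wpM2r ?invr_ge0 ?(ltW cq)//.
have st0 : 0 <= s * t by rewrite mulr_ge0 ?(ltW s0) ?(ltW t0).
have B20 : 0 <= 2 * B by rewrite mulr_ge0.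
by rewrite ge0_ler_powR ?nnegrE ?(ltW q0) ?(ltW h).
Qed.

(** Jensen for the norm: |m|^2 = E <m, x> <= |m| E |x|. *)
Lemma fnorm_mean_le d (T : measurableType d) (R : realType) (P : probability T R)
    p n (X : T -> 'M[R]_(p, n)) (C c q V : R) i :
  (0 < p)%N -> random_mx X ->
  convexly_concentrated P (@frobenius R p n) X (decay C c q) ->
  (forall W : T -> R, mfun W -> concentrated P W (decay C c q) -> moment_bound P V W) ->
  integ P (fun w => fnorm (col i (X w))) /\
  fnorm (mx_expectation P (fun w => col i (X w))) <= Ex P (fun w => fnorm (col i (X w))).
Proof.
move=> p0 rX cX hV; set x := fun w => col i (X w); set m := mx_expectation P x.
have iN : integ P (fun w => fnorm (x w)).
  have h1 (u : 'cV[R]_p) : fnorm ((1%:M : 'M[R]_p)^T *m u) <= 1 * fnorm u.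
    by rewrite trmx1 mul1mx mul1r.
  have [h _ _ _ _] := quad_norm_moments rX cX hV i ltr01 h1.
  by move: h; congr (integ P _); apply/funext => w; rewrite trmx1 mul1mx.
split => //; have [->|N0] := eqVneq (fnorm m) 0; first by apply: Ex_ge0 => w; exact: fnorm_ge0.
have Np : 0 < fnorm m by rewrite lt_def N0 fnorm_ge0.
rewrite -(ler_pM2l Np) -expr2 sqr_fnorm -ExZ//.
rewrite -[X in X <= _](ExpipE rX cX hV).
apply: Ex_le; [exact: (integ_ip rX cX hV)|exact: integZ|move=> w].
exact: le_trans (ler_norm _) (ip_le_fnorm _ _).
Qed.

Theorem corollary3p15 (R : realType) (C0 c0 q K kappa : R)
    (hC0 : expR 1 <= C0) (hc0 : 0 < c0) (hq : 0 < q) (hK : 0 < K)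
    (hkappa : 0 < kappa) :
  exists (n0 : nat) (C c : R), [/\ (2 <= n0)%N, expR 1 <= C, 0 < c &
    forall (n p : nat), (n0 <= n)%N -> (1 <= p)%N -> p%:R <= kappa * n%:R ->
    forall z0 z : R, 0 < z0 -> z0 < 1 -> z0^-1 <= kappa -> z0 < z ->
    forall (d : measure_display) (T : measurableType d) (P : probability T R)
      (X : T -> 'M[R]_(p, n)) (mo : 'I_n -> 'cV[R]_p) (s : 'cV[R]_p),
    let x (i : 'I_n) (w : T) : 'cV[R]_p := col i (X w) in
    let Sigma (i : 'I_n) : 'M[R]_p := second_moment P (x i) in
    let S (w : T) : 'M[R]_p := n%:R^-1 *: (X w *m (X w)^T) in
    let m_F (w : T) : R := stieltjes (spectral_distribution (S w)) (- z) in
    random_mx X ->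
    (forall i, mx_expectation P (x i) = mo i + s) ->
    (* (A1) *)
    independent_vectors P x ->
    (* (A2) *)
    convexly_concentrated P (@frobenius R p n) X
      (fun t => C0 * expR (- (t `^ q / c0))) ->
    (* (A3) or (A3') *)
    (forall i, ('E_P[fun w => frobenius (x i w)] <= (K * Num.sqrt p%:R)%:E)%E /\
               frobenius (mo i) <= K) \/
    [/\ 2 <= q, frobenius s <= K * Num.sqrt p%:R &
        forall i, frobenius (mo i) <= K] ->
    forall delta' : 'rV[R]_n, unique (delta_equation Sigma z) delta' ->
    (forall w, m_F w = p%:R^-1 * \tr (invmx (S w + z%:M))) /\
    concentrated_around P m_F (p%:R^-1 * \tr (tildeQ Sigma z delta'))
      (fun t => C * expR (- ((Num.sqrt (n%:R / ln n%:R) * t) `^ q / c)))].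
Proof.
have C01 : 1 <= C0 by have := expR_ge1Dx (1 : R); lra.
have [V V1 hV] := concentrated_variance C01 hc0 hq.
have V0 : 0 < V by apply: lt_le_trans V1.
(* The 2 accommodates |mo_i| + |s| <= K + K sqrt p under (A3'); (A3) gives K sqrt p. *)
pose Km := 2 * K; have Km0 : 0 <= Km by rewrite mulr_ge0// ltW.
have M11 : 1 <= 1 + (V + Km ^+ 2) by rewrite lerDl addr_ge0 ?sqr_ge0 ?(ltW V0).
have sV0 : 0 < Num.sqrt V by rewrite sqrtr_gt0.
(* The trace concentration is used twice: with operator bound sqrt V for factors of the covariances,
   which feeds the bias, and with bound 1 for the identity, which gives the final tail. *)
have [C2 [c2 [C21 c20 hC2]]] := resolvent_trace_concentrated C01 hc0 hq M11 hkappa sV0.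
have [V' V'1 hV'] := concentrated_variance C21 c20 hq.
have [C3 [c3 [C31 c30 hC3]]] := resolvent_trace_concentrated C01 hc0 hq M11 hkappa (@ltr01 R).
have [V3 _ hV3] := concentrated_variance C31 c30 hq.
have [C4 [c4 [C34 c40 hC4]]] := concentrated_mean_tail C31 c30 hq.
pose B := bias_constant V Km V' K kappa.
have B0 : 0 <= B by rewrite /B /bias_constant le_max lexx.
(* The second term gives B <= sqrt n, the condition of the bias estimate; the third gives n >= e, so
   that ln n >= 1. *)
pose n0 := (2 + Num.bound (B ^+ 2) + Num.bound (expR 1 : R))%N.
pose c := c4 * 2 `^ q; pose C := (C4 + expR 1) * expR ((2 * B) `^ q / c).
have C40 : 0 <= C4 by lra.
have cp : 0 < c by rewrite mulr_gt0// powR_gt0.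
have CE : expR 1 <= C.
  rewrite -[leLHS]mulr1; apply: ler_pM; rewrite ?expR_ge0//; first by rewrite lerDr.
  by rewrite -[leLHS]expR0 ler_expR divr_ge0 ?powR_ge0// ltW.
exists n0, C, c; split => // n p n0n p1 pn z0 z z00 z01 z0k z0z d T P X mo s x Sigma S m_F.
move=> rX hmean ix cX hA3 delta' [hd _].
have n2 : (1 < n)%N by apply: leq_trans n0n; rewrite /n0 -addnA leq_addr.
have npos : (0 < n)%N by exact: ltn_trans n2.
have nR : 0 < n%:R :> R by rewrite ltr0n.
have zp : 0 < z by apply: lt_trans z0z.
have zk : z^-1 <= kappa by apply: le_trans z0k; rewrite lef_pV2 ?posrE// ltW.
have kap1 : 1 <= kappa.
  by apply: le_trans z0k; rewrite invf_ge1// ltW.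
have mE w : m_F w = p%:R^-1 * \tr (resolvent z (X w)).
  apply: stieltjes_resolvent; last exact: (coercive_unit zp (gram_coercive z (X w))).
  by rewrite linearZ /= trmx_mul trmxK.
split; first by move=> w; rewrite mE.
have hVX W := hV d T P W.
have hmo i : fnorm (mo i) <= K.
  by rewrite -frobeniusE; case: hA3 => [h|[_ _ h]]; [case: (h i)|exact: h].
have sp1 : 1 <= Num.sqrt p%:R :> R by rewrite -[leLHS]sqrtr1 ler_wsqrtr// ler1n.
have hm i : fnorm (mx_expectation P (x i)) <= Km * Num.sqrt p%:R.
  have KK : K * Num.sqrt p%:R <= Km * Num.sqrt p%:R.
    by have := mulr_ge0 (ltW hK) (sqrtr_ge0 (p%:R : R)); rewrite /Km; lra.
  case: hA3 => [h|[_ hs _]].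
    have [iN hN] := fnorm_mean_le i p1 rX cX hVX.
    apply: le_trans hN _; apply: le_trans KK.
    have [h1 _] := h i; rewrite -lee_fin -expectation_Ex//.
    by under eq_fun do rewrite -frobeniusE.
  rewrite hmean; apply: le_trans (fnormD _ _) _; rewrite frobeniusE in hs.
  have h2 : K <= K * Num.sqrt p%:R by rewrite ler_peMr// ltW.
  by have := hmo i; rewrite /Km; lra.
have hmm i j : fnorm (mx_expectation P (x i) - mx_expectation P (x j)) <= 2 * K.
  rewrite !hmean opprD addrACA subrr addr0.
  apply: le_trans (fnormB _ _) _; have := hmo i; have := hmo j; lra.
have hX : Ex P (fun w => fnorm (X w)) <= (1 + (V + Km ^+ 2)) * Num.sqrt (n * p)%:R.
  exact: (Ex_fnorm_mx_le rX cX hVX V1 hm).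
have rR : random_mx (fun w => resolvent z (X w)).
  apply: rmx_inv => [w|]; first exact: (coercive_unit zp (gram_coercive z (X w))).
  apply: rmx_add; last exact: rmx_cst.
  by apply/rmx_scale/rmx_mul => //; exact: rmx_tr.
have sn0 : 0 < Num.sqrt n%:R :> R by rewrite sqrtr_gt0.
have hres (G : 'M[R]_(p, p + p)) :
  (forall k (U : 'M[R]_(p, k)), fnorm (G^T *m U) <= Num.sqrt V * fnorm U) ->
  ip G G <= V * p%:R ->
  let g w := ip G (resolvent z (X w) *m G) / p%:R in
  Ex P (fun w => (g w - Ex P g) ^+ 2) <= V' / n%:R.
  move=> hG GG; pose g w := ip G (resolvent z (X w) *m G) / p%:R.
  change (Ex P (fun w => (g w - Ex P g) ^+ 2) <= V' / n%:R).
  have mg : mfun g.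
    apply: measurable_funM; last exact: measurable_cst.
    by apply: mfun_ip; [exact: rmx_cst|apply: rmx_mul => //; exact: rmx_cst].
  have GG' : ip G G <= Num.sqrt V ^+ 2 * p%:R by rewrite sqr_sqrtr// ltW.
  have cc := hC2 n p d T P X z _ G npos p1 zp zk rX cX hX hG GG'.
  have mg' : mfun (fun w => Num.sqrt n%:R * g w).
    by apply: measurable_funM => //; exact: measurable_cst.
  have mb := hV' d T P _ mg' cc.
  have sn' : 0 < (Num.sqrt n%:R)^-1 :> R by rewrite invr_gt0.
  rewrite -[Num.sqrt n%:R]invrK in mb.
  have [_ _ _ _] := moment_bound_scale sn' mb.
  by rewrite exprVn sqr_sqrtr// ltW.
have BB : B ^+ 2 <= n%:R.
  apply: le_trans (ltW (archi_boundP (sqr_ge0 B))) _; rewrite ler_nat.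
  by apply: leq_trans n0n; rewrite /n0 addnAC leq_addl.
have Bn : B <= Num.sqrt n%:R.
  by rewrite -(ger0_norm B0) -sqrtr_sqr ler_wsqrtr.
have bias := trace_resolvent_bias rX cX hVX V1 p1 hm (ltW hK) hmm n2 pn kap1 zp zk ix hres Km0 hd Bn.
have fE : m_F = (fun w => p%:R^-1 * \tr (resolvent z (X w))).
  by apply/funext => w; rewrite mE.
rewrite -fE -/B in bias.
have mf : mfun m_F.
  by rewrite fE; apply: measurable_funM; [exact: measurable_cst|exact: mfun_trace].
have h1n k (U : 'M[R]_(p, k)) : fnorm ((1%:M : 'M[R]_p)^T *m U) <= 1 * fnorm U.
  by rewrite trmx1 mul1mx mul1r.
have h11 : ip (1%:M : 'M[R]_p) 1%:M <= 1 ^+ 2 * p%:R.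
  by rewrite expr1n mul1r /ip trmx1 mul1mx mxtrace1.
have cc : concentrated P (fun w => Num.sqrt n%:R * m_F w) (decay C3 c3 q).
  have := hC3 n p d T P X z _ 1%:M npos p1 zp zk rX cX hX h1n h11.
  congr (concentrated P _ _); apply/funext => w.
  by rewrite mE /ip trmx1 mul1mx mulmx1 [_ / _]mulrC.
have msf : mfun (fun w => Num.sqrt n%:R * m_F w).
  by apply: measurable_funM => //; exact: measurable_cst.
have tail := hC4 d T P _ msf cc.
have [isf _ _ _ _] := hV3 d T P _ msf cc.
have fi : integ P m_F.
  have := integZ (Num.sqrt n%:R)^-1 isf; congr (integ P _); apply/funext => w.
  by rewrite mulKf// gt_eqF.
have main := concentrated_around_shift sn0 B0 C40 c40 hq mf fi tail bias.
move=> t t0; apply: le_trans (main t t0) _; rewrite lee_fin.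
(* As ln n >= 1, replacing sqrt n by sqrt (n / ln n) only enlarges the bound. *)
have ln1 : 1 <= ln n%:R :> R.
  rewrite -[leLHS](expRK (1 : R)) ler_ln ?posrE ?expR_gt0//.
  apply: le_trans (ltW (archi_boundP (expR_ge0 1))) _; rewrite ler_nat.
  by apply: leq_trans n0n; rewrite /n0 leq_addl.
apply: decay_anti => //; first exact: le_trans (expR_ge0 1) CE; first exact: ltW.
  by rewrite mulr_ge0 ?sqrtr_ge0// ltW.
rewrite ler_wpM2r ?(ltW t0)// ler_wsqrtr//.
by rewrite ler_pdivrMr ?(lt_le_trans ltr01 ln1)// ler_peMr// ltW.
Qed.
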